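(* Let $\mathbf{m}=(m_1,\dots,m_n)^\top$ with $m_i>0$, and suppose that $\{\boldsymbol{\xi}_t\}_{t\ge0}$ is an $\mathbb{R}^n$-valued Lévy process under a measure $\widetilde{\mathbb{P}}$ with $\widetilde{\mathbb{P}}(\boldsymbol{\xi}_t\in d\mathbf{x})=g_t(\mathbf{x})\,d\mathbf{x}$, where $g_t(\mathbf{x})=\prod_{i=1}^n f_{m_it}(x_i)$. Let $R_t=\mathbf{1}\cdot\boldsymbol{\xi}_t$. Then $\{\Theta_t(R_t)^{-1}\}_{0\le t<1}$ is a Radon–Nikodym density process that defines the measure change $$\left.\frac{d\widetilde{\mathbb{P}}}{d\mathbb{P}}\right|_{\mathcal{F}^{\boldsymbol{\xi}}_t}=\Theta_t(R_t)^{-1},\qquad 0\le t<1,$$ and $\{\boldsymbol{\xi}_t\}_{0\le t<1}$ is a GLP under $\mathbb{P}$ with generating law $\nu$ and activity parameter $\mathbf{m}$.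
   Context: For $\mathbf{x}\in\mathbb{R}^n$ write $\mathbf{1}\cdot\mathbf{x}=\sum_i x_i$. All processes are càdlàg; $\mathcal{F}^{\boldsymbol{\xi}}_t=\sigma(\boldsymbol{\xi}_u:0\le u\le t)$. Lévy random bridge (LRB). Let $T>0$, let $\nu$ be a probability law on $\mathbb{R}$, and let $\{X_t\}$ be a real-valued Lévy process such that $X_t$ has a density $f_t$ for all $t\in(0,T]$, with $f_t(x)=\int_{\mathbb{R}}f_{t-s}(x-y)f_s(y)\,dy$ for $0<s<t\le T$, $x\in\mathbb{R}$, and $0<f_T(z)<\infty$ for $\nu$-a.e. $z$. A process $\{L_t\}_{0\le t\le T}$ is an LRB with generating law $\nu$ if $L_T$ has law $\nu$ and, for all $k\ge 1$, $0<t_1<\cdots<t_k<T$, $(x_1,\dots,x_k)\in\mathbb{R}^k$ and $\nu$-a.e. $z$, $\mathbb{P}(L_{t_1}\le x_1,\dots,L_{t_k}\le x_k\mid L_T=z)=\mathbb{P}(X_{t_1}\le x_1,\dots,X_{t_k}\le x_k\mid X_T=z)$. Equivalently (with $t_0=0$, $x_0=0$), $$\mathbb{P}(L_{t_1}\in dx_1,\dots,L_{t_k}\in dx_k,L_T\in dz)=\prod_{i=1}^k\big(f_{t_i-t_{i-1}}(x_i-x_{i-1})\,dx_i\big)\frac{f_{T-t_k}(z-x_k)}{f_T(z)}\,\nu(dz).$$ Generalised Liouville process (GLP). Let $n\ge2$, $m_1,\dots,m_n>0$, $u_0=0$, $u_i=u_{i-1}+m_i$ (so $u_n=\mathbf{1}\cdot\mathbf{m}$).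 A process $\{\boldsymbol{\xi}_t\}_{0\le t\le1}$ is an $n$-dimensional GLP with generating law $\nu$ and activity parameter $\mathbf{m}=(m_1,\dots,m_n)^\top$ if it is equal in law to the process with coordinates $L_{tm_i+u_{i-1}}-L_{u_{i-1}}$, $i=1,\dots,n$, $0\le t\le1$, for some LRB $\{L_t\}_{0\le t\le u_n}$ with generating law $\nu$. A process indexed by $0\le t<1$ is called a GLP if it has the law of a GLP restricted to $[0,1)$. It is assumed throughout that $\nu$ has no continuous singular part. In the claim, $\{f_t\}$ are the densities of such a Lévy process with $T=\mathbf{1}\cdot\mathbf{m}$, and $\nu$ is a probability law with $0<f_{\mathbf{1}\cdot\mathbf{m}}<\infty$ $\nu$-a.e. Define $$\Theta_0(x)=1,\qquad \Theta_t(x)=\int_{\mathbb{R}}\frac{f_{(\mathbf{1}\cdot\mathbf{m})(1-t)}(z-x)}{f_{\mathbf{1}\cdot\mathbf{m}}(z)}\,\nu(dz),\qquad t\in(0,1),\ x\in\mathbb{R}.$$ Standing convention: such ratios and their reciprocals are almost surely well defined, in particular $0<\Theta_t(R_t)<\infty$ almost surely for $0\le t<1$. *)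

(* Defs.v *)
From HB Require Import structures.
From mathcomp Require Import all_boot all_order all_algebra.
From mathcomp Require Import all_classical all_reals all_analysis measurable_realfun.

Set Implicit Arguments.
Unset Strict Implicit.
Unset Printing Implicit Defensive.

Import Order.TTheory GRing.Theory Num.Theory.
Import numFieldNormedType.Exports.

Local Open Scope classical_set_scope.
Local Open Scope ring_scope.

(* A process is a map X : R -> Omega -> V, of which only the values X t with t
   in the relevant time interval (such as `[0, +oo[ or `[0, T]) matter.
   The Borel sigma-algebra of R^n is the one of n.-tuple R. *)

Section paths.
Context {R : realType}.
Implicit Types (D : set R).

(* D is an interval, hence D contains a one-sided neighbourhood of each of its
   points t that is not the corresponding endpoint. *)
Definition cadlag D (x : R -> R) : Prop :=
  forall t, D t ->
    ((exists2 s, D s & t < s) -> x u @[u --> t^'+] --> x t) /\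
    ((exists2 s, D s & s < t) -> cvg (x u @[u --> t^'-])).

Definition cadlag_tuple n D (x : R -> n.-tuple R) : Prop :=
  forall i : 'I_n, cadlag D (fun t => tnth (x t) i).

Definition tuple_zero n : n.-tuple R := [tuple 0 | _ < n].

Definition tuple_sub n (x y : n.-tuple R) : n.-tuple R :=
  [tuple tnth x i - tnth y i | i < n].

Definition tuple_sum n (x : n.-tuple R) : R := \sum_(i < n) tnth x i.

End paths.

Section levy.
Context {R : realType} {d : measure_display} {Omega : measurableType d}.

(* The state space V is R or R^n, with its null element and its subtraction.
   Stochastic continuity follows from stationarity and right-continuity, and
   the latter is required separately, by [cadlag]. *)
Definition levy_law {dV} {V : measurableType dV} (zero : V) (sub : V -> V -> V)
    (P : probability Omega R) (X : R -> Omega -> V) : Prop :=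
  [/\ forall t, 0 <= t -> measurable_fun [set: Omega] (X t),
      {ae P, forall w, X 0 w = zero},
      (* stationary increments *)
      forall s t (A : set V), 0 <= s -> 0 <= t -> measurable A ->
        P [set w | A (sub (X (s + t) w) (X s w))] = P (X t @^-1` A) &
      (* independent increments *)
      forall (k : nat) (t : nat -> R) (A : nat -> set V),
        0 <= t 0%N -> {homo t : i j / (i <= j)%N >-> i <= j} ->
        (forall j, measurable (A j)) ->
        P [set w | forall j, (j < k)%N -> A j (sub (X (t j.+1) w) (X (t j) w))]
        = (\prod_(j < k) P [set w | A j (sub (X (t j.+1) w) (X (t j) w))])%E].

Definition levy_process (P : probability Omega R) (X : R -> Omega -> R) : Prop :=
  levy_law (V := measurableTypeR R) 0 (fun x y : R => x - y) P X /\
  forall w, cadlag `[0, +oo[ (fun t => X t w).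

Definition levy_process_tuple n (P : probability Omega R)
    (X : R -> Omega -> n.-tuple R) : Prop :=
  levy_law (tuple_zero n) (@tuple_sub R n) P X /\
  forall w, cadlag_tuple `[0, +oo[ (fun t => X t w).

End levy.

Section integrals.
Context {R : realType}.
Local Open Scope ereal_scope.

(* Lebesgue integral over R^n of a nonnegative measurable function, as an
   iterated integral. *)
Fixpoint integral_Rn n : (n.-tuple R -> \bar R) -> \bar R :=
  match n with
  | 0 => fun F => F [tuple]
  | n'.+1 => fun F =>
      \int[lebesgue_measure]_x integral_Rn (fun v : n'.-tuple R => F (cons_tuple x v))
  end.

(* P(Y \in dx) = g(x) dx on R^n *)
Definition has_density_Rn {d} {Omega : measurableType d} n
    (P : probability Omega R) (Y : Omega -> n.-tuple R) (g : n.-tuple R -> \bar R) :=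
  forall A : set (n.-tuple R), measurable A ->
    P (Y @^-1` A) = integral_Rn (fun x => (\1_A x)%:E * g x).

(* nu is the sum of a discrete and of an absolutely continuous measure. *)
Definition no_continuous_singular_part
    (nu : probability (measurableTypeR R) R) : Prop :=
  exists (D : set R) (h : R -> \bar R),
    [/\ countable D, measurable_fun [set: R] h, (forall x, 0 <= h x) &
        forall A : set (measurableTypeR R), measurable A ->
          nu A = nu (A `&` D) + \int[lebesgue_measure]_(x in A) h x].

End integrals.

Section lrb.
Context {R : realType}.
Local Open Scope ereal_scope.

(* Conditions on the densities f and on the generating law nu of an LRB on
   [0, T]; densities are [0, +oo]-valued. *)
Definition lrb_parameters (f : R -> R -> \bar R) (T : R)
    (nu : probability (measurableTypeR R) R)
    {d} {Omega : measurableType d} (P : probability Omega R)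
    (X : R -> Omega -> R) : Prop :=
  [/\ levy_process P X,
      (forall t, (0 < t)%R -> measurable_fun [set: R] (f t) /\ forall x, 0 <= f t x),
      (forall t, (0 < t <= T)%R -> forall A : set R, measurable A ->
         P (X t @^-1` A) = \int[lebesgue_measure]_(x in A) f t x),
      (forall s t x, (0 < s)%R -> (s < t)%R -> (t <= T)%R ->
         f t x = \int[lebesgue_measure]_y (f (t - s)%R (x - y)%R * f s y)) &
      {ae nu, forall z, 0 < f T z < +oo}].

(* prod_(1 <= i <= k) f_(t_i - t_(i-1))(x_i - x_(i-1)) * f_(T - t_k)(z - x_k) / f_T(z)
   with t_0 = x_0 = 0 *)
Definition bridge_density (f : R -> R -> \bar R) (T : R) k
    (t x : k.-tuple R) (z : R) : \bar R :=
  (\prod_(i < k) f (tnth t i - nth 0%R (0%R :: t) i)%R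
                   (tnth x i - nth 0%R (0%R :: x) i)%R)
  * (f (T - last 0%R t)%R (z - last 0%R x)%R / f T z).

Definition is_lrb (f : R -> R -> \bar R) (T : R)
    (nu : probability (measurableTypeR R) R)
    {d} {Omega : measurableType d} (P : probability Omega R)
    (L : R -> Omega -> R) : Prop :=
  [/\ forall t, (0 <= t <= T)%R -> measurable_fun [set: Omega] (L t),
      forall w, cadlag `[0%R, T] (fun t => L t w),
      forall B : set (measurableTypeR R), measurable B -> P (L T @^-1` B) = nu B &
      forall k (t : k.-tuple R), (0 < k)%N ->
        path <%R 0%R (rcons t T) ->
        forall (A : set (k.-tuple R)) (B : set (measurableTypeR R)),
        measurable A -> measurable B ->
        P [set w | A [tuple L (tnth t i) w | i < k] /\ B (L T w)]
        = \int[nu]_(z in B)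
            integral_Rn (fun x => (\1_A x)%:E * bridge_density f T t x z)].

End lrb.

Section glp.
Context {R : realType}.

(* u_i = m_1 + ... + m_i *)
Definition partial_activity n (m : n.-tuple R) (i : nat) : R :=
  \sum_(x <- take i m) x.

(* The coordinate of (0-based) index i is L_(t m_(i+1) + u_i) - L_(u_i). *)
Definition glp_of_lrb n (m : n.-tuple R) {T : Type} (L : R -> T -> R) (t : R) (w : T)
    : n.-tuple R :=
  [tuple L (t * tnth m i + partial_activity m i) w - L (partial_activity m i) w
  | i < n].

(* Equality of the finite-dimensional laws of xi under P and of eta under Q.
   P is a mere set function, see [RN_density_process]. *)
Definition same_law_on n (D : set R) {T T' : Type}
    (P : set T -> \bar R) (xi : R -> T -> n.-tuple R)
    (Q : set T' -> \bar R) (eta : R -> T' -> n.-tuple R) : Prop :=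
  forall k (t : 'I_k -> R) (A : 'I_k -> set (n.-tuple R)),
    (forall j, D (t j)) -> (forall j, measurable (A j)) ->
    P [set w | forall j, A j (xi (t j) w)] = Q [set w | forall j, A j (eta (t j) w)].

(* {xi_t, 0 <= t < 1} is a GLP under P with generating law nu and activity
   parameter m, where f are the densities of the underlying Levy process. *)
Definition is_glp n (f : R -> R -> \bar R) (nu : probability (measurableTypeR R) R)
    (m : n.-tuple R) {T : Type} (P : set T -> \bar R) (xi : R -> T -> n.-tuple R)
    : Prop :=
  [/\ (2 <= n)%N, forall i, 0 < tnth m i &
      exists (d' : measure_display) (Omega' : measurableType d')
        (P' : probability Omega' R) (L : R -> Omega' -> R),
        is_lrb f (tuple_sum m) nu P' L /\
        same_law_on `[0, 1[ P xi P' (glp_of_lrb m L)].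

Definition Theta (f : R -> R -> \bar R) (T : R)
    (nu : probability (measurableTypeR R) R) (t x : R) : \bar R :=
  (if t == 0%R then 1
   else \int[nu]_z (f (T * (1 - t))%R (z - x)%R / f T z))%E.

End glp.

Section measure_change.
Context {R : realType} {d : measure_display} {Omega : measurableType d}.

Definition history_gen n (xi : R -> Omega -> n.-tuple R) (D : set R)
    : set (set Omega) :=
  \bigcup_(u in D) preimage_set_system setT (xi u) measurable.

(* Omega with the sigma-algebra sigma(xi_u : u \in D) *)
Definition history n (xi : R -> Omega -> n.-tuple R) (D : set R) :=
  g_sigma_algebraType (history_gen xi D).

(* {Z_t, 0 <= t < 1} is the density process dPtilde/dP with respect to the
   filtration F_t = sigma(xi_u : 0 <= u <= t).  Only the restrictions of P to
   the sigma-algebras F_t with t < 1 are constrained, and each of them has to be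
   a probability measure.  P need not be countably additive on a sigma-algebra
   that contains all of them: on a space Omega with too few trajectories these
   restrictions may have no countably additive common extension. *)
Definition RN_density_process n (xi : R -> Omega -> n.-tuple R)
    (Ptilde : set Omega -> \bar R) (P : set Omega -> \bar R)
    (Z : R -> Omega -> \bar R) : Prop :=
  forall t : R, 0 <= t < 1 ->
    exists Pt : probability (history xi `[0, t]) R,
      [/\ forall A : set (history xi `[0, t]), measurable A -> P A = Pt A,
          measurable_fun [set: history xi `[0, t]] (Z t),
          forall w, (0 <= Z t w)%E &
          forall A : set (history xi `[0, t]), measurable A ->
            Ptilde A = (\int[Pt]_(w in A) Z t w)%E].

(* As for the coordinate process on the Skorokhod space, every cadlag function
   that starts at 0 is a trajectory of xi. *)
Definition all_trajectories n (xi : R -> Omega -> n.-tuple R) : Prop :=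
  forall x : R -> n.-tuple R,
    cadlag_tuple `[0, +oo[ x -> x 0 = tuple_zero n ->
    exists w, forall t, 0 <= t -> xi t w = x t.

End measure_change.

(* Main.v *)
From HB Require Import structures.
Require Import Defs.
From mathcomp Require Import all_boot all_order all_algebra.
From mathcomp Require Import all_classical all_reals all_analysis measurable_realfun.
From mathcomp Require Import ring lra.

Set Implicit Arguments.
Unset Strict Implicit.
Unset Printing Implicit Defensive.

Import Order.TTheory GRing.Theory Num.Theory.
Import numFieldNormedType.Exports.

Local Open Scope classical_set_scope.
Local Open Scope ring_scope.

(** Let T be the sum of the m_i and u_i the partial sums. The argument compares
    xi with a bridge L of X from 0 to a random end point of law nu.

    Up to a time s < T, the law of L jointly with L_T = z is that of X times nu,
    reweighted by f_(T - s)(z - X_s) / f_T(z) ([bridge_family_law]). The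
    coordinates of the generalised Liouville process up to time t < 1 are
    the increments of L over the disjoint intervals [u_i, u_i + m_i t]. Before
    reweighting these are increments of X, and they have the law of xi on
    [0, t], whose coordinates are independent copies of X run at the speeds m_i
    ([levy_tuple_family]). The increments of X over the gaps
    [u_i + m_i t, u_(i+1)] are independent of them and only enter the weight:
    the last gap is already integrated out if s is taken to be its left end
    point, and the others are integrated out by the Chapman-Kolmogorov
    equation. As the gaps have total length T (1 - t), the weight becomes
    f_(T (1 - t))(z - R_t) / f_T(z) ([levy_interleaving]), and its integral over
    z is Theta_t(R_t). So the Liouville process on [0, t] has the law of xi
    reweighted by Theta_t(R_t) ([theta_fdd]).

    The rest is the theory of changes of measure. The measures
    Theta_t(R_t) dPtilde on the histories F_t extend each other, since on
    cylinders they do not depend on t ([likelihood_consistent]); they define P,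
    and Theta_t(R_t)^-1 is the density of Ptilde with respect to P since
    0 < Theta_t(R_t) < +oo almost surely ([likelihood_density]). Conversely,
    if Ptilde has density Theta_t(R_t)^-1 with respect to P on F_t, then
    Theta_t(R_t) dPtilde is P restricted to {0 < Theta_t(R_t) < +oo}, and it is
    P because both have mass 1 ([density_likelihood]). If every cadlag
    trajectory occurs, P is obtained on the whole of sigma(xi_u : 0 <= u < 1) as
    an image of the law of L ([rn_trajectories]).

    The bridge L has to be constructed. Its trajectory is cut into blocks
    [tau k, tau k.+1] with tau k increasing to T, and the blocks are drawn one
    after the other by the Ionescu-Tulcea theorem ([ionescu_tulcea]): block k is
    a trajectory of X, under a law biased by the density of reaching the end
    point from the position at tau k.+1 (a Doob transform, [chain_bridge]). This
    gives a cadlag path on [0, T[. The increments of the bridge are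
    exchangeable, so the oscillation of the path over [tau m, T[ has the law of
    that over [0, T - tau m[, which tends to 0 with T - tau m by
    right-continuity: almost surely the path has a left limit at T
    ([oscillates_null]). *)

(** * Laws of finite families *)
Section image_measure.
Context {R : realType} {d : measure_display} {Om : measurableType d}.
Variable P : {measure set Om -> \bar R}.

Definition image_measure dV (V : measurableType dV) (Y : Om -> V)
    (mY : measurable_fun [set: Om] Y) : {measure set V -> \bar R} :=
  measure_function_pushforward__canonical__measure_function_Measure P mY.
End image_measure.

Section same_law.
Context {R : realType} {d d' : measure_display} {Om : measurableType d}
  {Om' : measurableType d'}.
Variables (P : probability Om R) (P' : probability Om' R).

Lemma law_unique dV (V : measurableType dV) (G : set (set V))
    (Y : Om -> V) (Y' : Om' -> V) :
  measurable = <<s G >> -> setI_closed G -> G setT ->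
  measurable_fun setT Y -> measurable_fun setT Y' ->
  (forall A, G A -> P (Y @^-1` A) = P' (Y' @^-1` A)) ->
  forall A, measurable A -> P (Y @^-1` A) = P' (Y' @^-1` A).
Proof.
move=> mG GI GT mY mY' YY' A mA.
apply: (@measure_unique _ R V G (fun=> setT) mG GI _ _
  (image_measure P mY) (image_measure P' mY')) => //.
- by rewrite bigcup_const//; exists 0%N.
- by move=> _; rewrite [ltLHS](_ : _ = 1%E) ?ltry//; exact: probability_setT.
Qed.

Lemma law_integral dV (V : measurableType dV) (Y : Om -> V) (Y' : Om' -> V)
    (F : V -> \bar R) :
  measurable_fun setT Y -> measurable_fun setT Y' ->
  (forall A, measurable A -> P (Y @^-1` A) = P' (Y' @^-1` A)) ->
  measurable_fun setT F -> (forall v, 0 <= F v)%E ->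
  (\int[P]_w F (Y w) = \int[P']_w F (Y' w))%E.
Proof.
move=> mY mY' YY' mF F0.
rewrite -[LHS](ge0_integral_pushforward mY P measurableT)//.
rewrite -[RHS](ge0_integral_pushforward mY' P' measurableT)//.
apply: (@eq_measure_integral _ _ _ _ (image_measure P' mY') (image_measure P mY)).
by move=> A mA _; exact: YY'.
Qed.

End same_law.

Section families.
Context {R : realType} {dT : measure_display} {T : measurableType dT}.

Lemma measurable_tuple_box N (A : 'I_N -> set T) :
  (forall i, measurable (A i)) ->
  measurable [set v : N.-tuple T | forall i, A i (tnth v i)].
Proof.
move=> mA.
rewrite (_ : [set v | _] = \big[setI/setT]_(i < N)
  ((@tnth N T) ^~ i @^-1` A i)); last first.
  rewrite -bigcap_seq; apply/seteqP; split => v /=.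
    by move=> vA i _; exact: vA.
  by move=> vA i; apply: vA; rewrite /= mem_index_enum.
apply: bigsetI_measurable => i _.
by rewrite -[X in measurable X]setTI; exact: measurable_tnth.
Qed.

(** Boxes are stable under intersection: the laws of two finite families are
    equal as soon as they agree on boxes. *)
Lemma measurable_tuple_boxes N : @measurable _ (N.-tuple T) =
  <<s [set B | exists A : 'I_N -> set T, (forall i, measurable (A i)) /\
         B = [set v | forall i, A i (tnth v i)]] >>.
Proof.
apply/seteqP; split.
- apply: smallest_sub; first exact: smallest_sigma_algebra.
  rewrite big_tnth -bigcup_seq; apply: bigcup_sub => i _ B [C mC <-].
  set j := tnth _ i.
  apply: sub_sigma_algebra.
  exists (fun k => if k == j then C else setT); split.
    by move=> k; case: ifP.
  rewrite setTI; apply/seteqP; split => v /=.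
    by move=> Cv k; case: eqP => // ->.
  by move=> /(_ j); rewrite eqxx.
- apply: smallest_sub; first exact: sigma_algebra_measurable.
  by move=> B [A [mA ->]]; exact: measurable_tuple_box.
Qed.

(** Families indexed by a finite type are turned into tuples, which carry a
    product sigma-algebra. *)
Definition of_tuple (I : finType) (v : #|I|.-tuple T) (i : I) : T :=
  tnth v (enum_rank i).

Definition to_tuple (I : finType) (y : I -> T) : #|I|.-tuple T :=
  [tuple y (enum_val k) | k < #|I|].

Lemma to_tupleK (I : finType) (y : I -> T) : of_tuple (to_tuple y) = y.
Proof.
by apply/funext => i; rewrite /of_tuple tnth_mktuple enum_rankK.
Qed.

Lemma measurable_of_tuple (I : finType) (i : I) :
  measurable_fun setT (fun v : #|I|.-tuple T => of_tuple v i).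
Proof. exact: measurable_tnth. Qed.

Lemma measurable_mktuple d (Om : measurableType d) N (Y : 'I_N -> Om -> T) :
  (forall i, measurable_fun setT (Y i)) ->
  measurable_fun setT (fun w => [tuple Y i w | i < N]).
Proof.
move=> mY; apply/measurable_fun_tnthP => i.
by apply: eq_measurable_fun (mY i) => w _ /=; rewrite tnth_mktuple.
Qed.

Lemma measurable_to_tuple d (Om : measurableType d) (I : finType)
    (Y : I -> Om -> T) : (forall i, measurable_fun setT (Y i)) ->
  measurable_fun setT (fun w => to_tuple (Y ^~ w)).
Proof. by move=> mY; apply: measurable_mktuple => k; exact: mY. Qed.

Lemma measurable_family_box d (Om : measurableType d) (I : finType)
    (Y : I -> Om -> T) (A : I -> set T) :
  (forall i, measurable_fun setT (Y i)) -> (forall i, measurable (A i)) ->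
  measurable [set w | forall i, A i (Y i w)].
Proof.
move=> mY mA; rewrite (_ : [set w | _] =
    \big[setI/setT]_(i : I) (Y i @^-1` A i)); last first.
  rewrite -bigcap_seq; apply/seteqP; split => w /= H i; first by move=> _.
  by apply: H; rewrite /= mem_index_enum.
by apply: bigsetI_measurable => i _; rewrite -[X in measurable X]setTI; exact: mY.
Qed.

Lemma family_integral {d d'} {Om : measurableType d} {Om' : measurableType d'}
    (P : probability Om R) (P' : probability Om' R) (I : finType)
    (Y : I -> Om -> T) (Y' : I -> Om' -> T) (F : (I -> T) -> \bar R) :
  (forall i, measurable_fun setT (Y i)) ->
  (forall i, measurable_fun setT (Y' i)) ->
  (forall A : I -> set T, (forall i, measurable (A i)) ->
    P [set w | forall i, A i (Y i w)] = P' [set w | forall i, A i (Y' i w)]) ->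
  measurable_fun setT (fun v : #|I|.-tuple T => F (of_tuple v)) ->
  (forall y, 0 <= F y)%E ->
  (\int[P]_w F (Y ^~ w) = \int[P']_w F (Y' ^~ w))%E.
Proof.
move=> mY mY' YY' mF F0.
have := @law_integral R _ _ _ _ P P' _ _ (fun w => to_tuple (Y ^~ w))
  (fun w => to_tuple (Y' ^~ w)) _ (measurable_to_tuple mY)
  (measurable_to_tuple mY') _ mF (fun=> F0 _).
have toE dx (Ox : measurableType dx) (Z : I -> Ox -> T) :
    (fun w => F (of_tuple (to_tuple (Z ^~ w)))) = (fun w => F (Z ^~ w)).
  by apply/funext => w; rewrite to_tupleK.
rewrite !toE; apply; apply: (law_unique (measurable_tuple_boxes _)).
- move=> _ _ [A [mA ->]] [B [mB ->]]; exists (fun i => A i `&` B i); split.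
    by move=> i; exact: measurableI.
  apply/seteqP; split => v /=; first by move=> [vA vB] i; split.
  by move=> vAB; split => i; have [] := vAB i.
- by exists (fun=> setT); split => //; apply/seteqP; split.
- exact: measurable_to_tuple.
- exact: measurable_to_tuple.
- move=> _ [A [mA ->]] /=.
  have to_box dx (Ox : measurableType dx) (Z : I -> Ox -> T) :
      (fun w => to_tuple (Z ^~ w)) @^-1` [set v | forall i, A i (tnth v i)] =
      [set w | forall i, A (enum_rank i) (Z i w)].
    apply/seteqP; split => w /= wA i.
      by have := wA (enum_rank i); rewrite tnth_mktuple enum_rankK.
    by have := wA (enum_val i); rewrite enum_valK tnth_mktuple.
  by rewrite !to_box; exact: (YY' (fun i => A (enum_rank i))).
Qed.

End families.

(** * Families of increments of a Levy process *)
Section levy_families.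
Context {R : realType} {dX : measure_display} {OmX : measurableType dX}.
Variables (PX : probability OmX R) (X : R -> OmX -> R).
Hypothesis levyX : levy_law (V := measurableTypeR R) 0 (fun x y : R => x - y) PX X.
Local Open Scope ereal_scope.

(** Independent variables, the i-th of which is distributed as X at time h i.
    They may live on any space, so that increments of X, increments of the
    coordinates of xi and blocks of a Markov chain can be exchanged for one
    another in an expectation. *)
Definition levy_family {d} {Om : measurableType d} (P : probability Om R)
    (I : finType) (Y : I -> Om -> R) (h : I -> R) : Prop :=
  (forall i, measurable_fun setT (Y i)) /\
  forall A : I -> set R, (forall i, measurable (A i)) ->
    P [set w | forall i, A i (Y i w)] = \prod_(i : I) PX (X (h i) @^-1` A i).

Lemma levy_measurable t : (0 <= t)%R -> measurable_fun setT (X t).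
Proof. by case: levyX => mX _ _ _; exact: mX. Qed.

Lemma levy_measurableB s t : (0 <= s)%R -> (0 <= t)%R ->
  measurable_fun setT (fun w => X t w - X s w)%R.
Proof. by move=> s0 t0; apply: measurable_funB; exact: levy_measurable. Qed.

Lemma levy_family_integral {d d'} {Om : measurableType d} {Om' : measurableType d'}
    (P : probability Om R) (P' : probability Om' R) (I : finType)
    (Y : I -> Om -> R) (Y' : I -> Om' -> R) (h : I -> R) (F : (I -> R) -> \bar R) :
  levy_family P Y h -> levy_family P' Y' h ->
  measurable_fun setT (fun v : #|I|.-tuple R => F (of_tuple v)) ->
  (forall y, 0 <= F y) ->
  \int[P]_w F (Y ^~ w) = \int[P']_w F (Y' ^~ w).
Proof.
move=> [mY YP] [mY' YP'] mF F0; apply: family_integral => // A mA.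
by rewrite YP// YP'.
Qed.

Definition family_sum {Om : Type} {Om' : Type} (I J : Type)
    (U : I -> Om -> R) (V : J -> Om' -> R) (k : I + J) (w : Om * Om') : R :=
  match k with inl i => U i w.1 | inr j => V j w.2 end.

Definition sum_fun {I J : Type} (h : I -> R) (h' : J -> R) (k : I + J) : R :=
  match k with inl i => h i | inr j => h' j end.

Lemma levy_family_sum {d d'} {Om : measurableType d} {Om' : measurableType d'}
    (P : probability Om R) (P' : probability Om' R) (I J : finType)
    (U : I -> Om -> R) (V : J -> Om' -> R) (h : I -> R) (h' : J -> R) :
  levy_family P U h -> levy_family P' V h' ->
  levy_family (P \x P') (family_sum U V) (sum_fun h h').
Proof.
move=> [mU UP] [mV VP']; split.
  case=> [i|j] /=.
    exact: (measurableT_comp (mU i) measurable_fst).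
  exact: (measurableT_comp (mV j) measurable_snd).
move=> A mA.
have -> : [set w | forall i, A i (family_sum U V i w)] =
    [set w | forall i, A (inl i) (U i w)] `*`
    [set w | forall j, A (inr j) (V j w)].
  apply/seteqP; split => -[w w'] /=.
    by move=> H; split => i; [exact: (H (inl i))|exact: (H (inr i))].
  by move=> [H H'] [i|j]; [exact: H|exact: H'].
transitivity (P [set w | forall i, A (inl i) (U i w)] *
    P' [set w | forall j, A (inr j) (V j w)]).
  apply: (@product_measure1E _ _ _ _ _ P P').
    exact: (measurable_family_box (A := fun i => A (inl i)) mU (fun i => mA _)).
  exact: (measurable_family_box (A := fun i => A (inr i)) mV (fun i => mA _)).
rewrite (UP (fun i => A (inl i)))// (VP' (fun j => A (inr j)))//.
by rewrite big_sumType.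
Qed.

(** By independence and Fubini, one group of increments is integrated out for
    fixed values of the other group. *)
Lemma levy_family_split {d d' d''} {Om : measurableType d}
    {Om' : measurableType d'} {Om'' : measurableType d''}
    (P : probability Om R) (P' : probability Om' R) (P'' : probability Om'' R)
    (I J : finType)
    (Y : I + J -> Om'' -> R) (U : I -> Om -> R) (V : J -> Om' -> R)
    (h : I -> R) (h' : J -> R) (F : (I + J -> R) -> \bar R) :
  levy_family P U h -> levy_family P' V h' ->
  levy_family P'' Y (sum_fun h h') ->
  measurable_fun setT (fun v : #|{: I + J}|.-tuple R => F (of_tuple v)) ->
  (forall y, 0 <= F y) ->
  \int[P'']_w F (Y ^~ w) =
  \int[P]_w \int[P']_w' F (sum_fun (U ^~ w) (V ^~ w')).
Proof.
move=> UP VP' YP'' mF F0.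
have UV := levy_family_sum UP VP'.
rewrite (levy_family_integral YP'' UV)//.
rewrite fubini_tonelli1//.
  have := measurableT_comp mF (measurable_to_tuple UV.1).
  by apply: eq_measurable_fun => w _ /=; rewrite to_tupleK.
Qed.

Lemma levy_family_bij {d} {Om : measurableType d} (P : probability Om R)
    (I J : finType) (Y : I -> Om -> R) (h : I -> R) (s : J -> I) :
  bijective s -> levy_family P Y h -> levy_family P (Y \o s) (h \o s).
Proof.
move=> bs [mY YP]; split => [j|A mA]; first exact: mY.
have [s' sK s'K] := bs.
have := YP (A \o s') (fun i => mA _).
rewrite [RHS](reindex s)/=; last exact: onW_bij.
under [RHS]eq_bigr do rewrite sK.
move=> <-; congr (P _); apply/seteqP; split => w /= H i.
  by have := H (s' i); rewrite s'K.
by have := H (s i); rewrite sK.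
Qed.

Lemma levy_grid (t : nat -> R) k (A : nat -> set R) :
  (0 <= t 0%N)%R -> {homo t : i j / (i <= j)%N >-> (i <= j)%R} ->
  (forall j, measurable (A j)) ->
  PX [set w | forall j, (j < k)%N -> A j (X (t j.+1) w - X (t j) w)%R] =
  \prod_(j < k) PX (X (t j.+1 - t j)%R @^-1` A j).
Proof.
move=> t0 nt mA; case: levyX => _ _ stat /(_ k t A t0 nt mA) ->.
apply: eq_bigr => j _.
have tj0 : (0 <= t j)%R by rewrite (le_trans t0)//; exact: nt.
have tS0 : (0 <= t j.+1 - t j)%R by rewrite subr_ge0; exact: nt.
by rewrite -(stat (t j) _ (A j) tj0 tS0 (mA j)) subrKC.
Qed.

Lemma levy_family_grid (t : nat -> R) k :
  (0 <= t 0%N)%R -> {homo t : i j / (i <= j)%N >-> (i <= j)%R} ->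
  levy_family PX (fun (j : 'I_k) w => X (t j.+1) w - X (t j) w)%R
    (fun j => t j.+1 - t j)%R.
Proof.
move=> t0 nt.
have tge0 j : (0 <= t j)%R by rewrite (le_trans t0)//; exact: nt.
split => [j|A mA]; first exact: levy_measurableB.
pose A' j := if insub j is Some i then A i else setT.
have A'E (j : 'I_k) : A' j = A j by rewrite /A' valK.
have := @levy_grid t k A' t0 nt _.
under eq_bigr do rewrite A'E.
move=> <-; last by move=> j; rewrite /A'; case: insubP.
congr (PX _); apply/seteqP; split => w /= H j.
  by move=> jk; have := H (Ordinal jk); rewrite -A'E.
by have := H j (ltn_ord j); rewrite A'E.
Qed.

Lemma prod_divmod n M (G : nat -> nat -> \bar R) : (0 < M)%N ->
  \prod_(q < n * M) G (q %/ M)%N (q %% M)%N = \prod_(i < n) \prod_(j < M) G i j.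
Proof.
move=> M0; rewrite -(big_mkord xpredT (fun q => G (q %/ M)%N (q %% M)%N)).
elim: n => [|n IH]; first by rewrite mul0n big_nil big_ord0.
rewrite mulSnr (big_cat_nat (n := n * M))//= ?leq_addr// IH big_ord_recr/=.
congr (_ * _); rewrite -{1}[(n * M)%N]add0n big_addn addKn big_mkord.
apply: eq_bigr => j _.
by rewrite addnC divnMDl// modnMDl divn_small// modn_small// addn0.
Qed.

(** The rows of the double sequence c are adjacent finite grids; division with
    remainder by their common length enumerates them as a single grid. *)
Lemma levy_family_lex (c : nat -> nat -> R) n M : (0 <= c 0%N 0%N)%R ->
  (forall i j, (j <= M)%N -> (c i j <= c i j.+1)%R) ->
  (forall i, c i M.+1 = c i.+1 0%N) ->
  levy_family PX (fun (p : 'I_n * 'I_M.+1) w => X (c p.1 p.2.+1) w - X (c p.1 p.2) w)%R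
    (fun p => c p.1 p.2.+1 - c p.1 p.2)%R.
Proof.
move=> c0 cS cM.
pose t q := c (q %/ M.+1)%N (q %% M.+1)%N.
have tS q : t q.+1 = c (q %/ M.+1)%N (q %% M.+1).+1.
  rewrite /t; have := ltn_pmod q (ltn0Sn M); rewrite ltnS leq_eqVlt => /orP[/eqP qM|qM].
    have qE : q.+1 = ((q %/ M.+1).+1 * M.+1)%N.
      by rewrite {1}(divn_eq q M.+1) qM -addnS -mulSnr.
    by rewrite qM cM qE mulnK// modnMl.
  have qE : q.+1 = (q %/ M.+1 * M.+1 + (q %% M.+1).+1)%N.
    by rewrite addnS -divn_eq.
  have qM' : ((q %% M.+1).+1 < M.+1)%N by rewrite ltnS.
  by rewrite qE divnMDl// modnMDl (divn_small qM') (modn_small qM') addn0.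
have nt : {homo t : i j / (i <= j)%N >-> (i <= j)%R}.
  apply: homo_leq => [//||]; first exact: le_trans.
  by move=> q; rewrite tS; apply: cS; rewrite -ltnS ltn_pmod.
have tge0 j : (0 <= t j)%R by rewrite (le_trans _ (nt 0%N j _))// /t div0n mod0n.
have tE (p : 'I_n * 'I_M.+1) : t (p.1 * M.+1 + p.2)%N = c p.1 p.2 /\
    t (p.1 * M.+1 + p.2).+1 = c p.1 p.2.+1.
  rewrite tS /t divnMDl// modnMDl divn_small// modn_small// addn0; split => //.
split => [p|A mA].
  by have [<- <-] := tE p; exact: levy_measurableB.
pose A' q := if (insub (q %/ M.+1)%N, insub (q %% M.+1)%N) is (Some i, Some j)
   then A (i, j) else setT.
have A'E (p : 'I_n * 'I_M.+1) : A' (p.1 * M.+1 + p.2)%N = A p.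
  rewrite /A' divnMDl// modnMDl divn_small// modn_small// addn0 !valK.
  by case: p.
have := @levy_grid t (n * M.+1) A' _ nt _.
have -> : [set w | forall j, (j < n * M.+1)%N -> A' j (X (t j.+1) w - X (t j) w)%R]
   = [set w | forall p : 'I_n * 'I_M.+1, A p (X (c p.1 p.2.+1) w - X (c p.1 p.2) w)%R].
  apply/seteqP; split => w /= H.
    move=> p; have [<- <-] := tE p; rewrite -A'E; apply: H.
    case: p => -[i ilt] [j jlt] /=.
    by rewrite (@leq_trans (i.+1 * M.+1))// ?leq_mul2r ?ilt ?orbT// mulSnr ltn_add2l.
  move=> q qlt.
  have i1 : (q %/ M.+1 < n)%N by rewrite ltn_divLR.
  have j1 : (q %% M.+1 < M.+1)%N by rewrite ltn_pmod.
  have := H (Ordinal i1, Ordinal j1); rewrite -A'E.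
  have [<- <-] := tE (Ordinal i1, Ordinal j1).
  by rewrite /= -divn_eq.
move=> ->//; last first.
  by move=> q; rewrite /A'; do 2 case: insubP => //.
pose G i j := PX (X (c i j.+1 - c i j)%R @^-1` A' (i * M.+1 + j)%N).
transitivity (\prod_(q < n * M.+1) G (q %/ M.+1)%N (q %% M.+1)%N).
  by apply: eq_bigr => q _; rewrite /G -divn_eq tS.
rewrite prod_divmod// pair_bigA; apply: eq_bigr => p _ /=.
by rewrite /G A'E.
Qed.

End levy_families.

(** * The Ionescu-Tulcea theorem *)
Section sequence_space.
Context {d : measure_display} {S : measurableType d}.

Definition coordinate_preimages : set (set (nat -> S)) :=
  \bigcup_(n in [set: nat])
    preimage_set_system setT (fun x : nat -> S => x n) measurable.

Definition seqspace := g_sigma_algebraType coordinate_preimages.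

Lemma measurable_coord n : measurable_fun setT (fun x : seqspace => x n).
Proof.
by move=> _ A mA; apply: sub_sigma_algebra; exists n => //; exists A.
Qed.

Lemma measurable_fun_seqspaceP d' (Om : measurableType d') (f : Om -> seqspace) :
  (forall n, measurable_fun setT (fun w => f w n)) -> measurable_fun setT f.
Proof.
move=> mf; apply: (@measurability _ _ _ _ setT f coordinate_preimages erefl).
move=> _ [_ [n _ [A mA <-]] <-].
by have := mf n measurableT A mA; rewrite !setTI.
Qed.

Definition prepend (s : S) (x : seqspace) : seqspace :=
  fun n => if n is m.+1 then x m else s.

Lemma measurable_prepend :
  measurable_fun setT (fun p : S * seqspace => prepend p.1 p.2).
Proof.
apply: measurable_fun_seqspaceP => -[|n] /=; first exact: measurable_fst.
exact: (measurableT_comp (measurable_coord n) measurable_snd).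
Qed.

Lemma measurable_prepend1 s : measurable_fun setT (prepend s).
Proof.
have ms : measurable_fun setT (fun x : seqspace => (s, x)).
  exact: measurable_fun_pair.
exact: (measurableT_comp measurable_prepend ms).
Qed.

Definition cylinder n (C : set seqspace) := measurable C /\
  forall x y : seqspace, (forall i, (i < n)%N -> x i = y i) -> C x -> C y.

Lemma cylinder_le n m C : (n <= m)%N -> cylinder n C -> cylinder m C.
Proof.
move=> nm [mC depC]; split => // x y xy; apply: depC => i ilt.
by apply: xy; exact: leq_trans nm.
Qed.

Lemma cylinder_prepend n C s : cylinder n.+1 C -> cylinder n (prepend s @^-1` C).
Proof.
move=> [mC depC]; split; first by rewrite -[X in measurable X]setTI; exact: measurable_prepend1.
by move=> x y xy; apply: depC => -[|i]//= /xy.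
Qed.

Lemma cylinderC n C : cylinder n C -> cylinder n (~` C).
Proof.
move=> [mC depC]; split; first exact: measurableC.
by move=> x y xy nCx Cy; apply: nCx; apply: depC Cy => i /xy.
Qed.

Lemma cylinderU n C D : cylinder n C -> cylinder n D -> cylinder n (C `|` D).
Proof.
move=> [mC depC] [mD depD]; split; first exact: measurableU.
by move=> x y xy [Cx|Dx]; [left; exact: depC Cx|right; exact: depD Dx].
Qed.

Lemma cylinder0 n : cylinder n set0. Proof. by split. Qed.

Definition cylinders : set (set (nat -> S)) := [set C | exists n, cylinder n C].

Lemma cylinders0 : cylinders set0. Proof. by exists 0%N; exact: cylinder0. Qed.

Lemma cylindersU : setU_closed cylinders.
Proof.
move=> A B [n nA] [m mB]; exists (maxn n m); apply: cylinderU.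
  exact: cylinder_le (leq_maxl _ _) nA.
exact: cylinder_le (leq_maxr _ _) mB.
Qed.

Lemma cylindersC : setC_closed cylinders.
Proof. by move=> A [n nA]; exists n; exact: cylinderC. Qed.

(** A copy of the sequence space that carries the algebra of cylinders only. *)
Definition cylspace := (nat -> S)%type.

HB.instance Definition _ := Pointed.on cylspace.
Definition cylinder_display : measure_display. Proof. exact. Qed.
HB.instance Definition _ := @isAlgebraOfSets.Build cylinder_display cylspace
  cylinders cylinders0 cylindersU cylindersC.

End sequence_space.
Arguments seqspace {d} S.

Section chain.
Context {R : realType} {d : measure_display} {S : measurableType d}.
Local Open Scope ereal_scope.

Section step.
Variables (K : R.-pker S ~> S) (M : R.-pker S ~> seqspace S).

(** The first component of the pair is the source of the step, as required by the
    composition of kernels; the second one is the new state. *)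
Definition prepend_law (p : S * S) : {measure set seqspace S -> \bar R} :=
  image_measure (M p.2)
    (measurable_prepend1 p.2).

Let measurable_prepend_law U : measurable U ->
  measurable_fun setT (prepend_law ^~ U).
Proof.
move=> mU.
have mUp : measurable ((fun p : S * seqspace S => prepend p.1 p.2) @^-1` U).
  by rewrite -[X in measurable X]setTI; exact: measurable_prepend.
have : measurable_fun setT (fun s => M s (prepend s @^-1` U)).
  have := @measurable_fun_integral_finite_kernel _ _ _ _ R
    (fun p => (\1_((fun p : S * seqspace S => prepend p.1 p.2) @^-1` U) p)%:E) M.
  have mi : measurable_fun setT (fun p : S * seqspace S =>
     (\1_((fun p : S * seqspace S => prepend p.1 p.2) @^-1` U) p)%:E : \bar R).
    exact/measurable_EFinP/measurable_indic.
  have i0 p : 0 <= (\1_((fun p : S * seqspace S => prepend p.1 p.2) @^-1` U) p)%:E :> \bar R.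
    by rewrite lee_fin.
  move=> /(_ i0 mi); apply: eq_measurable_fun => s _.
  rewrite (_ : (fun y => _) = (fun y => (\1_(prepend s @^-1` U) y)%:E)).
    rewrite integral_indic ?setIT//.
    by rewrite -[X in measurable X]setTI; exact: measurable_prepend1.
  by [].
by move=> /measurableT_comp; apply; exact: measurable_snd.
Qed.

HB.instance Definition _ := isKernel.Build _ _ _ _ R prepend_law measurable_prepend_law.

Let prepend_law_prob p : prepend_law p setT = 1.
Proof. exact: prob_kernel. Qed.

HB.instance Definition _ := Kernel_isProbability.Build _ _ _ _ R prepend_law prepend_law_prob.

Definition chain_step : S -> {measure set seqspace S -> \bar R} :=
  mkcomp K prepend_law.

Let measurable_chain_step U : measurable U -> measurable_fun setT (chain_step ^~ U).
Proof.
move=> mU; exact: (@measurable_kernel _ _ _ _ R (K \; prepend_law) U mU).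
Qed.

HB.instance Definition _ := isKernel.Build _ _ _ _ R chain_step measurable_chain_step.

Lemma chain_stepE s U : measurable U ->
  chain_step s U = \int[K s]_s' M s' (prepend s' @^-1` U).
Proof. by []. Qed.

Let chain_step_prob s : chain_step s setT = 1.
Proof.
rewrite chain_stepE//; under eq_integral do rewrite preimage_setT prob_kernel.
by rewrite integral_cst// mul1e; exact: prob_kernel.
Qed.

HB.instance Definition _ := Kernel_isProbability.Build _ _ _ _ R chain_step chain_step_prob.

Lemma integral_chain_step s F : (forall x, 0 <= F x) -> measurable_fun setT F ->
  \int[chain_step s]_x F x = \int[K s]_s' \int[M s']_x F (prepend s' x).
Proof.
move=> F0 mF; rewrite [LHS]integral_kcomp//; apply: eq_integral => s' _.
by rewrite (ge0_integral_pushforward (measurable_prepend1 s')).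
Qed.

End step.

Variable K : nat -> R.-pker S ~> S.

(** The law, from time k on, of the first n states of the chain, continued by
    a constant sequence. *)
Fixpoint chain (n k : nat) : R.-pker S ~> seqspace S :=
  match n with
  | 0 => kdirac (measurable_cst (point : seqspace S))
  | n'.+1 => chain_step (K k) (chain n' k.+1)
  end.

Lemma chainS n k s U : measurable U ->
  chain n.+1 k s U = \int[K k s]_s' chain n k.+1 s' (prepend s' @^-1` U).
Proof. exact: chain_stepE. Qed.

Lemma integral_chainS n k s F : (forall x, 0 <= F x) -> measurable_fun setT F ->
  \int[chain n.+1 k s]_x F x =
  \int[K k s]_s' \int[chain n k.+1 s']_x F (prepend s' x).
Proof. exact: integral_chain_step. Qed.

Lemma chain_cylinder n m k s C : (n <= m)%N -> cylinder n C ->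
  chain m k s C = chain n k s C.
Proof.
elim: n m k s C => [|n IH] m k s C.
  move=> _ [mC depC]; have [->|/set0P[x Cx]] := eqVneq C set0.
    by rewrite !measure0.
  have -> : C = setT by apply/seteqP; split => // y _; exact: depC Cx.
  by rewrite !prob_kernel.
case: m => // m; rewrite ltnS => nm cC.
rewrite !(chainS _ _ _ cC.1); apply: eq_integral => s' _; apply: IH => //.
exact: cylinder_prepend.
Qed.

Definition level (C : set (seqspace S)) : nat :=
  if pselect (exists n, cylinder n C) is left e then projT1 (cid e) else 0%N.

(** By [chain_cylinder] the choice of the level does not matter. This is the
    finitely additive law that is to be extended. *)
Definition cylinder_law k s (C : set (seqspace S)) : \bar R :=
  chain (level C) k s C.

Lemma cylinder_level n C : cylinder n C -> cylinder (level C) C.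
Proof.
move=> cC; rewrite /level; case: pselect => [e|[]]; last by exists n.
by case: cid.
Qed.

Lemma cylinder_lawE n k s C : cylinder n C -> cylinder_law k s C = chain n k s C.
Proof.
move=> cC; have lC := cylinder_level cC.
rewrite /cylinder_law -(@chain_cylinder n (maxn n (level C)))// ?leq_maxl//.
by rewrite -(@chain_cylinder (level C) (maxn n (level C)))// leq_maxr.
Qed.

Lemma cylinder_law_rec n k s C : cylinder n C ->
  cylinder_law k s C = \int[K k s]_s' cylinder_law k.+1 s' (prepend s' @^-1` C).
Proof.
move=> /(cylinder_le (leqnSn n)) cC.
rewrite (cylinder_lawE _ _ cC) (chainS _ _ _ cC.1); apply: eq_integral => s' _.
by rewrite -(cylinder_lawE _ _ (cylinder_prepend s' cC)).
Qed.
End chain.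

Section ionescu_tulcea.
Context {R : realType} {d : measure_display} {S : measurableType d}.
Variables (K : nat -> R.-pker S ~> S) (s0 : S).
Local Open Scope ereal_scope.
Local Notation plaw := (cylinder_law K).

Let plaw_ge0 k s C : 0 <= plaw k s C.
Proof. exact: measure_ge0. Qed.

Let plaw_le1 n k s C : cylinder n C -> plaw k s C <= 1.
Proof.
move=> cC; rewrite (cylinder_lawE _ _ _ cC).
by rewrite -(@prob_kernel _ _ _ _ _ (chain K n k) s); apply: le_measure; rewrite ?inE//; case: cC.
Qed.

Let plaw0 k s : plaw k s set0 = 0.
Proof. exact: measure0. Qed.

Let plawU k s A B : cylinders A -> cylinders B -> A `&` B = set0 ->
  plaw k s (A `|` B) = plaw k s A + plaw k s B.
Proof.
move=> [n cA] [m cB] AB0.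
have cA' := cylinder_le (leq_maxl n m) cA.
have cB' := cylinder_le (leq_maxr n m) cB.
rewrite (cylinder_lawE _ _ _ cA') (cylinder_lawE _ _ _ cB').
rewrite (cylinder_lawE _ _ _ (cylinderU cA' cB')).
by rewrite measureU//; [exact: cA.1|exact: cB.1].
Qed.

Section extinction.

(** By dominated convergence, probabilities that vanish in the limit after
    every choice of the next state also vanish before this choice. *)
Lemma next_state k s (C : nat -> set (seqspace S)) :
  (forall m, cylinders (C m)) ->
  ~ (plaw k s (C m) @[m --> \oo] --> 0) ->
  exists s', ~ (plaw k.+1 s' (prepend s' @^-1` C m) @[m --> \oo] --> 0).
Proof.
move=> cC; apply: contra_notP => /forallNP H.
have {}H s' : plaw k.+1 s' (prepend s' @^-1` C m) @[m --> \oo] --> 0.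
  exact: contrapT (H s').
have cC' s' m : cylinders (prepend s' @^-1` C m).
  have [n /(cylinder_le (leqnSn n)) cn] := cC m.
  by exists n; exact: cylinder_prepend.
have mf m : measurable_fun setT (fun s' => plaw k.+1 s' (prepend s' @^-1` C m)).
  have [n cn] := cC m.
  have mn := (cylinder_le (leqnSn n) cn).
  rewrite [X in measurable_fun _ X](_ : _ =
      (fun s' => prepend_law (chain K n k.+1) (s', s') (C m))).
    apply: (measurableT_comp (measurable_kernel (prepend_law (chain K n k.+1)) _ _)).
      by case: cn.
    exact: measurable_fun_pair.
  apply/funext => s'; rewrite (cylinder_lawE _ _ _ (cylinder_prepend s' mn)).
  by [].
have i1 : (K k s).-integrable setT (cst 1).
  apply/integrableP; split => //.
  rewrite (_ : (fun x => _) = cst 1); last first.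
    by apply/funext => x /=; rewrite normr1.
  by rewrite integral_cst// mul1e prob_kernel ltry.
have b1 s' m : setT s' -> `|plaw k.+1 s' (prepend s' @^-1` C m)| <= cst 1 s'.
  move=> _; rewrite gee0_abs ?plaw_ge0//.
  by have [n cn] := cC' s' m; exact: plaw_le1 cn.
have [_ _] := @dominated_convergence _ _ _ (K k s) setT measurableT
  (fun m s' => plaw k.+1 s' (prepend s' @^-1` C m)) (cst 0) (cst 1) mf
  (measurable_cst 0) (aeW _ (fun s' _ => H s')) i1 (aeW _ b1).
rewrite integral_cst// mul0e.
rewrite (_ : (fun m => plaw k s (C m)) =
   (fun m => \int[K k s]_s' plaw k.+1 s' (prepend s' @^-1` C m))).
  by [].
by apply/funext => m; have [n cn] := cC m; exact: (cylinder_law_rec _ _ _ cn).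
Qed.

Variable C : nat -> set (seqspace S).
Hypothesis cC : forall m, cylinders (C m).
Hypothesis ndC : forall m, C m.+1 `<=` C m.
Hypothesis C0 : ~ (plaw 0%N s0 (C m) @[m --> \oo] --> 0).

Let good k (p : S * (nat -> set (seqspace S))) :=
  [/\ forall m, cylinders (p.2 m), forall m, p.2 m.+1 `<=` p.2 m &
      ~ (plaw k p.1 (p.2 m) @[m --> \oo] --> 0)].

Let next k (p : S * (nat -> set (seqspace S))) : S :=
  if pselect (exists s', ~ (plaw k.+1 s' (prepend s' @^-1` p.2 m) @[m --> \oo] --> 0))
  is left e then projT1 (cid e) else point.

Let states := fix states k : S * (nat -> set (seqspace S)) :=
  if k is k'.+1 then
    let p := states k' in
    (next k' p, fun m => prepend (next k' p) @^-1` p.2 m)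
  else (s0, C).

Let states_good k : good k (states k).
Proof.
elim: k => [|k [cp np p0]]; first by [].
split => /=.
- move=> m; have [n /(cylinder_le (leqnSn n)) cn] := cp m.
  by exists n; exact: cylinder_prepend.
- by move=> m x; exact: np.
- rewrite /next; case: pselect => [e|]; first by case: cid.
  by case; exact: (next_state cp p0).
Qed.

(** Iterating [next_state] produces a sequence of states. As each cylinder
    depends on finitely many of them, it contains this sequence. *)
Lemma cylinders_nonempty : exists x, forall m, C m x.
Proof.
pose x k := (states k.+1).1; exists x => m.
have statesE k y : (states k).2 m y <->
    C m (fun n => if (n < k)%N then x n else y (n - k)%N).
  elim: k y => [|k IH] y.
    rewrite /=; suff -> : (fun n => y (n - 0)%N) = y by [].
    by apply/funext => n; rewrite subn0.
  rewrite [(states k.+1).2 m y]/= -/(x k).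
  rewrite (IH (prepend (x k) y)).
  rewrite (_ : (fun n => if (n < k)%N then _ else _) =
      (fun n => if (n < k.+1)%N then x n else y (n - k.+1)%N))//.
  apply/funext => n; rewrite ltnS; case: ltngtP => [//| |->].
  - by case: n => // n; rewrite ltnS => kn; rewrite subSS subSn.
  - by rewrite subnn.
have [n cn] := cC m.
have [cp np p0] := states_good n.
suff [y /statesE Cy] : (states n).2 m !=set0.
  by case: cn => _ /(_ _ x _ Cy); apply => i ->.
apply: contrapT => /set0P/negP/negPn/eqP e; apply: p0.
have npm m' : (m <= m')%N -> (states n).2 m' = set0.
  elim: m' => [|m' IH]; first by rewrite leqn0 => /eqP <-.
  rewrite leq_eqVlt => /orP[/eqP <-//|/IH e'].
  by apply/seteqP; split => // z /np; rewrite e'.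
apply: cvg_near_cst; exists m => // m' mm' /=.
by rewrite npm ?plaw0.
Qed.

End extinction.

Let mu (C : set (@cylspace _ S)) : \bar R := plaw 0%N s0 C.

(** Finite additivity and continuity at the empty set, which is the content of
    [cylinders_nonempty]. *)
Let mu_sigma_additive : semi_sigma_additive mu.
Proof.
move=> F cF tF cUF.
pose U := \bigcup_n F n.
pose A N := \big[setU/set0]_(i < N) F i.
have cA N : cylinders (A N).
  rewrite /A; elim/big_ind: _ => [|B D cB cD|i _]; first exact: cylinders0.
    exact: cylindersU.
  exact: cF.
have muA N : mu (A N) = \sum_(0 <= i < N) mu (F i).
  rewrite /A; elim: N => [|N IH]; first by rewrite big_ord0 big_geq//; exact: plaw0.
  rewrite big_ord_recr big_nat_recr//= -IH; apply: plawU => //.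
  - exact: (cA N).
  - exact: cF.
  rewrite -bigcup_mkord; apply/seteqP; split => // x [[i /= iN Fix] FNx].
  have := (trivIsetP.1 tF) i N Logic.I Logic.I (negbT (ltn_eqF iN)).
  move=> e.
  by have : (F i `&` F N) x by []; rewrite e.
pose C N := U `\` A N.
have cC N : cylinders (C N).
  rewrite /C setDE -(setCK U) -setCU; apply: cylindersC; apply: cylindersU => //.
  exact: cylindersC.
have muC N : mu (C N) = mu U - \sum_(0 <= i < N) mu (F i).
  rewrite -muA; have -> : mu U = mu (A N) + mu (C N).
    rewrite -plawU//; last by rewrite setDIK.
    congr (mu _); rewrite /C setDUK// => x; rewrite /A -bigcup_mkord => -[i _ Fi].
    by exists i.
  rewrite addeAC subee ?add0e// ge0_fin_numE//.
  by have [n cn] := cA N; rewrite (le_lt_trans (plaw_le1 _ _ cn))// ltry.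
have C0 : mu (C N) @[N --> \oo] --> 0.
  apply: contrapT => nC0; have [|x xC] := cylinders_nonempty cC _ nC0.
    move=> N x [Ux nA]; split => // Ax; apply: nA.
    by rewrite /A big_ord_recr; left.
  have [[n _ Fn]] := xC 0%N.
  have [_] := xC n.+1; rewrite /A big_ord_recr => + _; apply; by right.
have Ufin : mu U \is a fin_num.
  rewrite ge0_fin_numE//.
  by have [n cn] := cUF; rewrite (le_lt_trans (plaw_le1 _ _ cn))// ltry.
rewrite (_ : (fun n => _) = (fun n => mu U - mu (C n))).
  rewrite -[X in _ --> X]sube0; apply: cvgeB; last exact: C0.
    by rewrite fin_num_adde_defl.
  exact: (cvg_cst (mu U)).
apply/funext => N; rewrite muC -muA.
have AN : mu (A N) \is a fin_num.
  rewrite ge0_fin_numE//.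
  by have [n cn] := cA N; rewrite (le_lt_trans (plaw_le1 _ _ cn))// ltry.
by rewrite fin_num_oppeB// addeA subee// add0e.
Qed.

HB.instance Definition _ := isMeasure.Build _ _ R mu (plaw0 _ _)
  (fun C => plaw_ge0 _ _ C) mu_sigma_additive.

Let I : measurableType _ := g_sigma_algebraType (@measurable _ (@cylspace _ S)).

Let measurable_id_seqspace : measurable_fun setT (fun x : I => x : seqspace S).
Proof.
apply: measurable_fun_seqspaceP => n _ A mA; apply: sub_sigma_algebra.
rewrite setTI; exists n.+1; split.
  by rewrite -[X in measurable X]setTI; exact: measurable_coord.
by move=> x y /(_ n (ltnSn n)) /= ->.
Qed.

Let P : {measure set seqspace S -> \bar R} :=
  image_measure (measure_extension mu) measurable_id_seqspace.

Let PE C : cylinders C -> P C = mu C.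
Proof. by move=> cC; exact: measurable_mu_extE. Qed.

Let P_prob : P setT = 1.
Proof.
rewrite PE; last by exists 0%N; split.
by rewrite /mu (@cylinder_lawE _ _ _ _ 0%N)// prob_kernel.
Qed.

(** Ionescu-Tulcea: a sequence of transition kernels is the sequence of
    conditional laws of a process. *)
Theorem ionescu_tulcea : exists Q : probability (seqspace S) R,
  forall n C, cylinder n C -> Q C = chain K n 0%N s0 C.
Proof.
pose Q : probability (seqspace S) R :=
  HB.pack (Measure.sort P) (Measure_isProbability.Build _ _ _ P P_prob).
exists Q => n C cC; rewrite -[LHS]/(P C) PE; last by exists n.
exact: cylinder_lawE.
Qed.

End ionescu_tulcea.

(** * Densities and reweighted kernels *)
Section density_measure.
Context {R : realType} {d : measure_display} {T : measurableType d}.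
Variables (mu : {measure set T -> \bar R}) (h : T -> \bar R).
Hypotheses (mh : measurable_fun setT h) (h0 : forall x, (0 <= h x)%E).
Local Open Scope ereal_scope.

Definition density (A : set T) : \bar R := \int[mu]_(x in A) h x.

Let density0 : density set0 = 0. Proof. exact: integral_set0. Qed.

Let density_ge0 A : 0 <= density A. Proof. exact: integral_ge0. Qed.

Let density_sigma_additive : semi_sigma_additive density.
Proof.
move=> F mF tF mUF; rewrite /density ge0_integral_bigcup//; last first.
  exact: measurable_funTS.
by apply: is_cvg_ereal_nneg_natsum => n _; exact: integral_ge0.
Qed.

Definition density_measure : {measure set T -> \bar R} :=
  HB.pack density
    (isMeasure.Build _ _ _ density density0 density_ge0 density_sigma_additive).

Import HBNNSimple.

Let integral_density_nnsfun (g : {nnsfun T >-> R}) :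
  \int[density_measure]_x (g x)%:E = \int[mu]_x ((g x)%:E * h x).
Proof.
rewrite integralT_nnsfun sintegralE.
have mg r : measurable (g @^-1` [set r]) by [].
under [RHS]eq_integral => x _.
  rewrite fimfunE -fsumEFin// ge0_mule_fsuml; last first.
    by move=> r; rewrite nnfun_muleindic_ge0.
  over.
rewrite ge0_integral_fsum//; last 2 first.
- move=> r; apply: emeasurable_funM => //.
  by apply/measurable_EFinP; apply: measurable_funM.
- by move=> r x _; rewrite mule_ge0// nnfun_muleindic_ge0.
apply: eq_fsbigr => r /[!inE] -[t _ <-].
under [RHS]eq_integral do rewrite EFinM -muleA.
rewrite ge0_integralZl//.
- congr (_ * _); rewrite /= /density integral_mkcond; apply: eq_integral => x _.
  by rewrite epatch_indic muleC.
- by apply: emeasurable_funM => //; apply/measurable_EFinP.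
- by move=> x _; rewrite mule_ge0.
- by rewrite lee_fin.
Qed.

Lemma integral_density (g : T -> \bar R) : measurable_fun setT g ->
  (forall x, 0 <= g x) ->
  \int[density_measure]_x g x = \int[mu]_x (g x * h x).
Proof.
move=> mg g0; pose g_ := nnsfun_approx measurableT mg.
have g_cvg x : (g_ n x)%:E @[n --> \oo] --> g x.
  exact: cvg_nnsfun_approx.
have g_nd x : {homo (fun n => (g_ n x)%:E) : a b / (a <= b)%N >-> a <= b}.
  by move=> a b ab; rewrite lee_fin; exact/lefP/nd_nnsfun_approx.
transitivity (\int[density_measure]_x limn (fun n => (g_ n x)%:E)).
  by apply: eq_integral => x _; apply/esym/cvg_lim => //.
rewrite monotone_convergence//; last 2 first.
- by move=> n; exact/measurable_EFinP.
- by move=> n x _; rewrite lee_fin.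
transitivity (limn (fun n => \int[mu]_x ((g_ n x)%:E * h x))).
  by congr (limn _); apply/funext => n; rewrite integral_density_nnsfun.
rewrite -monotone_convergence//; last 3 first.
- by move=> n; apply: emeasurable_funM => //; exact/measurable_EFinP.
- by move=> n x _; rewrite mule_ge0// lee_fin.
- by move=> x _ a b ab; rewrite lee_wpmul2r//; exact: g_nd.
apply: eq_integral => x _; apply/cvg_lim => //.
have [hx|hx] := boolP (h x \is a fin_num).
  by apply: cvgeZr => //; exact: g_cvg.
(* Multiplication is discontinuous at 0 * +oo: either an approximation of g x
   is positive, and so are the later ones, or all of them are 0. *)
have {hx} -> : h x = +oo by move: hx (h0 x); case: (h x).
have [[N gN]|gn0] := pselect (exists N, g_ N x != 0%R).
  have gNpos : (0 < g_ N x)%R by rewrite lt_neqAle eq_sym gN /=.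
  have gpos : 0 < g x.
    apply: (@lt_le_trans _ _ (g_ N x)%:E); first by rewrite lte_fin.
    rewrite -(cvg_lim _ (g_cvg x))//; apply: lime_ge.
      by apply/cvg_ex; exists (g x); exact: g_cvg.
    by exists N => // n /= Nn; exact: g_nd.
  rewrite gt0_muley//; apply: cvg_near_cst; exists N => // n /= Nn.
  rewrite gt0_muley// lte_fin (lt_le_trans gNpos)//.
  by have := g_nd x _ _ Nn; rewrite lee_fin.
have g_0 n : g_ n x = 0%R by apply/eqP; apply: contra_notT gn0 => ?; exists n.
have -> : g x = 0.
  rewrite -(cvg_lim _ (g_cvg x))//.
  by under eq_fun do rewrite g_0; exact: lim_cst.
by under eq_fun do rewrite g_0; rewrite !mul0e; exact: cvg_cst.
Qed.

End density_measure.

Section more_measurability.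
Context {R : realType}.
Local Open Scope ereal_scope.

Lemma measurable_inve d (T : measurableType d) (f : T -> \bar R) :
  measurable_fun setT f -> (forall x, 0 <= f x) ->
  measurable_fun setT (fun x => (f x)^-1).
Proof.
move=> mf f0.
have fE x : (f x)^-1 = if f x == 0 then +oo else
    if f x == +oo then 0 else (powR (fine (f x)) (-1))%:E.
  case: (inveP (f x)) (f0 x) => [|||r r0] //=; rewrite ?eqxx//.
  by rewrite lee_fin eqe (negbTE r0) /= => ?; rewrite powR_inv1.
under eq_fun do rewrite fE.
have meq (c : \bar R) : measurable_fun setT (fun x => f x == c).
  apply: (measurable_fun_bool true); rewrite setTI.
  rewrite (_ : _ @^-1` _ = f @^-1` [set c]).
    by rewrite -[X in measurable X]setTI; apply: mf => //; exact: emeasurable_set1.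
  by apply/seteqP; split => x /= /eqP.
apply: measurable_fun_ifT => //; apply: measurable_fun_ifT => //.
apply/measurable_EFinP; apply: (measurableT_comp (measurable_powR _)).
exact: (measurableT_comp (fine_measurable measurableT) mf).
Qed.

Lemma measurable_indic_ereal d (O : measurableType d) (U : set O) : measurable U ->
  measurable_fun setT (fun x => (\1_U x)%:E : \bar R).
Proof. by move=> mU; apply/measurable_EFinP; exact: measurable_indic. Qed.

Lemma integral_shift (g : R -> \bar R) (c : R) : measurable_fun setT g ->
  (forall x, 0 <= g x) ->
  \int[lebesgue_measure]_x g (x + c)%R = \int[lebesgue_measure]_x g x.
Proof.
move=> mg g0.
pose sh : measurableTypeR R -> measurableTypeR R := fun x => (x + c)%R.
have ms : measurable_fun setT sh by apply: measurable_funD.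
have := @ge0_integral_pushforward _ _ _ _ _ _ ms lebesgue_measure setT g
  measurableT mg (fun x _ => g0 x).
rewrite preimage_setT => <-.
apply: (@eq_measure_integral _ _ _ _ lebesgue_measure
  (image_measure lebesgue_measure ms)) => A mA _.
apply/esym/lebesgue_measure_unique => //= _ [[a b]] _ <-.
rewrite /pushforward.
rewrite (_ : _ @^-1` _ = `](a - c)%R, (b - c)%R]%classic); last first.
  by apply/seteqP; split => x /=; rewrite !in_itv/= ltrBlDr lerBrDr.
rewrite !lebesgue_measure_itv/= !lte_fin ltrD2r.
by case: ifP => // _; rewrite -!EFinB; congr EFin; ring.
Qed.

End more_measurability.

Section reweighting.
Context {R : realType} {d d1 d2 : measure_display} {Om : measurableType d}
  {S : measurableType d1} {S' : measurableType d2}.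
Variables (P : probability Om R) (g : S * Om -> \bar R) (u : S * Om -> S').
Local Open Scope ereal_scope.
Hypotheses (mg : measurable_fun setT g) (g0 : forall p, 0 <= g p).
Hypothesis g1 : forall s, \int[P]_w g (s, w) = 1.
Hypothesis mu : measurable_fun setT u.

Let mg1 s : measurable_fun setT (fun w => g (s, w)).
Proof. exact: (measurableT_comp mg (measurable_pair1 s)). Qed.

Let mu1 s : measurable_fun setT (fun w => u (s, w)).
Proof. exact: (measurableT_comp mu (measurable_pair1 s)). Qed.

(** The new state is u (s, w), where w is drawn from P biased by g (s, _). *)
Definition reweighted (s : S) : {measure set S' -> \bar R} :=
  image_measure (density_measure P (mg1 s) (fun w => g0 (s, w))) (mu1 s).

Let measurable_reweighted U : measurable U ->
  measurable_fun setT (reweighted ^~ U).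
Proof.
move=> mU.
have mh : measurable_fun setT (fun p : S * Om => (\1_U (u p))%:E * g p).
  apply: emeasurable_funM => //; apply/measurable_EFinP.
  have mi : measurable_fun setT (\1_U : S' -> R) by exact: measurable_indic.
  exact: (measurableT_comp mi mu).
have h0 p : 0 <= (\1_U (u p))%:E * g p by rewrite mule_ge0// lee_fin.
apply: eq_measurable_fun (measurable_fun_fubini_tonelli_F (m2 := P) _ mh h0) => s _.
rewrite /fubini_F /reweighted /= /pushforward /= /density.
rewrite [RHS]integral_mkcond; apply: eq_integral => w _.
by rewrite epatch_indic muleC.
Qed.

HB.instance Definition _ := isKernel.Build _ _ _ _ R reweighted measurable_reweighted.

Let reweighted_prob s : reweighted s setT = 1.
Proof. exact: g1. Qed.

HB.instance Definition _ := Kernel_isProbability.Build _ _ _ _ R reweighted reweighted_prob.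

Definition reweighted_kernel : R.-pker S ~> S' := reweighted.

Lemma integral_reweighted s F : measurable_fun setT F -> (forall x, 0 <= F x) ->
  \int[reweighted_kernel s]_x F x = \int[P]_w (F (u (s, w)) * g (s, w)).
Proof.
move=> mF F0; rewrite [LHS](ge0_integral_pushforward (mu1 s))//.
rewrite preimage_setT.
have mFu : measurable_fun setT (F \o (fun w => u (s, w))).
  exact: (measurableT_comp mF (mu1 s)).
apply: (integral_density P (mg1 s) (fun w => g0 (s, w)) mFu) => w.
exact: F0.
Qed.

End reweighting.

Section kernel_probability.
Context {R : realType} {d d' : measure_display} {S : measurableType d}
  {S' : measurableType d'}.
Variables (k : R.-pker S ~> S') (s : S).
Let law : set S' -> \bar R := k s.
HB.instance Definition _ := Measure.copy law (k s).
Let law1 : law setT = 1%E. Proof. exact: prob_kernel. Qed.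
HB.instance Definition _ := Measure_isProbability.Build _ _ _ law law1.
Definition kernel_probability : probability S' R := law.
End kernel_probability.

(** * The bridge as a Markov chain of blocks *)
Lemma mulee_inv {R : realType} (x : \bar R) : (0 < x)%E -> (x < +oo)%E ->
  (x * x^-1 = 1)%E.
Proof.
case: x => [r| |]//; rewrite lte_fin => r0 _.
by rewrite inver gt_eqF// -EFinM divff// gt_eqF.
Qed.

Section bridge_chain.
Context {R : realType} (T : R) (T0 : 0 < T).
Context (nu : probability (measurableTypeR R) R).
Context {dX : measure_display} {OmX : measurableType dX}.
Context (PX : probability OmX R) (X : R -> OmX -> R) (f : R -> R -> \bar R).
Hypothesis hf : lrb_parameters f T nu PX X.
Local Open Scope ereal_scope.

Lemma lrb_levy : levy_law (V := measurableTypeR R) 0%R (fun x y : R => x - y)%R PX X.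
Proof. by case: hf => -[]. Qed.
Let levyX := lrb_levy.

Lemma density_measurable t : (0 < t)%R -> measurable_fun setT (f t).
Proof. by move=> t0; case: hf => _ /(_ t t0)[]. Qed.

Lemma density_nonneg t x : (0 < t)%R -> 0 <= f t x.
Proof. by move=> t0; case: hf => _ /(_ t t0)[]. Qed.

Lemma integral_levy_density t g : (0 < t <= T)%R -> measurable_fun setT g ->
  (forall x, 0 <= g x) ->
  \int[PX]_w g (X t w) = \int[lebesgue_measure]_x (g x * f t x).
Proof.
move=> tT mg g0; have /andP[t0 _] := tT.
pose Xt : OmX -> measurableTypeR R := X t.
have mX : measurable_fun setT Xt by exact: (levy_measurable levyX (ltW t0)).
pose law := image_measure PX mX.
pose dens := density_measure lebesgue_measure (density_measurable t0)
  (fun x => density_nonneg x t0).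
transitivity (\int[law]_x g x).
  by rewrite (ge0_integral_pushforward mX PX measurableT).
transitivity (\int[dens]_x g x); last exact: integral_density.
apply: (@eq_measure_integral _ _ _ _ dens law).
by move=> A mA _; case: hf => _ _ /(_ t tT A mA).
Qed.

Lemma levy_stationary a s : (0 <= a)%R -> (0 <= s)%R ->
  forall A, measurable A ->
  PX ((fun w => X (a + s)%R w - X a w)%R @^-1` A) = PX (X s @^-1` A).
Proof. by move=> a0 s0 A mA; case: levyX => _ _ /(_ a s A a0 s0 mA). Qed.

(** The Chapman-Kolmogorov equation as an expectation. *)
Lemma density_increment a s t y : (0 <= a)%R -> (0 <= s < t)%R -> (t <= T)%R ->
  \int[PX]_w f (t - s)%R (y - (X (a + s)%R w - X a w))%R = f t y.
Proof.
move=> a0 /andP[s0 st] tT.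
have ts0 : (0 < t - s)%R by rewrite subr_gt0.
have mg : measurable_fun setT (fun v : R => f (t - s)%R (y - v)%R).
  apply: (measurableT_comp (density_measurable ts0)).
  exact: measurable_funB.
have as0 : (0 <= a + s)%R by exact: addr_ge0.
have mXB := levy_measurableB levyX a0 as0.
have mXs := levy_measurable levyX s0.
transitivity (\int[PX]_w f (t - s)%R (y - X s w)%R).
  apply: (@law_integral _ _ _ _ _ PX PX _ _ _ _ _ mXB mXs
    (levy_stationary a0 s0) mg) => v.
  exact: density_nonneg.
(* The hypotheses give no density at time 0, where X vanishes almost surely. *)
have [s00|sn0] := eqVneq s 0%R.
  have mgX : measurable_fun setT (fun w => f (t - s)%R (y - X s w)%R).
    exact: (measurableT_comp mg mXs).
  rewrite (ge0_ae_eq_integral (g := cst (f t y)) measurableT mgX).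
  - by rewrite integral_cst//= probability_setT mule1.
  - exact: measurable_cst.
  - by move=> w _; exact: density_nonneg.
  - by move=> w _; apply: density_nonneg; exact: le_lt_trans st.
  - case: levyX => _ X0 _ _.
    by apply: filterS X0 => w /= Xw _; rewrite s00 Xw !subr0.
have spos : (0 < s)%R by rewrite lt_neqAle eq_sym sn0.
rewrite (@integral_levy_density s (fun v => f (t - s)%R (y - v)%R))//.
- by case: hf => _ _ _ /(_ s t y spos st tT) <-.
- by rewrite spos (le_trans (ltW st)).
- by move=> v; exact: density_nonneg.
Qed.

(** Block k covers the times between tau k and tau k.+1, so that tau 0 = 0 and
    the blocks accumulate at T. *)
Definition remaining (k : nat) : R := T / k.+1%:R.
Definition tau (k : nat) : R := T - remaining k.
Definition block (k : nat) : R := tau k.+1 - tau k.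

Lemma remainingE k : remaining k = (T / k.+1%:R)%R. Proof. by []. Qed.

Lemma tauE k : tau k = (T - remaining k)%R. Proof. by []. Qed.

Lemma remaining_gt0 k : (0 < remaining k)%R. Proof. by rewrite divr_gt0. Qed.

Lemma remainingS k : (remaining k.+1 < remaining k)%R.
Proof. by rewrite ltr_pM2l// ltf_pV2 ?posrE// ltr_nat. Qed.

Lemma remaining_le k : (remaining k <= T)%R.
Proof.
by rewrite ler_pdivrMr// ler_peMr ?(ltW T0)// ler1n.
Qed.

Lemma remaining0 : remaining 0 = T. Proof. by rewrite /remaining divr1. Qed.

Lemma blockE k : block k = (remaining k - remaining k.+1)%R.
Proof. by rewrite /block /tau; ring. Qed.

Lemma block_gt0 k : (0 < block k)%R.
Proof. by rewrite blockE subr_gt0 remainingS. Qed.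

Lemma block_lt k : (0 <= block k < remaining k)%R.
Proof. by rewrite (ltW (block_gt0 k)) blockE ltrBlDr ltrDl remaining_gt0. Qed.

Lemma remaining_block k : (remaining k - block k = remaining k.+1)%R.
Proof. by rewrite blockE; ring. Qed.

(** A state consists of the end point z, of the position at the end of the last
    block, and of an outcome whose trajectory is that of the last block. *)
Local Notation state := ((R * R) * OmX)%type.

Definition gap (s : state) : R := (s.1.1 - s.1.2)%R.
Definition increment k (w : OmX) : R := (X (block k) w - X 0%R w)%R.
Definition move_state k (p : state * OmX) : state :=
  ((p.1.1.1, p.1.1.2 + increment k p.2)%R, p.2).

(** The density, with respect to a free step, of a step conditioned on hitting
    the end point. The default 1 makes it a probability density everywhere. *)
Definition tilt k (p : state * OmX) : \bar R :=
  if (0 < f (remaining k) (gap p.1)) && (f (remaining k) (gap p.1) < +oo) then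
    f (remaining k.+1) (gap p.1 - increment k p.2)%R / f (remaining k) (gap p.1)
  else 1.

Lemma gap_move k s w : gap (move_state k (s, w)) = (gap s - increment k w)%R.
Proof. by rewrite /gap /=; ring. Qed.

Lemma measurable_increment k : measurable_fun setT (increment k).
Proof. exact: (levy_measurableB levyX (lexx 0%R) (ltW (block_gt0 k))). Qed.

Lemma measurable_gap : measurable_fun setT gap.
Proof.
by apply: measurable_funB; apply: measurableT_comp => //; exact: measurableT_comp.
Qed.

Lemma measurable_move k : measurable_fun setT (move_state k).
Proof.
apply: measurable_fun_pair => //=; apply: measurable_fun_pair => /=.
  by apply: measurableT_comp => //; exact: measurableT_comp.
apply: measurable_funD.
  apply: (measurableT_comp measurable_snd).
  exact: (measurableT_comp measurable_fst measurable_fst).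
exact: (measurableT_comp (measurable_increment k) measurable_snd).
Qed.

Let measurable_f_gap k : measurable_fun setT (fun s : state => f (remaining k) (gap s)).
Proof. exact: (measurableT_comp (density_measurable (remaining_gt0 k)) measurable_gap). Qed.

Let f_ge0 k x : 0 <= f (remaining k) x.
Proof. exact: density_nonneg (remaining_gt0 k). Qed.

Lemma measurable_tilt k : measurable_fun setT (tilt k).
Proof.
have m1 : measurable_fun setT (fun p : state * OmX => f (remaining k) (gap p.1)).
  exact: (measurableT_comp (measurable_f_gap k) measurable_fst).
apply: measurable_fun_ifT => //.
- by apply: measurable_and; exact: measurable_fun_lte.
- apply: emeasurable_funM; last exact: measurable_inve.
  apply: (measurableT_comp (density_measurable (remaining_gt0 k.+1))).
  apply: measurable_funB.
    exact: (measurableT_comp measurable_gap measurable_fst).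
  exact: (measurableT_comp (measurable_increment k) measurable_snd).
Qed.

Lemma tilt_ge0 k p : 0 <= tilt k p.
Proof. by rewrite /tilt; case: ifP => // _; rewrite mule_ge0// inve_ge0. Qed.

Lemma integral_next_density k x :
  \int[PX]_w f (remaining k.+1) (x - increment k w)%R = f (remaining k) x.
Proof.
have := density_increment x (lexx 0%R) (block_lt k) (remaining_le k).
by rewrite remaining_block add0r.
Qed.

Let measurable_next k x :
  measurable_fun setT (fun w => f (remaining k.+1) (x - increment k w)%R).
Proof.
apply: (measurableT_comp (density_measurable (remaining_gt0 k.+1))).
by apply: measurable_funB => //; exact: measurable_increment.
Qed.

Lemma integral_tilt k s : \int[PX]_w tilt k (s, w) = 1.
Proof.
rewrite /tilt/=; set b := _ && _; have [/andP[fpos foo]|_] := boolP b; last first.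
  by rewrite integral_cst//= probability_setT mule1.
rewrite ge0_integralZr//; last by rewrite inve_ge0.
by rewrite integral_next_density mulee_inv.
Qed.

(** The third component is arbitrary: no block has been drawn yet. *)
Definition start (z : R) : state := ((z, 0%R), point).

Lemma measurable_start :
  measurable_fun setT (fun p : state * measurableTypeR R => start p.2).
Proof. by apply: measurable_fun_pair => //=; exact: measurable_fun_pair. Qed.

Let cst1_ge0 (A : Type) (p : A) : 0 <= cst (1 : \bar R) p.
Proof. by []. Qed.

Let integral_cst1 d (O : measurableType d) (P : probability O R) (s : state) :
  \int[P]_w (cst 1 : state * O -> \bar R) (s, w) = 1.
Proof. by rewrite integral_cst//= probability_setT mule1. Qed.

Definition start_kernel : R.-pker state ~> state :=
  reweighted_kernel (measurable_cst 1) (@cst1_ge0 _)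
    (@integral_cst1 _ _ nu) measurable_start.

Definition free_kernel k : R.-pker state ~> state :=
  reweighted_kernel (measurable_cst 1) (@cst1_ge0 _)
    (@integral_cst1 _ _ PX) (measurable_move k).

Definition tilted_kernel k : R.-pker state ~> state :=
  reweighted_kernel (measurable_tilt k) (tilt_ge0 k)
    (integral_tilt k) (measurable_move k).

Definition free_chain n k := chain free_kernel n k.
(** Step 0 draws the end point, hence step k.+1 draws block k. *)
Definition bridge_kernel (k : nat) : R.-pker state ~> state :=
  if k is k'.+1 then tilted_kernel k' else start_kernel.

Lemma integral_start s F : measurable_fun setT F -> (forall x, 0 <= F x) ->
  \int[start_kernel s]_x F x = \int[nu]_z F (start z).
Proof.
move=> mF F0; rewrite integral_reweighted//.
by apply: eq_integral => z _; rewrite mule1.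
Qed.

Lemma integral_free k s F : measurable_fun setT F -> (forall x, 0 <= F x) ->
  \int[free_kernel k s]_x F x = \int[PX]_w F (move_state k (s, w)).
Proof.
move=> mF F0; rewrite integral_reweighted//.
by apply: eq_integral => w _; rewrite mule1.
Qed.

Lemma integral_tilted k s F : measurable_fun setT F -> (forall x, 0 <= F x) ->
  \int[tilted_kernel k s]_x F x =
  \int[PX]_w (F (move_state k (s, w)) * tilt k (s, w)).
Proof. by move=> mF F0; rewrite integral_reweighted. Qed.

Definition end_gap n (s : state) (x : seqspace state) : R :=
  gap (if n is n'.+1 then x n' else s).

Lemma end_gap_prepend n s s' x : end_gap n.+1 s (prepend s' x) = end_gap n s' x.
Proof. by case: n. Qed.

Lemma measurable_end_gap n :
  measurable_fun setT (fun p : state * seqspace state => end_gap n p.1 p.2).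
Proof.
case: n => [|n].
  exact: (measurableT_comp measurable_gap measurable_fst).
apply: (measurableT_comp measurable_gap).
exact: (measurableT_comp (measurable_coord n) measurable_snd).
Qed.

Let measurable_f_end_gap n k s : measurable_fun setT
  (fun x : seqspace state => f (remaining k) (end_gap n s x)).
Proof.
apply: (measurableT_comp (density_measurable (remaining_gt0 k))).
exact: (measurableT_comp (measurable_end_gap n) (measurable_pair1 s)).
Qed.

(** The density of reaching the end point is harmonic for the free chain, by
    the Chapman-Kolmogorov equation. *)
Lemma integral_free_chain_density n k s :
  \int[free_chain n k s]_x f (remaining (k + n)%N) (end_gap n s x) =
  f (remaining k) (gap s).
Proof.
elim: n k s => [|n IH] k s.
  rewrite addn0 (eq_integral (cst (f (remaining k) (gap s))))// integral_cst//.
  by rewrite (prob_kernel (s := free_chain 0 k)) mule1.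
rewrite integral_chainS//.
under eq_integral => s' _.
  under eq_integral do rewrite end_gap_prepend -addSnnS.
  rewrite IH.
  over.
rewrite integral_free//.
under eq_integral do rewrite gap_move.
exact: integral_next_density.
Qed.

Let measurable_kernel_integral n k (U : set (seqspace state)) m : measurable U ->
  measurable_fun setT (fun s' => \int[free_chain n k s']_x
    ((\1_U (prepend s' x))%:E * f (remaining m) (end_gap n s' x))).
Proof.
move=> mU.
apply: (@measurable_fun_integral_finite_kernel _ _ _ _ R
  (fun p : state * seqspace state =>
     (\1_U (prepend p.1 p.2))%:E * f (remaining m) (end_gap n p.1 p.2))
  (free_chain n k)).
  by move=> p; rewrite mule_ge0// lee_fin.
apply: emeasurable_funM.
  exact: (measurableT_comp (measurable_indic_ereal mU) measurable_prepend).
exact: (measurableT_comp (density_measurable (remaining_gt0 m)) (measurable_end_gap n)).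
Qed.

Lemma measurable_prepend_chain (K : nat -> R.-pker state ~> state) n k
    (U : set (seqspace state)) : measurable U ->
  measurable_fun setT (fun s' => chain K n k s' (prepend s' @^-1` U)).
Proof.
move=> mU.
apply: eq_measurable_fun (measurableT_comp
  (measurable_kernel (prepend_law (chain K n k)) U mU)
  (measurable_fun_pair (@measurable_id _ _ _) (@measurable_id _ _ _))).
by [].
Qed.

(** Doob transform: the tilts of the successive blocks telescope to the ratio of
    the final and of the initial density of reaching the end point. *)
Lemma chain_bridge n k s U : measurable U -> f (remaining k) (gap s) < +oo ->
  f (remaining k) (gap s) * chain bridge_kernel n k.+1 s U =
  \int[free_chain n k s]_x ((\1_U x)%:E * f (remaining (k + n)%N) (end_gap n s x)).
Proof.
elim: n k s U => [|n IH] k s U mU foo.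
  rewrite addn0 /=.
  rewrite integral_dirac//.
    by rewrite diracT mul1e diracE indicE muleC.
  apply: emeasurable_funM => //; exact: measurable_indic_ereal.
rewrite chainS// integral_chainS//; last 2 first.
- by move=> x; rewrite mule_ge0// lee_fin.
- by apply: emeasurable_funM => //; exact: measurable_indic_ereal.
under [RHS]eq_integral => s' _.
  under eq_integral do rewrite end_gap_prepend -addSnnS.
  over.
rewrite integral_tilted//; last exact: measurable_prepend_chain.
rewrite [RHS]integral_free//; last 2 first.
- exact: measurable_kernel_integral.
- by move=> s'; apply: integral_ge0 => x _; rewrite mule_ge0// lee_fin.
have mH := measurable_kernel_integral n k.+1 (k.+1 + n) mU.
have mHw : measurable_fun setT (fun w => \int[free_chain n k.+1 (move_state k (s, w))]_x
    ((\1_U (prepend (move_state k (s, w)) x))%:E *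
     f (remaining (k.+1 + n)) (end_gap n (move_state k (s, w)) x))).
  apply: (measurableT_comp mH).
  exact: (measurableT_comp (measurable_move k) (measurable_pair1 s)).
have H0 w : 0 <= \int[free_chain n k.+1 (move_state k (s, w))]_x
    ((\1_U (prepend (move_state k (s, w)) x))%:E *
     f (remaining (k.+1 + n)) (end_gap n (move_state k (s, w)) x)).
  by apply: integral_ge0 => x _; rewrite mule_ge0// lee_fin.
have mt : measurable_fun setT (fun w => tilt k (s, w)).
  exact: (measurableT_comp (measurable_tilt k) (measurable_pair1 s)).
have mG : measurable_fun setT (fun w => chain bridge_kernel n k.+2 (move_state k (s, w))
    (prepend (move_state k (s, w)) @^-1` U)).
  apply: (measurableT_comp (measurable_prepend_chain bridge_kernel n k.+2 mU)).
  exact: (measurableT_comp (measurable_move k) (measurable_pair1 s)).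
(* If the density vanishes at s then, being harmonic, it vanishes almost surely
   after n blocks. *)
have [f0|fn0] := eqVneq (f (remaining k) (gap s)) 0.
  rewrite f0 mul0e; apply/esym/eqP; rewrite eq_le; apply/andP; split; last first.
    exact: integral_ge0.
  rewrite -f0 -(integral_next_density k (gap s)).
  apply: ge0_le_integral => //.
  move=> w _; rewrite -gap_move -(integral_free_chain_density n k.+1).
  set s' := move_state k (s, w).
  have mI : measurable_fun setT (fun x => (\1_U (prepend s' x))%:E : \bar R).
    exact: (measurableT_comp (measurable_indic_ereal mU) (measurable_prepend1 s')).
  apply: ge0_le_integral => //.
  - by move=> x _; rewrite mule_ge0// lee_fin.
  - by apply: emeasurable_funM.
  - move=> x _; rewrite -[leRHS]mul1e lee_wpmul2r// lee_fin indicE.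
    by case: (_ \in _).
have fpos : 0 < f (remaining k) (gap s) by rewrite lt_neqAle eq_sym fn0 f_ge0.
rewrite -ge0_integralZl//; last 2 first.
- exact: emeasurable_funM.
- by move=> w _; rewrite mule_ge0// tilt_ge0.
apply: ge0_ae_eq_integral => //.
- by apply: measurable_funeM; exact: emeasurable_funM.
- by move=> w _; rewrite !mule_ge0// tilt_ge0.
have : PX.-integrable setT (fun w => f (remaining k.+1) (gap s - increment k w)%R).
  apply/integrableP; split; first exact: measurable_next.
  under eq_integral do rewrite gee0_abs//.
  by rewrite integral_next_density.
move=> /integrable_ae => /(_ measurableT).
apply: filterS => w /(_ Logic.I) fin _.
have foo' : f (remaining k.+1) (gap (move_state k (s, w))) < +oo.
  by rewrite gap_move -ge0_fin_numE.
rewrite -(IH _ _ _ _ foo'); last first.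
  by rewrite -[X in measurable X]setTI; exact: measurable_prepend1.
rewrite /tilt fpos foo gap_move.
set c := chain _ _ _ _ _; set a := f (remaining k) _; set b := f (remaining k.+1) _.
rewrite -[LHS]/(a * (c * (b / a))) -[RHS]/(b * c).
by rewrite !muleA [a * c]muleC -!muleA [X in c * X]muleCA mulee_inv// mule1 muleC.
Qed.

End bridge_chain.

Lemma sum_telescope {R : zmodType} n (u : nat -> R) :
  \sum_(k < n) (u k.+1 - u k) = u n - u 0%N.
Proof.
by rewrite -(big_mkord xpredT (fun k => u k.+1 - u k)) telescope_sumr.
Qed.

(** The times tt are sorted; c j locates tt j among them. *)
Lemma time_grid {R : realType} (J : finType) (tt : J -> R) (a b : R) : a <= b ->
  (forall j, a <= tt j <= b) ->
  exists M (s : nat -> R) (c : J -> nat),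
    [/\ s 0%N = a, {homo s : i j / (i <= j)%N >-> i <= j},
        forall j, (c j <= M)%N, forall j, s (c j) = tt j & s M.+1 = b].
Proof.
move=> ab ttab.
pose l := sort <=%R [seq tt j | j <- enum J].
pose s i := nth b (a :: l) i.
have lE x : (x \in l) = (x \in [seq tt j | j <- enum J]).
  by rewrite mem_sort.
have ttl j : tt j \in l by rewrite lE; apply/mapP; exists j; rewrite ?mem_enum.
have lab x : x \in l -> a <= x <= b by rewrite lE => /mapP[j _ ->].
exists (size l), s, (fun j => (index (tt j) l).+1); split => //.
- apply: homo_leq => [//||i]; first exact: le_trans.
  rewrite /s; have [il|li] := ltnP i (size l); last first.
    rewrite [leRHS]nth_default//; case: i li => [|i] _ /=; first exact: ab.
    have [il|li] := ltnP i (size l); last by rewrite nth_default.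
    by have /andP[] := lab _ (mem_nth b il).
  have : path <=%R a l.
    rewrite path_min_sorted; first exact: sort_le_sorted.
    by apply/allP => x /lab /andP[].
  by move=> /(pathP b) /(_ _ il).
- by move=> j; rewrite index_mem.
- by move=> j; rewrite /s /= nth_index.
- by rewrite /s /= nth_default.
Qed.

Section block_law.
Context {R : realType} (T : R) (T0 : 0 < T).
Context (nu : probability (measurableTypeR R) R).
Context {dX : measure_display} {OmX : measurableType dX}.
Context (PX : probability OmX R) (X : R -> OmX -> R) (f : R -> R -> \bar R).
Hypothesis hf : lrb_parameters f T nu PX X.
Local Open Scope ereal_scope.
Local Notation state := ((R * R) * OmX)%type.
Let levyX := lrb_levy hf.
Local Notation free_chain := (free_chain T0 hf).
Local Notation tau := (tau T).
Local Notation block := (block T).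

Lemma measurable_coord_set n (E : nat -> set OmX) : (forall i, measurable (E i)) ->
  measurable [set x : seqspace state | forall i, (i < n)%N -> E i (x i).2].
Proof.
move=> mE; rewrite (_ : [set x | _] =
    \bigcap_(i in `I_n) [set x : seqspace state | E i (x i).2])//.
apply: bigcap_measurableType => // i _.
rewrite -[X in measurable X]setTI.
exact: (measurableT_comp measurable_snd (measurable_coord i)).
Qed.

Lemma free_chain_blocks n k s (E : nat -> set OmX) : (forall i, measurable (E i)) ->
  free_chain n k s [set x | forall i, (i < n)%N -> E i (x i).2] =
  \prod_(i < n) PX (E i).
Proof.
elim: n k s E => [|n IH] k s E mE.
  rewrite big_ord0 (_ : [set x | _] = setT); last by apply/seteqP; split.
  exact: prob_kernel.
rewrite chainS; last exact: measurable_coord_set.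
rewrite (eq_integral (fun s' => (\1_(E 0%N) s'.2)%:E * \prod_(i < n) PX (E i.+1)));
    last first.
  move=> s' _; rewrite indicE; have [Es'|nEs'] := pselect (E 0%N s'.2).
    rewrite mem_set// mul1e -(IH k.+1 s' (fun i => E i.+1))//.
    congr (chain _ _ _ _ _); apply/seteqP; split => x /= H.
      by move=> i ilt; exact: (H i.+1).
    by case=> [|i] //= ilt; exact: H.
  rewrite memNset// mul0e (_ : _ @^-1` _ = set0) ?measure0//.
  by apply/seteqP; split => // x /(_ 0%N (ltn0Sn n)).
have m1 : measurable_fun setT (fun s' : state => (\1_(E 0%N) s'.2)%:E : \bar R).
  apply/measurable_EFinP.
  have mi : measurable_fun setT (\1_(E 0%N) : OmX -> R) by exact: measurable_indic.
  exact: (measurableT_comp mi measurable_snd).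
have h0 s' : 0 <= (\1_(E 0%N) (s' : state).2)%:E :> \bar R by rewrite lee_fin.
have p0 : 0 <= \prod_(i < n) PX (E i.+1) by apply: prode_ge0.
rewrite ge0_integralZr// integral_free//.
by rewrite /= integral_indic// setIT big_ord_recl.
Qed.

Definition clamp k t : R := Num.max 0%R (Num.min (t - tau k)%R (block k)).

(** Block k contributes its increment up to time t, which is frozen at 0 before
    tau k and at its final value after tau k.+1. *)
Definition block_path n (x : nat -> state) (t : R) : R :=
  \sum_(k < n) (X (clamp k t) (x k).2 - X 0%R (x k).2).

Lemma block_path_sum n x t :
  block_path n x t = (\sum_(k < n) (X (clamp k t) (x k).2 - X 0 (x k).2))%R.
Proof. by []. Qed.

Lemma tau0 : tau 0 = 0%R. Proof. by rewrite tauE remaining0 subrr. Qed.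
Lemma tauS k : (tau k <= tau k.+1)%R.
Proof. by rewrite lerD2l lerN2 ltW// remainingS. Qed.

Lemma tau_ge0 k : (0 <= tau k)%R.
Proof. by rewrite subr_ge0 remaining_le. Qed.

Lemma clamp_ge0 k t : (0 <= clamp k t)%R. Proof. by rewrite le_max lexx. Qed.

Lemma clamp_le k s t : (s <= t)%R -> (clamp k s <= clamp k t)%R.
Proof.
move=> st; rewrite /clamp ge_max !le_max lexx /=.
by rewrite le_min !ge_min lerD2r st lexx !orbT.
Qed.

Lemma clamp0 k t : (t <= tau k)%R -> clamp k t = 0%R.
Proof.
by move=> tk; apply/max_idPl; rewrite ge_min subr_le0 tk.
Qed.

Lemma clamp_block k t : (tau k.+1 <= t)%R -> clamp k t = block k.
Proof.
move=> kt; rewrite /clamp min_r ?lerD2r// max_r// ltW//; exact: block_gt0.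
Qed.

Lemma tau_clamp k t : (tau k <= t)%R -> (t <= tau k.+1)%R ->
  (tau k + clamp k t = t)%R.
Proof.
move=> kt tk; rewrite /clamp min_l ?lerD2r// max_r ?subr_ge0//.
by rewrite addrC subrK.
Qed.

Lemma tau_block k : (tau k + block k = tau k.+1)%R.
Proof. by rewrite addrC subrK. Qed.

Lemma tau_ltT k : (tau k < T)%R.
Proof. by rewrite ltrBlDr ltrDl remaining_gt0. Qed.

Lemma levy_telescope n t w : (0 <= t <= tau n)%R ->
  (\sum_(k < n) (X (tau k + clamp k t) w - X (tau k) w) = X t w - X 0 w)%R.
Proof.
move=> /andP[t0 tn].
suff -> : (\sum_(k < n) (X (tau k + clamp k t) w - X (tau k) w) =
    X (Num.min t (tau n)) w - X 0 w)%R by rewrite min_l.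
elim: n {tn} => [|n IH]; first by rewrite big_ord0 tau0 min_r// subrr.
rewrite big_ord_recr/= IH; have [tn|nt] := leP t (tau n).
  by rewrite clamp0// addr0 min_l ?subrr ?addr0// (le_trans tn (tauS n)).
have [tn1|nt1] := leP t (tau n.+1).
  by rewrite (tau_clamp (ltW nt) tn1); ring.
by rewrite (clamp_block (ltW nt1)) tau_block; ring.
Qed.

(** The free chain draws independent trajectories of X, of which block k uses
    the initial stretch of length [block k]: put end to end they have the law of
    one trajectory, by independence and stationarity of the increments. *)
Lemma block_path_law n s0 (J : finType) (tt : J -> R) (G : (J -> R) -> \bar R) :
  (forall j, 0 <= tt j <= tau n)%R ->
  measurable_fun setT (fun v : #|J|.-tuple R => G (of_tuple v)) ->
  (forall y, 0 <= G y) ->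
  \int[free_chain n 0 s0]_x G (fun j => block_path n x (tt j)) =
  \int[PX]_w G (fun j => X (tt j) w - X 0%R w)%R.
Proof.
move=> ttn mG G0.
have ttT j : (0 <= tt j <= T)%R.
  by have /andP[-> /= h] := ttn j; rewrite (le_trans h)// ltW// tau_ltT.
have [M [s [c [s0E ns cM sc sM]]]] := time_grid (ltW T0) ttT.
pose cc i j := (tau i + clamp i (s j))%R.
have sT j : (0 <= s j)%R by rewrite -s0E; exact: ns.
have cc0 : (0 <= cc 0%N 0%N)%R by rewrite addr_ge0 ?tau_ge0 ?clamp_ge0.
have ccS i j : (j <= M)%N -> (cc i j <= cc i j.+1)%R.
  by move=> _; rewrite lerD2l clamp_le//; exact: ns.
have ccM i : cc i M.+1 = cc i.+1 0%N.
  rewrite /cc sM s0E clamp_block ?(ltW (tau_ltT _))// clamp0 ?tau_ge0//.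
  by rewrite addr0 tau_block.
have hX := levy_family_lex levyX n cc0 ccS ccM.
pose P := kernel_probability (free_chain n 0) s0.
pose I : finType := ('I_n * 'I_M.+1)%type.
pose Y (p : I) (x : seqspace state) :=
  (X (clamp p.1 (s p.2.+1)) (x p.1).2 - X (clamp p.1 (s p.2)) (x p.1).2)%R.
have mXc i j : measurable_fun setT (X (clamp i (s j))).
  exact: levy_measurable levyX _ (clamp_ge0 _ _).
have hF : levy_family PX X P Y (fun p => cc p.1 p.2.+1 - cc p.1 p.2)%R.
  split => [p|A mA].
    have m2 : measurable_fun setT (fun x : seqspace state => (x p.1).2).
      exact: (measurableT_comp measurable_snd (measurable_coord p.1)).
    apply: measurable_funB.
      exact: (measurableT_comp (mXc p.1 p.2.+1) m2).
    exact: (measurableT_comp (mXc p.1 p.2) m2).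
  pose E i := [set w | forall j : 'I_M.+1,
    (if insub i is Some i' then A (i', j) else setT)
    (X (clamp i (s j.+1)) w - X (clamp i (s j)) w)%R].
  have mE i : measurable (E i).
    apply: (measurable_family_box (A := fun j => if insub i is Some i' then
      A (i', j) else setT) (Y := fun (j : 'I_M.+1) w =>
      X (clamp i (s j.+1)) w - X (clamp i (s j)) w)%R) => j.
      exact: measurable_funB.
    by case: insubP.
  rewrite (_ : [set x | _] =
    [set x : seqspace state | forall i, (i < n)%N -> E i (x i).2]); last first.
    apply/seteqP; split => x /= H.
      by move=> i ilt j; rewrite insubT; exact: (H (Ordinal ilt, j)).
    move=> [i j]; have := H i (ltn_ord i) j; by rewrite valK.
  rewrite [LHS](free_chain_blocks n 0 s0 mE).
  transitivity (\prod_(i < n) \prod_(j < M.+1)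
      PX (X (cc i j.+1 - cc i j)%R @^-1` A (i, j))); last first.
    by rewrite pair_bigA; apply: eq_bigr => -[].
  apply: eq_bigr => i _.
  have cl0 : (0 <= clamp i (s 0%N))%R by exact: clamp_ge0.
  have ncl : {homo (fun j => clamp i (s j)) : a b / (a <= b)%N >-> (a <= b)%R}.
    by move=> a b ab; apply: clamp_le; exact: ns.
  have [_ /(_ (fun j => A (i, j)) (fun j => mA _))] :=
    levy_family_grid levyX M.+1 cl0 ncl.
  rewrite /E valK => ->; apply: eq_bigr => j _.
  rewrite (_ : (clamp i (s j.+1) - clamp i (s j) = cc i j.+1 - cc i j)%R)//.
  by rewrite /cc; ring.
pose Phi (y : I -> R) := G (fun j => \sum_(i < n) \sum_(k < c j) y (i, inord k))%R.
have mPhi : measurable_fun setT (fun v : #|I|.-tuple R => Phi (of_tuple v)).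
  have ms j : measurable_fun setT (fun v : #|I|.-tuple R =>
      \sum_(i < n) \sum_(k < c j) of_tuple v (i, inord k))%R.
    apply: measurable_sum => i; apply: measurable_sum => k.
    exact: measurable_of_tuple.
  apply: eq_measurable_fun (measurableT_comp mG (measurable_to_tuple ms)) => v _.
  by rewrite /= to_tupleK.
have := levy_family_integral hF hX mPhi (fun y => G0 _).
have -> : (fun x => Phi (Y ^~ x)) = (fun x => G (fun j => block_path n x (tt j))).
  apply/funext => x; congr G; apply/funext => j; apply: eq_bigr => i _.
  rewrite (eq_bigr (fun k : 'I_(c j) => X (clamp i (s k.+1)) (x i).2 -
      X (clamp i (s k)) (x i).2)%R).
    by rewrite (sum_telescope _ (fun k => X (clamp i (s k)) (x i).2)) sc s0E (clamp0 (tau_ge0 i)).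
  by move=> k _; rewrite /Y /= inordK// (leq_trans (ltn_ord k)) ?(leq_trans (cM j)).
move=> ->; apply: eq_integral => w _; congr G; apply/funext => j.
rewrite -(@levy_telescope n (tt j) w (ttn j)); apply: eq_bigr => i _.
rewrite (eq_bigr (fun k : 'I_(c j) => X (cc i k.+1) w - X (cc i k) w)%R).
  rewrite (sum_telescope _ (fun k => X (cc i k) w)) /cc sc s0E (clamp0 (tau_ge0 i)).
  by rewrite addr0.
by move=> k _ /=; rewrite inordK// (leq_trans (ltn_ord k)) ?(leq_trans (cM j)).
Qed.
End block_law.

(** * Joint law of the bridge and of its end point *)
Section split_increment.
Context {R : realType} {dX : measure_display} {OmX : measurableType dX}.
Variables (PX : probability OmX R) (X : R -> OmX -> R).
Hypothesis levyX : levy_law (V := measurableTypeR R) 0 (fun x y : R => x - y) PX X.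
Local Open Scope ereal_scope.

Lemma levy_family_single a b : (0 <= a)%R -> (a <= b)%R ->
  levy_family PX X PX (fun (_ : unit) w => X b w - X a w)%R (fun=> (b - a)%R).
Proof.
move=> a0 ab; split => [_|A mA].
  exact: (levy_measurableB levyX a0 (le_trans a0 ab)).
case: levyX => _ _ /(_ a (b - a)%R (A tt) a0); rewrite subr_ge0.
move=> /(_ ab (mA tt)); rewrite subrKC => stat _.
rewrite (big_pred1 tt); last by case.
rewrite -stat; congr (PX _); apply/seteqP; split => w /= H; first exact: H.
by case.
Qed.

Definition unlift_unit n (i0 : 'I_n.+1) (k : 'I_n + unit) : 'I_n.+1 :=
  if k is inl j then lift i0 j else i0.

Lemma unlift_unit_bij n (i0 : 'I_n.+1) : bijective (unlift_unit i0).
Proof.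
exists (fun i => if unlift i0 i is Some j then inl j else inr tt).
  by case=> [j|[]] /=; rewrite ?liftK ?unlift_none.
by move=> i; case: unliftP => [j ->|->].
Qed.

(** Used to integrate one increment out while the others are kept fixed. *)
Lemma levy_grid_split (t : nat -> R) n (i0 : 'I_n.+1)
    (F : ('I_n + unit -> R) -> \bar R) :
  (0 <= t 0%N)%R -> {homo t : i j / (i <= j)%N >-> (i <= j)%R} ->
  measurable_fun setT (fun v : #|{: 'I_n + unit}|.-tuple R => F (of_tuple v)) ->
  (forall y, 0 <= F y) ->
  let Y (i : 'I_n.+1) w := (X (t i.+1) w - X (t i) w)%R in
  \int[PX]_w F (fun k => Y (unlift_unit i0 k) w) =
  \int[PX]_w \int[PX]_w'
     F (sum_fun (fun j => Y (lift i0 j) w) (fun=> Y i0 w')).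
Proof.
move=> t0 nt mF F0 Y.
have hY := levy_family_grid levyX n.+1 t0 nt.
have hs := levy_family_bij (unlift_unit_bij i0) hY.
have tge0 j : (0 <= t j)%R by rewrite (le_trans t0)//; exact: nt.
have hV := levy_family_single (tge0 i0) (nt _ _ (leqnSn i0)).
have hU : levy_family PX X PX (fun j w => Y (lift i0 j) w)
    (fun j => t (lift i0 j).+1 - t (lift i0 j))%R.
  split => [j|A mA]; first exact: hY.1.
  pose A' (k : 'I_n + unit) := if k is inl j then A j else setT.
  have mA' k : measurable (A' k) by case: k => [j|[]] /=.
  have := hs.2 A' mA'.
  rewrite [X in _ = X -> _]big_sumType/= [X in _ * X](big_pred1 tt); last by case.
  rewrite /= preimage_setT probability_setT mule1 => <-.
  congr (PX _); apply/seteqP; split => w /= H; first by case=> [j|//]; exact: H.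
  by move=> j; exact: (H (inl j)).
apply: (levy_family_split hU hV _ mF F0).
by move: hs; congr levy_family; apply/funext => -[].
Qed.

End split_increment.

Section levy_martingale.
Context {R : realType} (T : R) (T0 : 0 < T).
Context (nu : probability (measurableTypeR R) R).
Context {dX : measure_display} {OmX : measurableType dX}.
Context (PX : probability OmX R) (X : R -> OmX -> R) (f : R -> R -> \bar R).
Hypothesis hf : lrb_parameters f T nu PX X.
Local Open Scope ereal_scope.
Let levyX := lrb_levy hf.

(** The density f_(T - s)(z - X_s) of reaching z is a martingale: the increment
    of X after s is independent of the past and is integrated out by
    [density_increment]. *)
Lemma levy_martingale (J : finType) (ts : J -> R) (s s' z : R)
    (G : (J -> R) -> \bar R) :
  (forall j, 0 <= ts j <= s)%R -> (0 <= s)%R -> (s <= s')%R -> (s' < T)%R ->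
  measurable_fun setT (fun v : #|J|.-tuple R => G (of_tuple v)) ->
  (forall y, 0 <= G y) ->
  \int[PX]_w (G (fun j => X (ts j) w - X 0%R w)%R *
              f (T - s')%R (z - (X s' w - X 0%R w))%R) =
  \int[PX]_w (G (fun j => X (ts j) w - X 0%R w)%R *
              f (T - s)%R (z - (X s w - X 0%R w))%R).
Proof.
move=> tss s0 ss' s'T mG G0.
have [M [u [c [u0 nu' cM uc uM]]]] := time_grid s0 tss.
pose t i := if (i <= M.+1)%N then u i else s'.
have nt : {homo t : i j / (i <= j)%N >-> (i <= j)%R}.
  apply: homo_leq => [//||i]; first exact: le_trans.
  rewrite /t; have [iM|Mi] := ltnP i M.+1; first by rewrite (ltnW iM); exact: nu'.
  case: ifP => [iM|//]; have -> : i = M.+1 by apply/eqP; rewrite eqn_leq iM Mi.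
  by rewrite uM.
have t0 : t 0%N = 0%R by rewrite /t u0.
have T's : (0 < T - s')%R by rewrite subr_gt0.
pose Phi (y : 'I_M.+1 + unit -> R) : \bar R :=
  G (fun j => \sum_(k < c j) y (inl (inord k)))%R *
  f (T - s')%R (z - (\sum_(k < M.+1) y (inl k) + y (inr tt)))%R.
have mPhi : measurable_fun setT
    (fun v : #|{: 'I_M.+1 + unit}|.-tuple R => Phi (of_tuple v)).
  apply: emeasurable_funM.
    have ms j : measurable_fun setT (fun v : #|{: 'I_M.+1 + unit}|.-tuple R =>
        \sum_(k < c j) of_tuple v (inl (inord k)))%R.
      by apply: measurable_sum => k; exact: measurable_of_tuple.
    apply: eq_measurable_fun (measurableT_comp mG (measurable_to_tuple ms)) => v _.
    by rewrite /= to_tupleK.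
  apply: (measurableT_comp (density_measurable hf T's)).
  apply: measurable_funB => //; apply: measurable_funD.
    by apply: measurable_sum => k; exact: measurable_of_tuple.
  exact: measurable_of_tuple.
have Phi0 y : 0 <= Phi y.
  by rewrite mule_ge0// (density_nonneg hf).
have := levy_grid_split levyX (ord_max : 'I_M.+2) _ nt mPhi Phi0.
rewrite t0 => /(_ (lexx _)) /=.
have tE i : (i <= M.+1)%N -> t i = u i by rewrite /t => ->.
have tM : t M.+1 = s by rewrite tE.
have tM' : t M.+2 = s' by rewrite /t ltnn.
have bumpE (j : 'I_M.+1) : bump M.+1 j = j by rewrite /bump leqNgt ltn_ord.
have ckM j (k : 'I_(c j)) : (k < M.+1)%N.
  by rewrite (leq_trans (ltn_ord k))// (leq_trans (cM j)).
have posE w j : (\sum_(k < c j) (X (t k.+1) w - X (t k) w) = X (ts j) w - X 0 w)%R.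
  rewrite (sum_telescope _ (fun k => X (t k) w)) t0 tE ?uc//.
  by rewrite (leq_trans (cM j)).
have gE w : G (fun j => \sum_(k < c j) (X (t (inord k : 'I_M.+1).+1) w -
     X (t (inord k : 'I_M.+1)) w))%R = G (fun j => X (ts j) w - X 0%R w)%R.
  congr G; apply/funext => j; rewrite -posE; apply: eq_bigr => k _.
  by rewrite inordK.
have endE w : (\sum_(k < M.+1) (X (t k.+1) w - X (t k) w) = X s w - X 0 w)%R.
  by rewrite (sum_telescope _ (fun k => X (t k) w)) t0 tM.
have -> : (fun w => Phi (fun k => X (t (unlift_unit (ord_max : 'I_M.+2) k).+1) w -
      X (t (unlift_unit (ord_max : 'I_M.+2) k)) w)%R) =
    (fun w => G (fun j => X (ts j) w - X 0%R w)%R *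
      f (T - s')%R (z - (X s' w - X 0%R w))%R).
  apply/funext => w; rewrite /Phi /= tM tM'.
  under eq_fun do under eq_bigr do rewrite bumpE.
  under eq_bigr do rewrite bumpE.
  by rewrite gE endE; congr (_ * f _ _); ring.
move=> ->; apply: eq_integral => w _.
rewrite /Phi /= tM tM'.
under eq_integral => w' _.
  under eq_fun do under eq_bigr do rewrite bumpE.
  under eq_bigr do rewrite bumpE.
  rewrite gE endE (_ : (z - (X s w - X 0 w + (X s' w' - X s w')) =
    (z - (X s w - X 0 w)) - (X (s + (s' - s)) w' - X s w'))%R); last first.
    by rewrite subrKC; ring.
  over.
rewrite ge0_integralZl//; last 2 first.
- apply: (measurableT_comp (density_measurable hf T's)).
  apply: measurable_funB => //; apply: (levy_measurableB levyX s0).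
  by rewrite subrKC (le_trans s0).
- by move=> w' _; exact: (density_nonneg hf).
rewrite -(@density_increment _ _ _ _ _ _ _ _ hf s (s' - s)%R (T - s)%R).
- by rewrite (_ : (T - s - (s' - s) = T - s')%R)//; ring.
- exact: s0.
- by rewrite subr_ge0 ss' ltrD2r.
- by rewrite lerBlDr lerDl.
Qed.
End levy_martingale.

Section bridge_law.
Context {R : realType} (T : R) (T0 : 0 < T).
Context (nu : probability (measurableTypeR R) R).
Context {dX : measure_display} {OmX : measurableType dX}.
Context (PX : probability OmX R) (X : R -> OmX -> R) (f : R -> R -> \bar R).
Hypothesis hf : lrb_parameters f T nu PX X.
Local Open Scope ereal_scope.
Local Notation state := ((R * R) * OmX)%type.
Let levyX := lrb_levy hf.
Local Notation free_chain := (free_chain T0 hf).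
Local Notation bridge_kernel := (bridge_kernel T0 hf).
Local Notation tau := (tau T).
Local Notation remaining := (remaining T).
Local Notation block := (block T).
Local Notation increment := (increment T X).
Local Notation move_state := (move_state T X).
Local Notation clamp := (clamp T).
Local Notation block_path := (block_path T X).

Let measurable_total n k : measurable_fun setT
  (fun x : seqspace state => \sum_(j < n) increment (k + j)%N (x j).2)%R.
Proof.
apply: measurable_sum => j.
apply: (measurableT_comp (measurable_increment T0 hf (k + j))).
exact: (measurableT_comp measurable_snd (measurable_coord j)).
Qed.

(** The position stored in a state is the sum of the increments so far. *)
Lemma free_chain_end n k s F (phi : R -> \bar R) :
  measurable_fun setT F -> (forall x, 0 <= F x) ->
  measurable_fun setT phi -> (forall x, 0 <= phi x) ->
  \int[free_chain n k s]_x (F x * phi (end_gap n s x)) =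
  \int[free_chain n k s]_x
    (F x * phi (gap s - \sum_(j < n) increment (k + j)%N (x j).2)%R).
Proof.
move=> mF F0 mphi phi0; elim: n k s F mF F0 => [|n IH] k s F mF F0.
  by apply: eq_integral => x _; rewrite big_ord0 subr0.
have mFe m : measurable_fun setT
    (fun p : state * seqspace state => F (prepend p.1 p.2) * phi (end_gap m p.1 p.2)).
  apply: emeasurable_funM; first exact: (measurableT_comp mF measurable_prepend).
  exact: (measurableT_comp mphi (measurable_end_gap m)).
have mFt : measurable_fun setT (fun p : state * seqspace state =>
    F (prepend p.1 p.2) *
    phi (gap s - \sum_(j < n.+1) increment (k + j)%N (prepend p.1 p.2 j).2)%R).
  apply: emeasurable_funM; first exact: (measurableT_comp mF measurable_prepend).
  apply: (measurableT_comp mphi); apply: measurable_funB => //.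
  exact: (measurableT_comp (measurable_total n.+1 k) measurable_prepend).
rewrite !integral_chainS; last 4 first.
- by move=> x; rewrite mule_ge0.
- apply: emeasurable_funM => //; apply: (measurableT_comp mphi).
  by apply: measurable_funB => //; exact: measurable_total.
- by move=> x; rewrite mule_ge0.
- apply: emeasurable_funM => //; apply: (measurableT_comp mphi).
  exact: (measurableT_comp (measurable_end_gap n.+1) (measurable_pair1 s)).
rewrite !integral_free; last 4 first.
- apply: (@measurable_fun_integral_finite_kernel _ _ _ _ R _ (free_chain n k.+1) _ mFt).
  by move=> p; rewrite mule_ge0.
- by move=> s'; apply: integral_ge0 => x _; rewrite mule_ge0.
- under eq_fun do under eq_integral do rewrite end_gap_prepend.
  apply: (@measurable_fun_integral_finite_kernel _ _ _ _ R _ (free_chain n k.+1) _ (mFe n)).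
  by move=> p; rewrite mule_ge0.
- by move=> s'; apply: integral_ge0 => x _; rewrite mule_ge0.
apply: eq_integral => w _.
under eq_integral do rewrite end_gap_prepend.
rewrite (IH k.+1 _ (fun x => F (prepend (move_state k (s, w)) x)))//; last first.
  exact: (measurableT_comp mF (measurable_prepend1 _)).
apply: eq_integral => x _; congr (_ * phi _).
rewrite gap_move big_ord_recl/= addn0; set a := increment k w.
rewrite (opprD a) addrA; congr (_ - _)%R.
by apply: eq_bigr => j _; rewrite /bump /= addSnnS.
Qed.

Lemma block_path_tau n (x : nat -> state) :
  block_path n x (tau n) = (\sum_(j < n) increment j (x j).2)%R.
Proof.
apply: eq_bigr => j _; rewrite /increment clamp_block//.
have : (j.+1 <= n)%N by [].
apply: (@homo_leq _ tau (fun a b => (a <= b)%R)) => //; first exact: le_trans.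
exact: tauS.
Qed.

Lemma tau_homo : {homo tau : i j / (i <= j)%N >-> (i <= j)%R}.
Proof. by apply: homo_leq => [//||]; [exact: le_trans|exact: tauS]. Qed.

Lemma tau_exhausts t : (t < T)%R -> exists n, (t <= tau n)%R.
Proof.
move=> tT; have Tt : (0 < T - t)%R by rewrite subr_gt0.
exists (Num.trunc (T / (T - t))%R); rewrite tauE lerBrDr -lerBrDl.
rewrite remainingE ler_pdivrMr// mulrC -ler_pdivrMr//.
by apply/ltW; apply: truncnS_gt.
Qed.

(** The number of blocks that are used to define the path at time t; any larger
    number gives the same value, see [bridge_pathE]. *)
Definition block_index (t : R) : nat :=
  if pselect (exists n, (t <= tau n)%R) is left e then projT1 (cid e) else 0%N.

(** Drops the initial state, which holds the end point but no block. *)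
Definition tail (x : nat -> state) (k : nat) : state := x k.+1.

Definition bridge_path (x : nat -> state) (t : R) : R :=
  block_path (block_index t) (tail x) t.

Lemma block_path_stable n m x t : (t <= tau n)%R -> (n <= m)%N ->
  block_path m x t = block_path n x t.
Proof.
move=> tn; elim: m => [|m IH]; first by rewrite leqn0 => /eqP <-.
rewrite leq_eqVlt => /orP[/eqP -> //|]; rewrite ltnS => nm.
rewrite block_path_sum big_ord_recr/= clamp0; last first.
  by rewrite (le_trans tn)// tau_homo.
by rewrite subrr addr0; exact: IH.
Qed.

Lemma bridge_pathE n x t : (t <= tau n)%R ->
  bridge_path x t = block_path n (tail x) t.
Proof.
move=> tn; rewrite /bridge_path /block_index.
case: pselect => [e|[]]; last by exists n.
case: cid => /= m tm.
rewrite -(block_path_stable _ tm (leq_maxl m n)).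
by rewrite -(block_path_stable _ tn (leq_maxr m n)).
Qed.

Lemma measurable_block_path n t :
  measurable_fun setT (fun x : seqspace state => block_path n x t).
Proof.
apply: measurable_sum => k.
have m2 : measurable_fun setT (fun x : seqspace state => (x k).2).
  exact: (measurableT_comp measurable_snd (measurable_coord k)).
apply: measurable_funB.
  exact: (measurableT_comp (levy_measurable levyX (clamp_ge0 T k t)) m2).
exact: (measurableT_comp (levy_measurable levyX (lexx 0%R)) m2).
Qed.

Lemma measurable_tail :
  measurable_fun setT (fun x : seqspace state => tail x : seqspace state).
Proof. by apply: measurable_fun_seqspaceP => n; exact: measurable_coord. Qed.

Lemma measurable_bridge_path t :
  measurable_fun setT (fun x : seqspace state => bridge_path x t).
Proof. exact: (measurableT_comp (measurable_block_path _ t) measurable_tail). Qed.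

Definition end_point (x : nat -> state) : R := (x 0%N).1.1.

Lemma measurable_end_point : measurable_fun setT (end_point : seqspace state -> R).
Proof.
apply: (measurableT_comp measurable_fst).
exact: (measurableT_comp measurable_fst (measurable_coord 0)).
Qed.

Variable Q : probability (seqspace state) R.
Hypothesis QE : forall n C, cylinder n C ->
  Q C = chain bridge_kernel n 0 (point : state) C.

Let fT_ge0 z : 0 <= f T z. Proof. exact: (density_nonneg hf). Qed.

(** Given the end point z, [chain_bridge] provides the weight
    f_(T - tau n)(z - X_(tau n)) / f_T(z) for any n such that s <= tau n, and the
    martingale property replaces tau n by s. *)
Theorem bridge_law (J : finType) (ts : J -> R) (s : R)
    (A : set (#|J|.-tuple R)) (B : set R) :
  (0 <= s)%R -> (s < T)%R -> (forall j, 0 <= ts j <= s)%R ->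
  measurable A -> measurable B ->
  Q [set x | A (to_tuple (fun j => bridge_path x (ts j))) /\ B (end_point x)] =
  \int[nu]_(z in B) ((\int[PX]_w
     ((\1_A (to_tuple (fun j => X (ts j) w - X 0 w)%R))%:E *
      f (T - s)%R (z - (X s w - X 0 w))%R)) / f T z).
Proof.
move=> s0 sT tss mA mB.
have [n sn] := tau_exhausts sT.
have tsn j : (ts j <= tau n)%R by have /andP[_ h] := tss j; exact: le_trans sn.
set U := [set x | _].
pose V := [set x : seqspace state | A (to_tuple (fun j => block_path n x (ts j)))].
have UE : U = (tail @^-1` V) `&` (end_point @^-1` B).
  apply/seteqP; split => x /= -[Ax Bx]; split => //; move: Ax;
    rewrite /V /= (_ : (fun j => bridge_path x (ts j)) =
      (fun j => block_path n (tail x) (ts j)))//;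
    by apply/funext => j; exact: bridge_pathE.
have mV : measurable V.
  have mt : measurable_fun setT (fun x : seqspace state =>
      to_tuple (fun j => block_path n x (ts j))).
    by apply: measurable_to_tuple => j; exact: measurable_block_path.
  by rewrite -[X in measurable X]setTI; exact: mt.
have cU : cylinder n.+1 U.
  rewrite UE; split.
    apply: measurableI; rewrite -[X in measurable X]setTI.
      exact: measurable_tail.
    exact: measurable_end_point.
  move=> x y xy; rewrite /V /= /end_point (xy 0%N)// => -[Ax Bx]; split => //.
  rewrite (_ : (fun j => block_path n (tail y) (ts j)) =
    (fun j => block_path n (tail x) (ts j)))//; apply/funext => j.
  by apply: eq_bigr => k _; rewrite /tail xy// ltnS.
rewrite (QE cU) chainS; last by case: cU.
rewrite integral_start; last 2 first.
- by apply: measurable_prepend_chain; case: cU.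
- by [].
have mI (C : set (#|J|.-tuple R)) : measurable C -> measurable_fun setT (fun w =>
    (\1_C (to_tuple (fun j => X (ts j) w - X 0 w)%R))%:E : \bar R).
  move=> mC; apply: (measurableT_comp (measurable_indic_ereal mC)).
  apply: measurable_to_tuple => j; apply: (levy_measurableB levyX (lexx 0%R)).
  by have /andP[] := tss j.
have Ts : (0 < T - s)%R by rewrite subr_gt0.
pose W z := \int[PX]_w ((\1_A (to_tuple (fun j => X (ts j) w - X 0 w)%R))%:E *
      f (T - s)%R (z - (X s w - X 0 w))%R).
have W0 z : 0 <= W z.
  apply: integral_ge0 => w _; rewrite mule_ge0 ?lee_fin//.
  exact: (density_nonneg hf).
have mW : measurable_fun setT W.
  pose g (p : R * OmX) := (\1_A (to_tuple (fun j => X (ts j) p.2 - X 0 p.2)%R))%:E *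
      f (T - s)%R (p.1 - (X s p.2 - X 0 p.2))%R.
  have g0 p : 0 <= g p.
    rewrite mule_ge0 ?lee_fin//; exact: (density_nonneg hf).
  apply: (measurable_fun_fubini_tonelli_F (m2 := PX) g _ g0).
  apply: emeasurable_funM; first exact: (measurableT_comp (mI A mA) measurable_snd).
  apply: (measurableT_comp (density_measurable hf Ts)).
  apply: measurable_funB => //.
  exact: (measurableT_comp (levy_measurableB levyX (lexx 0%R) s0) measurable_snd).
have miT : measurable_fun setT (fun z => (f T z)^-1).
  by apply: measurable_inve => //; exact: (density_measurable hf).
rewrite [RHS]integral_mkcond.
have hnu : {ae nu, forall z, 0 < f T z < +oo} by case: hf.
apply: ge0_ae_eq_integral => //.
- have mp := @measurable_prepend_chain R dX OmX bridge_kernel n 1 U cU.1.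
  apply: (measurableT_comp mp).
  exact: (measurableT_comp (measurable_start (OmX := OmX)) (measurable_pair1 (point : state))).
- apply/(measurable_restrictT _ mB).
  by apply: measurable_funTS; exact: emeasurable_funM.
- move=> z _; apply: erestrict_ge0 => {}z _.
  by apply: mule_ge0; rewrite ?inve_ge0//; exact: W0.
apply: (@filterS _ _ (ae_filter_ringOfSetsType nu) _ _ _ hnu) => z /andP[fpos foo] _.
have fz : f T z = f (remaining 0) (gap (start z : state)).
  by rewrite remainingE divr1 /gap /= subr0.
rewrite patchE; have [zB|zB] := boolP (z \in B); last first.
  rewrite (_ : _ @^-1` U = set0) ?measure0//.
  rewrite UE; apply/seteqP; split => // x /= [_].
  by rewrite /end_point /= => Bz; rewrite mem_set in zB.
have UV : prepend (start z : state) @^-1` U = V.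
  rewrite UE; apply/seteqP; split => x; first by case.
  by move=> Vx; split => //; exact: set_mem.
rewrite UV -[RHS]/(W z / f T z).
suff -> : W z = f T z * chain bridge_kernel n 1 (start z) V.
  by rewrite muleAC mulee_inv ?mul1e.
rewrite fz (chain_bridge T0 hf n mV); last by rewrite -fz.
rewrite (free_chain_end n 0 (start z) (measurable_indic_ereal mV)); last 3 first.
- by move=> x; rewrite lee_fin.
- exact: (density_measurable hf (remaining_gt0 T0 _)).
- by move=> x; exact: (density_nonneg hf _ (remaining_gt0 T0 _)).
pose oT (o : option J) := if o is Some j then ts j else tau n.
pose G (y : option J -> R) : \bar R :=
  (\1_A (to_tuple (fun j => y (Some j))))%:E * f (remaining n) (z - y None)%R.
have mG : measurable_fun setT (fun v : #|{: option J}|.-tuple R => G (of_tuple v)).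
  apply: emeasurable_funM.
    apply: (measurableT_comp (measurable_indic_ereal mA)).
    by apply: measurable_to_tuple => j; exact: measurable_of_tuple.
  apply: (measurableT_comp (density_measurable hf (remaining_gt0 T0 _))).
  by apply: measurable_funB => //; exact: measurable_of_tuple.
have G0 y : 0 <= G y.
  by rewrite mule_ge0 ?lee_fin//; exact: (density_nonneg hf _ (remaining_gt0 T0 _)).
have oTn o : (0 <= oT o <= tau n)%R.
  case: o => [j|] /=; last by rewrite tau_ge0// lexx.
  by have /andP[-> _] := tss j; rewrite tsn.
transitivity (\int[PX]_w G (fun o => X (oT o) w - X 0 w)%R); last first.
  rewrite -(block_path_law T0 hf (start z) oTn mG G0).
  apply: eq_integral => x _; rewrite /G /= block_path_tau add0n.
  by rewrite /gap /= subr0.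
have remE : (T - tau n = remaining n)%R by rewrite tauE; ring.
have mGA : measurable_fun setT (fun v : #|J|.-tuple R =>
    (\1_A (to_tuple (of_tuple v)))%:E : \bar R).
  apply: (measurableT_comp (measurable_indic_ereal mA)).
  by apply: measurable_to_tuple => j; exact: measurable_of_tuple.
have := @levy_martingale _ T nu _ _ PX X f hf J ts s (tau n) z
  (fun y => (\1_A (to_tuple y))%:E) tss s0 sn (tau_ltT T0 n) mGA (fun=> _).
by rewrite remE => ->.
Qed.

End bridge_law.

(** * Cadlag functions *)
Section cadlag_functions.
Context {R : realType}.
Implicit Types (D : set R) (x y phi : R -> R).

Lemma cvg_comp_at_right x phi t (F : set_system R) : {for t, continuous phi} ->
  (forall u, t < u -> phi t < phi u) ->
  x v @[v --> (phi t)^'+] --> F -> x (phi u) @[u --> t^'+] --> F.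
Proof.
move=> cphi inc; apply: cvg_comp => A PA.
have {}PA : \forall u \near t, phi t < phi u -> A (phi u) := cphi _ PA.
by apply: filterS PA => u Au tu; apply: Au; exact: inc.
Qed.

Lemma cvg_comp_at_left x phi t (F : set_system R) : {for t, continuous phi} ->
  (forall u, u < t -> phi u < phi t) ->
  x v @[v --> (phi t)^'-] --> F -> x (phi u) @[u --> t^'-] --> F.
Proof.
move=> cphi inc; apply: cvg_comp => A PA.
have {}PA : \forall u \near t, phi u < phi t -> A (phi u) := cphi _ PA.
by apply: filterS PA => u Au tu; apply: Au; exact: inc.
Qed.

(** A nondecreasing function is, on each side of t, either strictly away from
    its value at t or constant near t. *)
Lemma cadlag_comp D D' x phi : cadlag D x -> {homo phi : s t / s <= t} ->
  continuous phi -> (forall t, D' t -> D (phi t)) ->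
  cadlag D' (fun t => x (phi t)).
Proof.
move=> xD nphi cphi phiD t D't.
have [xr xl] := xD _ (phiD _ D't).
split => -[s D's st].
- have [[u tu phiu]|inc] := pselect (exists2 u, t < u & phi u = phi t).
    apply: cvg_near_cst; near=> v.
    have -> // : phi v = phi t.
    apply/eqP; rewrite eq_le -{1}phiu; apply/andP; split; apply: nphi.
      by near: v; exact: nbhs_right_le.
    by near: v; exact: nbhs_right_ge.
  have {}inc u : t < u -> phi t < phi u.
    move=> tu; rewrite lt_neqAle nphi ?ltW// andbT.
    by apply/eqP => e; apply: inc; exists u.
  apply: cvg_comp_at_right => //; first exact: cphi.
  by apply: xr; exists (phi s); [exact: phiD|exact: inc].
- have [[u tu phiu]|inc] := pselect (exists2 u, u < t & phi u = phi t).
    apply/cvg_ex; exists (x (phi t)); apply: cvg_near_cst; near=> v.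
    have -> // : phi v = phi t.
    apply/eqP; rewrite eq_le -{2}phiu; apply/andP; split; apply: nphi.
      by near: v; exact: nbhs_left_le.
    by near: v; exact: nbhs_left_ge.
  have {}inc u : u < t -> phi u < phi t.
    move=> tu; rewrite lt_neqAle nphi ?ltW// andbT.
    by apply/eqP => e; apply: inc; exists u.
  have /cvg_ex[l xl'] := xl (ex_intro2 _ _ (phi s) (phiD _ D's) (inc _ st)).
  apply/cvg_ex; exists l.
  by apply: cvg_comp_at_left => //; exact: cphi.
Unshelve. all: by end_near. Qed.

Lemma cadlag_cst D (c : R) : cadlag D (fun=> c).
Proof. by move=> t _; split => _; [exact: cvg_cst|exact: is_cvg_cst]. Qed.

Lemma cadlagD D x y : cadlag D x -> cadlag D y -> cadlag D (fun t => x t + y t).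
Proof.
move=> xD yD t Dt; have [xr xl] := xD t Dt; have [yr yl] := yD t Dt.
split => h; first by apply: cvgD; [exact: xr|exact: yr].
by apply: is_cvgD; [exact: xl|exact: yl].
Qed.

Lemma cadlag_sum D n (x : nat -> R -> R) : (forall k, cadlag D (x k)) ->
  cadlag D (fun t => \sum_(k < n) x k t).
Proof.
move=> xD; elim: n => [|n IH].
  by under eq_fun do rewrite big_ord0; exact: cadlag_cst.
by under eq_fun do rewrite big_ord_recr; exact: cadlagD.
Qed.

Lemma cadlag_near D x :
  (forall t, D t -> exists2 y, cadlag setT y & x t = y t /\ \forall u \near t, x u = y u) ->
  cadlag D x.
Proof.
move=> xD t Dt; have [y yT [xyt xy]] := xD t Dt; have [yr yl] := yT t Logic.I.
have t1 : exists2 s, setT s & t < s by exists (t + 1) => //; rewrite ltrDl.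
have t2 : exists2 s, setT s & s < t by exists (t - 1) => //; rewrite ltrBlDr ltrDl.
split => _.
  rewrite xyt; apply: cvg_trans (yr t1); apply: near_eq_cvg.
  by apply: cvg_within; apply: filterS xy => u ->.
have /cvg_ex[l yl'] := yl t2; apply/cvg_ex; exists l.
apply: cvg_trans yl'; apply: near_eq_cvg.
by apply: cvg_within; apply: filterS xy => u ->.
Qed.

End cadlag_functions.

(** * The left limit of the bridge at the final time *)
Section bridge_regularity.
Context {R : realType} (T : R) (T0 : 0 < T).
Context (nu : probability (measurableTypeR R) R).
Context {dX : measure_display} {OmX : measurableType dX}.
Context (PX : probability OmX R) (X : R -> OmX -> R) (f : R -> R -> \bar R).
Hypothesis hf : lrb_parameters f T nu PX X.
Local Open Scope ereal_scope.
Local Notation state := ((R * R) * OmX)%type.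
Let levyX := lrb_levy hf.
Local Notation bridge_kernel := (bridge_kernel T0 hf).
Local Notation tau := (tau T).
Local Notation clamp := (clamp T).
Local Notation block_path := (block_path T X).
Local Notation bridge_path := (bridge_path T X).

Lemma cadlag_block_path n (x : nat -> state) : cadlag setT (block_path n x).
Proof.
apply: (@cadlag_sum _ _ n (fun k t => X (clamp k t) (x k).2 - X 0 (x k).2)%R) => k.
apply: cadlagD; last exact: cadlag_cst.
apply: (@cadlag_comp _ `[0%R, +oo[ _ (X ^~ (x k).2)).
- by case: hf => -[_ cX] _ _ _ _; exact: cX.
- by move=> s t; exact: clamp_le.
- move=> t.
  have c1 : {for t, continuous (fun u : R => u - tau k : R^o)%R}.
    by apply: cvgB; [exact: cvg_id|exact: cvg_cst].
  have c2 (c : R) : {for t, continuous (cst c : R -> R^o)} by exact: cvg_cst.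
  exact: (continuous_max (c2 0%R) (continuous_min c1 (c2 _))).
- by move=> t _; rewrite /= in_itv/= andbT clamp_ge0.
Qed.

Lemma cadlag_bridge_path D (x : nat -> state) : (forall t, D t -> (t < T)%R) ->
  cadlag D (bridge_path x).
Proof.
move=> DT; apply: cadlag_near => t /DT tT.
have [n] := tau_exhausts (midf_lt tT).2.
move=> hn; exists (block_path n (tail x)); first exact: cadlag_block_path.
have tn : (t < tau n)%R by apply: lt_le_trans hn; exact: (midf_lt tT).1.
split; first exact: (bridge_pathE T0 X x (ltW tn)).
near=> u; apply: (bridge_pathE T0 X x).
by apply/ltW; near: u; exact: lt_nbhsl.
Unshelve. all: by end_near. Qed.

Lemma bridge_path0 (x : nat -> state) : bridge_path x 0 = 0%R.
Proof.
have t0 : (0 <= tau 0)%R by rewrite tau0.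
by rewrite (bridge_pathE T0 X x t0) block_path_sum big_ord0.
Qed.

(** The increments of X over [0, a] and over [a, a + l] may be swapped, by
    independence and stationarity; the position at time a + l is unchanged. *)
Lemma levy_shift (J : finType) (q : J -> R) (a l z : R) (G : (J -> R) -> \bar R) :
  (0 <= a)%R -> (0 <= l)%R -> (a + l < T)%R -> (forall j, 0 <= q j <= l)%R ->
  measurable_fun setT (fun v : #|J|.-tuple R => G (of_tuple v)) ->
  (forall y, 0 <= G y) ->
  \int[PX]_w (G (fun j => X (a + q j) w - X a w)%R *
    f (T - (a + l))%R (z - (X (a + l) w - X 0 w))%R) =
  \int[PX]_w (G (fun j => X (q j) w - X 0 w)%R *
    f (T - (a + l))%R (z - (X (a + l) w - X 0 w))%R).
Proof.
move=> a0 l0 alT ql mG G0.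
have [M [r [c [r0 nr cM rc rM]]]] := time_grid l0 ql.
have rge0 i : (0 <= r i)%R by rewrite -r0; exact: nr.
have Tal : (0 < T - (a + l))%R by rewrite subr_gt0.
pose t1 i := if i is j.+1 then (a + r j)%R else 0%R.
pose t2 i := if (i <= M.+1)%N then r i else (a + l)%R.
have nt1 : {homo t1 : i j / (i <= j)%N >-> (i <= j)%R}.
  apply: homo_leq => [//||[|i]]; first exact: le_trans.
    by rewrite /t1 addr_ge0.
  by rewrite /t1 lerD2l; exact: nr.
have nt2 : {homo t2 : i j / (i <= j)%N >-> (i <= j)%R}.
  apply: homo_leq => [//||i]; first exact: le_trans.
  rewrite /t2; have [iM|Mi] := ltnP i M.+1; first by rewrite (ltnW iM); exact: nr.
  case: ifP => [iM|//]; have -> : i = M.+1 by apply/eqP; rewrite eqn_leq iM Mi.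
  by rewrite rM lerDr.
have t2E i : (i <= M.+1)%N -> t2 i = r i by rewrite /t2 => ->.
have t20 : (0 <= t2 0%N)%R by rewrite t2E.
have h1 := levy_family_bij (unlift_unit_bij (ord0 : 'I_M.+2))
  (levy_family_grid levyX M.+2 (lexx 0%R : (0 <= t1 0%N)%R) nt1).
have h2 := levy_family_bij (unlift_unit_bij (ord_max : 'I_M.+2))
  (levy_family_grid levyX M.+2 t20 nt2).
pose I : finType := ('I_M.+1 + unit)%type.
pose Phi (y : I -> R) : \bar R :=
  G (fun j => \sum_(k < c j) y (inl (inord k)))%R *
  f (T - (a + l))%R (z - (\sum_(k < M.+1) y (inl k) + y (inr tt)))%R.
have mPhi : measurable_fun setT (fun v : #|I|.-tuple R => Phi (of_tuple v)).
  apply: emeasurable_funM.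
    have ms j : measurable_fun setT (fun v : #|I|.-tuple R =>
        \sum_(k < c j) of_tuple v (inl (inord k)))%R.
      by apply: measurable_sum => k; exact: measurable_of_tuple.
    apply: eq_measurable_fun (measurableT_comp mG (measurable_to_tuple ms)) => v _.
    by rewrite /= to_tupleK.
  apply: (measurableT_comp (density_measurable hf Tal)).
  apply: measurable_funB => //; apply: measurable_funD.
    by apply: measurable_sum => k; exact: measurable_of_tuple.
  exact: measurable_of_tuple.
have Phi0 y : 0 <= Phi y by rewrite mule_ge0// (density_nonneg hf).
have bumpE (j : 'I_M.+1) : bump M.+1 j = j by rewrite /bump leqNgt ltn_ord.
have lenE : (fun j : 'I_M.+2 => t2 j.+1 - t2 j)%R \o unlift_unit ord_max =
  (fun j : 'I_M.+2 => t1 j.+1 - t1 j)%R \o unlift_unit (ord0 : 'I_M.+2) :> (I -> R).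
  apply/funext => -[j|[]] /=.
    rewrite bumpE (t2E _ (ltn_ord j)) (t2E _ (ltnW (ltn_ord j))).
    by rewrite /bump leq0n add1n /t1; ring.
  by rewrite r0 (t2E _ (leqnn _)) rM /t2 ltnn; ring.
rewrite -lenE in h1.
have inordE j (k : 'I_(c j)) : (inord k : 'I_M.+1) = k :> nat.
  by rewrite inordK// (leq_trans (ltn_ord k))// (leq_trans (cM j)).
have := levy_family_integral h1 h2 mPhi Phi0.
congr (_ = _); apply: eq_integral => w _; rewrite /Phi /=.
- congr (G _ * f _ _).
    apply/funext => j.
    rewrite (eq_bigr (fun k : 'I_(c j) => X (a + r k.+1) w - X (a + r k) w)%R).
      by rewrite (sum_telescope _ (fun k => X (a + r k)%R w)) rc r0 addr0.
    by move=> k _; rewrite /bump leq0n add1n inordE.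
  rewrite (eq_bigr (fun k : 'I_M.+1 => X (a + r k.+1) w - X (a + r k) w)%R).
    by rewrite (sum_telescope _ (fun k => X (a + r k)%R w)) rM r0 addr0; ring.
  by move=> k _; rewrite /bump leq0n add1n.
- congr (G _ * f _ _).
    apply/funext => j.
    rewrite (eq_bigr (fun k : 'I_(c j) => X (r k.+1) w - X (r k) w)%R).
      by rewrite (sum_telescope _ (fun k => X (r k) w)) rc r0.
    move=> k _; have kM := leq_trans (ltn_ord k) (cM j).
    have kM1 : (k < M.+1)%N by exact: leqW.
    by rewrite bumpE inordE (t2E _ kM1) (t2E _ (ltnW kM1)).
  rewrite (eq_bigr (fun k : 'I_M.+1 => X (r k.+1) w - X (r k) w)%R).
    rewrite (sum_telescope _ (fun k => X (r k) w)) rM r0 (t2E _ (leqnn _)) rM /t2 ltnn.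
    by ring.
  by move=> k _; rewrite bumpE (t2E _ (ltn_ord k)) (t2E _ (ltnW (ltn_ord k))).
Qed.

Variable Q : probability (seqspace state) R.
Hypothesis QE : forall n C, cylinder n C ->
  Q C = chain bridge_kernel n 0 (point : state) C.

(** By [bridge_law], expectations for the bridge are expectations for X under a
    weight to which [levy_shift] applies. *)
Lemma bridge_exchange (J : finType) (q : J -> R) (a l : R) (C : set (#|J|.-tuple R)) :
  (0 <= a)%R -> (0 <= l)%R -> (a + l < T)%R -> (forall j, 0 <= q j <= l)%R ->
  measurable C ->
  Q [set x | C (to_tuple (fun j => bridge_path x (a + q j) - bridge_path x a)%R)] =
  Q [set x | C (to_tuple (fun j => bridge_path x (q j)))].
Proof.
move=> a0 l0 alT ql mC.
pose A := [set v : #|{: option J}|.-tuple R |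
  C (to_tuple (fun j => of_tuple v (Some j) - of_tuple v None)%R)].
have mA : measurable A.
  have mt : measurable_fun setT (fun v : #|{: option J}|.-tuple R =>
      to_tuple (fun j => of_tuple v (Some j) - of_tuple v None)%R).
    by apply: measurable_to_tuple => j; apply: measurable_funB; exact: measurable_of_tuple.
  by rewrite -[X in measurable X]setTI; exact: mt.
have AE (y : option J -> R) :
    A (to_tuple y) = C (to_tuple (fun j => y (Some j) - y None)%R).
  by rewrite /A /=; under eq_fun do rewrite !to_tupleK.
have al0 : (0 <= a + l)%R by exact: addr_ge0.
pose t1 (o : option J) := if o is Some j then (a + q j)%R else a.
pose t2 (o : option J) := if o is Some j then q j else 0%R.
have t1s o : (0 <= t1 o <= a + l)%R.
  case: o => [j|] /=; last by rewrite a0 lerDl.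
  by have /andP[q0 q1] := ql j; rewrite addr_ge0//= lerD2l.
have t2s o : (0 <= t2 o <= a + l)%R.
  case: o => [j|] /=; last by rewrite lexx.
  by have /andP[-> q1] := ql j; rewrite (le_trans q1)// lerDr.
have := bridge_law QE al0 alT t1s mA measurableT.
have := bridge_law QE al0 alT t2s mA measurableT.
have -> : [set x | A (to_tuple (fun o => bridge_path x (t2 o))) /\ [set: R] (end_point x)]
    = [set x | C (to_tuple (fun j => bridge_path x (q j)))].
  have sub0 x : (fun j => bridge_path x (q j) - bridge_path x 0)%R =
      (fun j => bridge_path x (q j)).
    by apply/funext => j; rewrite bridge_path0 subr0.
  by apply/seteqP; split => x /=; rewrite AE /= sub0 //; case.
have -> : [set x | A (to_tuple (fun o => bridge_path x (t1 o))) /\ [set: R] (end_point x)]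
    = [set x | C (to_tuple (fun j => bridge_path x (a + q j) - bridge_path x a)%R)].
  by apply/seteqP; split => x /=; rewrite AE //; case.
move=> -> ->; apply: eq_integral => z _; congr (_ / _).
have mG : measurable_fun setT (fun v : #|J|.-tuple R =>
    (\1_C (to_tuple (of_tuple v)))%:E : \bar R).
  apply: (measurableT_comp (measurable_indic_ereal mC)).
  by apply: measurable_to_tuple => j; exact: measurable_of_tuple.
have G0 (y : J -> R) : 0 <= (\1_C (to_tuple y))%:E :> \bar R by rewrite lee_fin.
have indicAE (y : option J -> R) : \1_A (to_tuple y) =
    \1_C (to_tuple (fun j => y (Some j) - y None)%R) :> R.
  rewrite !indicE; congr (_ %:R); congr (nat_of_bool _); apply/idP/idP => /set_mem;
    by [rewrite AE => ?; exact: mem_set | rewrite -AE => ?; exact: mem_set].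
have := @levy_shift J q a l z (fun y => (\1_C (to_tuple y))%:E) a0 l0 alT ql mG G0.
congr (_ = _); apply: eq_integral => w _; rewrite indicAE /=; congr (_%:E * _);
  congr (\1_C (to_tuple _)); apply/funext => j; ring.
Qed.

Definition rat_enum (i : nat) : R := ratr (odflt 0%R (unpickle i : option rat)).

Lemma rat_enumP (q : rat) : exists i, rat_enum i = ratr q.
Proof. by exists (pickle q); rewrite /rat_enum pickleK. Qed.

Definition oscillates a (d e : R) (x : nat -> state) (i : nat) : Prop :=
  (0 <= rat_enum i < d)%R /\
  (e < `|bridge_path x (a + rat_enum i) - bridge_path x a|)%R.

Let measurable_oscillates a d e i :
  measurable [set x : seqspace state | oscillates a d e x i].
Proof.
have [id|nid] := pselect (0 <= rat_enum i < d)%R; last first.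
  by rewrite (_ : [set x | _] = set0)//; apply/seteqP; split => // x [].
rewrite (_ : [set x | _] = (fun x : seqspace state =>
    `|bridge_path x (a + rat_enum i) - bridge_path x a|)%R @^-1` `]e, +oo[).
  have mB : measurable_fun setT (fun x : seqspace state =>
      `|bridge_path x (a + rat_enum i) - bridge_path x a|%R).
    apply: measurableT_comp => //; apply: measurable_funB;
      exact: (measurable_bridge_path hf).
  by rewrite -[X in measurable X]setTI; exact: mB.
apply/seteqP; split => x /=; rewrite in_itv/= andbT; first by case.
by move=> ex; split.
Qed.

Lemma oscillates_exchange a d e n : (0 <= a)%R -> (0 < d)%R -> (a + d <= T)%R ->
  Q [set x | exists2 i, (i < n)%N & oscillates a d e x i] =
  Q [set x | exists2 i, (i < n)%N & oscillates 0 d e x i].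
Proof.
move=> a0 d0 adT.
(* The indices of rationals out of range are sent to time 0, where the path
   does not move. *)
pose q (i : 'I_n) : R := if (0 <= rat_enum i < d)%R then rat_enum i else 0%R.
have qd i : (0 <= q i < d)%R by rewrite /q; case: ifP => // _; rewrite lexx.
pose l : R := \big[Num.max/0%R]_(i < n) q i.
have l0 : (0 <= l)%R by rewrite /l; exact: bigmax_ge_id.
have ld : (l < d)%R by apply: bigmax_lt => // i _; have /andP[] := qd i.
have ql i : (0 <= q i <= l)%R.
  by have /andP[-> _] := qd i; exact: le_bigmax.
have alT : (a + l < T)%R by rewrite (lt_le_trans _ adT)// ltrD2l.
pose C := [set v : #|'I_n|.-tuple R | exists2 i : 'I_n,
  (0 <= rat_enum i < d)%R & (e < `|of_tuple v i|)%R].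
have mC : measurable C.
  pose A (i : 'I_n) := [set y : R | ~ ((0 <= rat_enum i < d)%R /\ (e < `|y|)%R)].
  have mA i : measurable (A i).
    have [id|nid] := pselect (0 <= rat_enum i < d)%R; last first.
      by rewrite (_ : A i = setT)//; apply/seteqP; split => // y _ [].
    have mn : measurable_fun setT (fun y : R => `|y|%R) by [].
    rewrite (_ : A i = ~` ((fun y : R => `|y|%R) @^-1` `]e, +oo[)).
      by apply: measurableC; rewrite -[X in measurable X]setTI; exact: mn.
    by apply/seteqP; split => y /= h; rewrite ?in_itv/= ?andbT => h';
      apply: h; rewrite ?in_itv/= ?andbT; case: h'.
  rewrite (_ : C = ~` [set v : #|'I_n|.-tuple R | forall i, A i (of_tuple v i)]).
    by apply: measurableC; apply: (measurable_family_box (measurable_of_tuple (I := 'I_n))).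
  apply/seteqP; split => v /=; first by move=> [i id ei] /(_ i); apply.
  by move=> /existsNP[i /contrapT[id ei]]; exists i.
have := bridge_exchange a0 l0 alT ql mC.
have oscE b : [set x | exists2 i, (i < n)%N & oscillates b d e x i] =
    [set x | C (to_tuple (fun j => bridge_path x (b + q j) - bridge_path x b)%R)].
  apply/seteqP; split => x /=.
    move=> [i ilt [id ei]]; exists (Ordinal ilt) => //.
    by rewrite to_tupleK /q /= id.
  move=> [i id]; rewrite to_tupleK /q id => ei; exists i => //.
rewrite !oscE => ->; congr (Q _); apply/seteqP; split => x /=;
  rewrite (_ : (fun j => bridge_path x (0 + q j) - bridge_path x 0)%R =
    (fun j => bridge_path x (q j)))//;
  by apply/funext => j; rewrite bridge_path0 subr0 add0r.
Qed.

Local Notation remaining := (remaining T).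

Definition oscillating a d e := [set x : seqspace state | exists i, oscillates a d e x i].
Local Notation osc := oscillating.

Lemma measurable_osc a d e : measurable (osc a d e).
Proof.
rewrite (_ : osc a d e = \bigcup_i [set x | oscillates a d e x i]).
  by apply: bigcupT_measurable => i; exact: measurable_oscillates.
by apply/seteqP; split => x /= [i]; [exists i|move=> _; exists i].
Qed.

Let osc_exchange a d e : (0 <= a)%R -> (0 < d)%R -> (a + d <= T)%R ->
  Q (osc a d e) = Q (osc 0 d e).
Proof.
move=> a0 d0 adT.
pose E b n := [set x : seqspace state | exists2 i, (i < n)%N & oscillates b d e x i].
have mE b n : measurable (E b n).
  rewrite (_ : E b n = \bigcup_(i in [set i | (i < n)%N]) [set x | oscillates b d e x i]).
    by apply: bigcup_measurable => i _; exact: measurable_oscillates.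
  by apply/seteqP; split => x /= [i]; exists i.
have oscE b : osc b d e = \bigcup_n E b n.
  apply/seteqP; split => x /=; first by move=> [i xi]; exists i.+1 => //; exists i.
  by move=> [n _ [i _ xi]]; exists i.
have cvE b : Q (E b n) @[n --> \oo] --> Q (osc b d e).
  rewrite oscE; apply: nondecreasing_cvg_mu => //.
    by rewrite -oscE; exact: measurable_osc.
  move=> n m nm; apply/subsetPset => x [i ilt xi]; exists i => //.
  exact: leq_trans nm.
have := cvE a; rewrite (_ : (fun n => Q (E a n)) = (fun n => Q (E 0%R n))).
  by move=> /(cvg_unique _ (cvE 0%R)) <-.
by apply/funext => n; exact: oscillates_exchange.
Qed.

Let osc0_cvg e : (0 < e)%R -> Q (osc 0 (remaining m) e) @[m --> \oo] --> 0.
Proof.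
move=> e0.
(* A path that oscillates by e over every [0, d[ is not right-continuous at 0. *)
have cap0 : \bigcap_m osc 0 (remaining m) e = set0.
  apply/seteqP; split => // x xosc.
  have cx : cadlag `[0%R, T[ (bridge_path x).
    by apply: cadlag_bridge_path => t; rewrite /= in_itv/= => /andP[].
  have [|cx0 _] := cx 0%R; first by rewrite /= in_itv/= lexx T0.
  have /cx0 : exists2 s, `[0%R, T[%classic s & (0 < s)%R.
    exists (T / 2)%R; last by rewrite divr_gt0.
    by rewrite /= in_itv/= ltW ?divr_gt0//= ltr_pdivrMr// ltr_pMr// ltr1n.
  rewrite bridge_path0 => /cvgr0Pnorm_le /(_ e e0) [h /= h0 hle].
  have [m mh] : exists m, (remaining m < h)%R.
    exists (Num.trunc (T / h)); rewrite remainingE ltr_pdivrMr// mulrC -ltr_pdivrMr//.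
    exact: truncnS_gt.
  have [i [/andP[r0 rm]]] := xosc m Logic.I.
  rewrite add0r bridge_path0 subr0 ltNge; apply/negP; rewrite negbK.
  have [r00|rn0] := eqVneq (rat_enum i) 0%R.
    by rewrite r00 bridge_path0 normr0 ltW.
  apply: hle; last by rewrite lt_neqAle eq_sym rn0.
  by rewrite /= sub0r normrN ger0_norm// (lt_trans rm).
have := @nonincreasing_cvg_mu _ _ _ Q (fun m => osc 0 (remaining m) e).
rewrite cap0 measure0; apply.
- by rewrite (le_lt_trans (probability_le1 Q (measurable_osc _ _ _)))// ltry.
- by move=> m; exact: measurable_osc.
- by [].
- move=> n m nm; apply/subsetPset => x [i [/andP[r0 rm] xi]]; exists i; split => //.
  rewrite r0 (lt_le_trans rm)//.
  rewrite remainingE ler_pM2l// lef_pV2 ?posrE// ler_nat ltnS//.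
Qed.

(** By exchangeability, the path oscillates by e over [tau m, T[ as often as over
    [0, T - tau m[, hence with a probability that tends to 0. *)
Lemma oscillates_null e : (0 < e)%R ->
  Q (\bigcap_m osc (tau m) (remaining m) e) = 0.
Proof.
move=> e0; apply/eqP; rewrite eq_le measure_ge0 andbT.
rewrite -(cvg_lim _ (osc0_cvg e0))//; apply: lime_ge.
  by apply/cvg_ex; exists 0; exact: osc0_cvg.
apply: nearW => m; rewrite -(@osc_exchange (tau m))//.
- apply: le_measure; rewrite ?inE//.
  - by apply: bigcapT_measurable => k; exact: measurable_osc.
  - exact: measurable_osc.
  - by move=> x; apply.
- exact: tau_ge0.
- exact: remaining_gt0.
- by rewrite subrK.
Qed.

End bridge_regularity.

Lemma measure_setD_null {R : realType} {d} {T : measurableType d}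
    (mu : {measure set T -> \bar R}) (A N : set T) :
  measurable A -> measurable N -> mu N = 0%E -> mu A = mu (A `\` N).
Proof.
move=> mA mN N0; rewrite (measureDI mu mA mN) -[RHS]adde0; congr (_ + _)%E.
apply/eqP; rewrite eq_le measure_ge0 andbT -N0.
by apply: le_measure; rewrite ?inE//; exact: measurableI.
Qed.

Lemma rational_between {R : realType} (a b : R) : a < b ->
  exists i, a < rat_enum i < b.
Proof.
move=> ab; have [q] := rat_in_itvoo ab; rewrite in_itv/= => hq.
by have [i iq] := rat_enumP (R := R) q; exists i; rewrite iq.
Qed.

(** Right-continuity extends a bound on the oscillation from rational to real
    times. *)
Lemma cvg_at_left_rational {R : realType} (T : R) (x : R -> R) :
  cadlag `[0, T[ x ->
  (forall e, 0 < e -> exists a l, [/\ 0 <= a, 0 < l, a + l = T &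
     forall i, 0 <= (rat_enum i : R) < l -> `|x (a + rat_enum i) - x a| <= e]) ->
  cvg (x u @[u --> T^'-]).
Proof.
move=> cx osc; apply: cauchy_cvg; apply: cauchy_exP => e e0.
have e20 : 0 < e / 2 by rewrite divr_gt0.
have [a [l [a0 l0 alT osce]]] := osc _ e20; exists (x a).
have bound u : a <= u -> u < T -> `|x u - x a| <= e / 2.
  move=> au uT; rewrite leNgt; apply/negP => eu.
  have u0T : `[0, T[%classic u by rewrite /= in_itv/= (le_trans a0 au).
  have [+ _] := cx _ u0T.
  have hex : exists2 s, `[0, T[%classic s & u < s.
    exists ((u + T) / 2); last by rewrite (midf_lt uT).1.
    rewrite /= in_itv/= (midf_lt uT).2 andbT.
    by rewrite (le_trans (le_trans a0 au))// ltW// (midf_lt uT).1.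
  move=> /(_ hex) rc.
  have : \forall v \near u^'+, e / 2 < `|x v - x a|.
    have : (fun v => `|x v - x a|) v @[v --> u^'+] --> `|x u - x a|.
      by apply: cvg_norm; apply: cvgB => //; exact: cvg_cst.
    by move=> /cvgr_gt; exact.
  move=> [h /= h0 hle].
  have lt1 : u - a < Num.min (u - a + h) l.
    rewrite lt_min ltrDl h0/= ltrBlDl -ltrBlDl.
    by rewrite ltrBlDl alT.
  have [i] := rational_between lt1; rewrite lt_min => /andP[ri /andP[rh rl]].
  have := osce i; rewrite rl andbT => /(_ _)/wrap[].
    by rewrite (le_trans _ (ltW ri))// subr_ge0.
  rewrite leNgt => /negP; apply; apply: hle.
    rewrite /= distrC ger0_norm; first by rewrite ltrBlDl; lra.
    by lra.
  lra.
exists l => //= v /= vl vT.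
rewrite -ball_normE/= distrC (le_lt_trans (bound _ _ vT))//; last by lra.
by move: vl; rewrite ger0_norm; [lra|rewrite subr_ge0 ltW].
Qed.

Section bridge_process.
Context {R : realType} (T : R) (T0 : 0 < T).
Context (nu : probability (measurableTypeR R) R).
Context {dX : measure_display} {OmX : measurableType dX}.
Context (PX : probability OmX R) (X : R -> OmX -> R) (f : R -> R -> \bar R).
Hypothesis hf : lrb_parameters f T nu PX X.
Local Open Scope ereal_scope.
Local Notation state := ((R * R) * OmX)%type.
Let levyX := lrb_levy hf.
Local Notation bridge_kernel := (bridge_kernel T0 hf).
Local Notation tau := (tau T).
Local Notation bridge_path := (bridge_path T X).
Local Notation remaining := (remaining T).

(** The trajectories whose oscillation over [tau m, T[ does not tend to 0. Only
    rational times enter, which makes this set measurable. *)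
Definition irregular : set (seqspace state) :=
  \bigcup_k \bigcap_m oscillating T X (tau m) (remaining m) k.+1%:R^-1.

Lemma measurable_irregular : measurable irregular.
Proof.
apply: bigcupT_measurable => k; apply: bigcapT_measurable => m.
exact: (measurable_osc hf).
Qed.

Lemma regular_cvg (x : seqspace state) : ~ irregular x ->
  cvg (bridge_path x u @[u --> T^'-]).
Proof.
move=> nx; apply: cvg_at_left_rational.
  by apply: (cadlag_bridge_path T0 hf) => t; rewrite /= in_itv/= => /andP[].
move=> e e0.
have [k ke] : exists k : nat, (k.+1%:R^-1 < e)%R.
  exists (Num.trunc e^-1); rewrite invf_plt ?posrE//.
  exact: truncnS_gt.
have [m nm] : exists m, ~ oscillating T X (tau m) (remaining m) k.+1%:R^-1 x.
  apply: contrapT => /forallNP h; apply: nx; exists k => // m _.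
  exact: (contrapT (h m)).
exists (tau m), (remaining m); split.
- by have := tau_ge0 T0 m.
- by have := remaining_gt0 T0 m.
- by rewrite subrK.
move=> i ri; rewrite (le_trans _ (ltW ke))// leNgt; apply/negP => hi.
by apply: nm; exists i; split.
Qed.

(** Modified on a null set, so that every trajectory is cadlag. *)
Definition bridge (t : R) (x : seqspace state) : R :=
  if (t < T)%R then (if pselect (irregular x) then 0%R else bridge_path x t)
  else end_point x.

Lemma bridge_end x : bridge T x = end_point x.
Proof. by rewrite /bridge ltxx. Qed.

Lemma measurable_bridge t : measurable_fun setT (bridge t).
Proof.
have [tT|tT] := ltP t T; last first.
  rewrite (_ : bridge t = end_point); first exact: measurable_end_point.
  by apply/funext => x; rewrite /bridge ltNge tT.
rewrite (_ : bridge t = (fun x =>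
    (\1_(~` irregular) x * bridge_path x t)%R)); last first.
  apply/funext => x; rewrite indicE /bridge tT; case: pselect => /= xi.
    by rewrite memNset ?mul0r.
  by rewrite mem_set ?mul1r.
apply: measurable_funM; last exact: (measurable_bridge_path hf).
by apply: measurable_indic; apply: measurableC; exact: measurable_irregular.
Qed.

Lemma cadlag_bridge x : cadlag `[0%R, T] (bridge^~ x).
Proof.
move=> t; rewrite /= in_itv/= => /andP[t0]; rewrite le_eqVlt => /orP[/eqP ->|tT].
  split => [[s]|_]; first by rewrite /= in_itv/= => /andP[_ sT] /lt_geF; rewrite sT.
  have e : \forall u \near T^'-, (if pselect (irregular x) then 0%R else bridge_path x u)
      = bridge u x.
    by exists 1%R => //= u _ /= uT; rewrite /bridge uT.
  have c : cvg ((fun u => if pselect (irregular x) then 0%R else bridge_path x u) u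
       @[u --> T^'-]).
    case: pselect => xi; first exact: is_cvg_cst.
    exact: regular_cvg.
  apply/cvg_ex; exists (lim ((fun u => if pselect (irregular x) then 0%R
    else bridge_path x u) u @[u --> T^'-])).
  exact: cvg_trans (near_eq_cvg e) c.
have e : \forall u \near t, (if pselect (irregular x) then 0%R else bridge_path x u)
      = bridge u x.
  near=> u; have uT : (u < T)%R by near: u; exact: lt_nbhsl.
  by rewrite /bridge uT.
have [r l] : cadlag `[0%R, T[ (fun u => if pselect (irregular x) then 0%R
    else bridge_path x u)%R /\ True.
  split => //; case: pselect => xi; first exact: cadlag_cst.
  by apply: (cadlag_bridge_path T0 hf) => u; rewrite /= in_itv/= => /andP[].
have [|cr cl] := r t; first by rewrite /= in_itv/= t0.
have hex s : `[0%R, T]%classic s -> (s < t)%R -> `[0%R, T[%classic s.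
  by rewrite /= !in_itv/= => /andP[-> _] st; rewrite (lt_trans st tT).
split.
  move=> _.
  have h : exists2 s, `[0%R, T[%classic s & (t < s)%R.
    exists ((t + T) / 2)%R; last by rewrite (midf_lt tT).1.
    by rewrite /= in_itv/= (midf_lt tT).2 andbT (le_trans t0)// ltW// (midf_lt tT).1.
  rewrite {2}/bridge tT; apply: cvg_trans (cr h).
  by apply: near_eq_cvg; apply: cvg_within; exact: e.
move=> [s s0 st]; have /cvg_ex[y hy] := cl (ex_intro2 _ _ s (hex s s0 st) st).
apply/cvg_ex; exists y; apply: cvg_trans hy.
by apply: near_eq_cvg; apply: cvg_within; exact: e.
Unshelve. all: by end_near. Qed.

Variable Q : probability (seqspace state) R.
Hypothesis QE : forall n C, cylinder n C ->
  Q C = chain bridge_kernel n 0 (point : state) C.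

Lemma irregular_null : Q irregular = 0.
Proof.
apply: measure_negligible; first exact: measurable_irregular.
apply: negligible_bigcup => k; apply/negligibleP.
  by apply: bigcapT_measurable => m; exact: (measurable_osc hf).
by apply: (oscillates_null QE); rewrite invr_gt0.
Qed.

Lemma bridge_family_law (J : finType) (ts : J -> R) (s : R)
    (A : set (#|J|.-tuple R)) (B : set R) :
  (0 <= s)%R -> (s < T)%R -> (forall j, 0 <= ts j <= s)%R ->
  measurable A -> measurable B ->
  Q [set x | A (to_tuple (fun j => bridge (ts j) x)) /\ B (bridge T x)] =
  \int[nu]_(z in B) ((\int[PX]_w
     ((\1_A (to_tuple (fun j => X (ts j) w - X 0 w)%R))%:E *
      f (T - s)%R (z - (X s w - X 0 w))%R)) / f T z).
Proof.
move=> s0 sT tss mA mB; rewrite -(bridge_law QE s0 sT tss mA mB).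
have mset (Y : J -> seqspace state -> R) (Z : seqspace state -> R) :
    (forall j, measurable_fun setT (Y j)) -> measurable_fun setT Z ->
    measurable [set x | A (to_tuple (fun j => Y j x)) /\ B (Z x)].
  move=> mY mZ; have mYt := measurable_to_tuple mY.
  by apply: measurableI; rewrite -[X in measurable X]setTI; [exact: mYt|exact: mZ].
have cut (E : set (seqspace state)) : measurable E -> Q E = Q (E `\` irregular).
  by move=> mE; exact: (measure_setD_null mE measurable_irregular irregular_null).
rewrite cut; last first.
  by apply: mset; [move=> j; exact: measurable_bridge|exact: measurable_bridge].
rewrite [RHS]cut; last first.
  by apply: mset; [move=> j; exact: (measurable_bridge_path hf)|exact: measurable_end_point].
congr (Q _).
have tsE x : ~ irregular x -> (fun j => bridge (ts j) x) = (fun j => bridge_path x (ts j)).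
  move=> nx; apply/funext => j; rewrite /bridge ifT; first by case: pselect.
  by have /andP[_ h] := tss j; exact: le_lt_trans sT.
by apply/seteqP; split => x /= [h nx]; split => //; move: h; rewrite tsE// bridge_end.
Qed.

End bridge_process.

(** * The bridge is a Levy random bridge *)
Section integral_Rn_theory.
Context {R : realType}.
Local Open Scope ereal_scope.

Lemma measurable_cons_tuple {d} {S : measurableType d} n (g : S -> R)
    (h : S -> n.-tuple R) : measurable_fun setT g -> measurable_fun setT h ->
  measurable_fun setT (fun s => cons_tuple (g s) (h s)).
Proof.
move=> mg mh; apply: eq_measurable_fun (measurable_cons mg mh) => s _.
exact: val_inj.
Qed.

Lemma integral_Rn_ge0 n (F : n.-tuple R -> \bar R) : (forall x, 0 <= F x) ->
  0 <= integral_Rn F.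
Proof.
elim: n F => [|n IH] F F0 /=; first exact: F0.
by apply: integral_ge0 => x _; exact: IH.
Qed.

Lemma measurable_integral_Rn n {d} {S : measurableType d}
    (F : S -> n.-tuple R -> \bar R) :
  measurable_fun setT (fun p : S * n.-tuple R => F p.1 p.2) ->
  (forall s x, 0 <= F s x) -> measurable_fun setT (fun s => integral_Rn (F s)).
Proof.
elim: n d S F => [|n IH] d S F mF F0 /=.
  apply: (measurableT_comp mF (_ : measurable_fun setT
    (fun s : S => (s, [tuple] : 0.-tuple R)))).
  by apply: measurable_fun_pair.
pose F' (p : S * R) (v : n.-tuple R) := F p.1 (cons_tuple p.2 v).
have mF' : measurable_fun setT (fun q : (S * R) * n.-tuple R => F' q.1 q.2).
  apply: (measurableT_comp mF (_ : measurable_fun setT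
     (fun q : (S * R) * n.-tuple R => (q.1.1, cons_tuple q.1.2 q.2)))).
  apply: measurable_fun_pair; first exact: measurableT_comp.
  apply: measurable_cons_tuple; last exact: measurable_snd.
  exact: (measurableT_comp measurable_snd measurable_fst).
have mI := IH _ _ F' mF' (fun p v => F0 _ _).
apply: (@measurable_fun_fubini_tonelli_F _ _ S (measurableTypeR R) R
  lebesgue_measure (fun p => integral_Rn (F' p)) mI) => p.
by apply: integral_Rn_ge0 => v; exact: F0.
Qed.

Lemma integral_RnZr n (F : n.-tuple R -> \bar R) c : measurable_fun setT F ->
  (forall x, 0 <= F x) -> 0 <= c ->
  integral_Rn (fun x => F x * c) = integral_Rn F * c.
Proof.
elim: n F => [//|n IH] F mF F0 c0 /=.
have mF' : measurable_fun setT
    (fun p : R * n.-tuple R => F (cons_tuple p.1 p.2)).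
  by apply: (measurableT_comp mF); exact: measurable_cons_tuple.
rewrite -ge0_integralZr//.
- apply: eq_integral => x _; rewrite IH//.
  exact: (measurableT_comp mF' (measurable_pair1 x)).
- exact: (@measurable_integral_Rn n _ R (fun x v => F (cons_tuple x v))).
- by move=> x _; exact: integral_Rn_ge0.
Qed.

Lemma eq_integral_Rn n (F G : n.-tuple R -> \bar R) : F =1 G ->
  integral_Rn F = integral_Rn G.
Proof. by move=> /funext ->. Qed.

End integral_Rn_theory.

Lemma emeasurable_prod {R : realType} {d} {S : measurableType d} k
    (h : 'I_k -> S -> \bar R) : (forall i, measurable_fun setT (h i)) ->
  measurable_fun setT (fun s => \prod_(i < k) h i s)%E.
Proof.
elim: k h => [|k IH] h mh.
  by under eq_fun do rewrite big_ord0; exact: measurable_cst.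
under eq_fun do rewrite big_ord_recr; apply: emeasurable_funM => //.
by apply: IH => i; exact: mh.
Qed.

Section levy_density.
Context {R : realType} (T : R).
Context (nu : probability (measurableTypeR R) R).
Context {dX : measure_display} {OmX : measurableType dX}.
Context (PX : probability OmX R) (X : R -> OmX -> R) (f : R -> R -> \bar R).
Hypothesis hf : lrb_parameters f T nu PX X.
Local Open Scope ereal_scope.
Let levyX := lrb_levy hf.

(** The density at x of the positions at the times t of the process started at
    time a from x0. *)
Definition fdd_density k (t : k.-tuple R) (a x0 : R) (x : k.-tuple R) : \bar R :=
  \prod_(i < k) f (tnth t i - nth 0%R (a :: t) i)%R (tnth x i - nth 0%R (x0 :: x) i)%R.

Let step_gt0 k (t : k.-tuple R) a (i : 'I_k) : path <%R a t ->
  (0 < tnth t i - nth 0%R (a :: t) i)%R.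
Proof.
move=> /(pathP 0%R) /(_ i); rewrite size_tuple => /(_ (ltn_ord i)).
by rewrite subr_gt0 (tnth_nth 0%R).
Qed.

Lemma fdd_density_ge0 k (t : k.-tuple R) a x0 x : path <%R a t ->
  0 <= fdd_density t a x0 x.
Proof.
move=> pt; apply: prode_ge0 => i _; apply: (density_nonneg hf).
exact: step_gt0.
Qed.

Lemma measurable_fdd_density k (t : k.-tuple R) a x0 : path <%R a t ->
  measurable_fun setT (fdd_density t a x0).
Proof.
move=> pt; apply: emeasurable_prod => i.
apply: (measurableT_comp (density_measurable hf (step_gt0 i pt))).
apply: measurable_funB; first exact: measurable_tnth.
case: i => -[|i] ik /=; first exact: measurable_cst.
rewrite (_ : (fun _ => _) = (fun x : k.-tuple R => tnth x (Ordinal (ltnW ik)))).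
  exact: measurable_tnth.
by apply/funext => x; rewrite (tnth_nth 0%R).
Qed.

(** By induction on the number of times: the first increment is independent of
    the others, and given its value they form the same problem with the
    starting point (t_1, x_1). *)
Lemma levy_fdd_density k (t : k.-tuple R) a x0 (G : k.-tuple R -> \bar R) :
  (0 <= a)%R -> path <%R a t -> (last a t <= T)%R ->
  measurable_fun setT G -> (forall x, 0 <= G x) ->
  \int[PX]_w G [tuple (x0 + (X (tnth t i) w - X a w))%R | i < k] =
  integral_Rn (fun x => G x * fdd_density t a x0 x).
Proof.
elim: k t a x0 G => [|k IH] t a x0 G a0 pt lT mG G0.
  rewrite /fdd_density /= big_ord0 mule1.
  under eq_integral do rewrite tuple0.
  by rewrite integral_cst//= probability_setT mule1; congr G; exact: tuple0.
case/tupleP: t pt lT => t1 t' /= /andP[at1 pt'] lT.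
pose u q := nth 0%R (a :: t1 :: t') (minn q k.+1).
have uE q : (q <= k.+1)%N -> u q = nth 0%R (a :: t1 :: t') q.
  by move=> qk; rewrite /u (minn_idPl qk).
have t10 : (0 <= t1)%R by rewrite (le_trans a0)// ltW.
have nu' : {homo u : i j / (i <= j)%N >-> (i <= j)%R}.
  have srt : sorted <=%R (a :: t1 :: t').
    by apply: (sub_path (e := <%R)) => [x y /ltW//|]; rewrite /= at1.
  move=> i j ij; apply: (sorted_leq_nth le_trans lexx 0%R srt).
  - by rewrite inE /= size_tuple ltnS geq_minr.
  - by rewrite inE /= size_tuple ltnS geq_minr.
  - by rewrite leq_min geq_minr (leq_trans (geq_minl _ _)).
pose rest (y : 'I_k + unit -> R) (b : R) : k.-tuple R :=
  [tuple (b + \sum_(j < i.+1) y (inl (widen_ord (ltn_ord i) j)))%R | i < k].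
pose F (y : 'I_k + unit -> R) : \bar R :=
  G (cons_tuple (x0 + y (inr tt))%R (rest y (x0 + y (inr tt)))%R).
have mF : measurable_fun setT (fun v : #|{: 'I_k + unit}|.-tuple R => F (of_tuple v)).
  apply: (measurableT_comp mG); apply: measurable_cons_tuple.
    by apply: measurable_funD => //; exact: measurable_of_tuple.
  apply: measurable_mktuple => i; apply: measurable_funD.
    by apply: measurable_funD => //; exact: measurable_of_tuple.
  by apply: measurable_sum => j; exact: measurable_of_tuple.
have F0 y : 0 <= F y by exact: G0.
have u0 : u 0%N = a by rewrite uE.
have u1 : u 1%N = t1 by rewrite uE.
have uS (i : 'I_k) : u i.+2 = tnth t' i.
  by rewrite uE ?ltnS ?ltn_ord//= (tnth_nth 0%R).
have H1 := levy_grid_split levyX (ord0 : 'I_k.+1) _ nu' mF F0.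
rewrite u0 in H1; move/(_ a0) : H1 => /= H1.
have sumE w (i : 'I_k) : (\sum_(j < i.+1) (X (u (bump 0 j).+1) w - X (u (bump 0 j)) w)
    = X (tnth t' i) w - X t1 w)%R.
  rewrite -uS -u1 -(sum_telescope i.+1 (fun j => X (u j.+1) w)).
  by apply: eq_bigr => j _; rewrite /bump leq0n add1n.
pose H y := \int[PX]_w G (cons_tuple y
  [tuple (y + (X (tnth t' i) w - X t1 w))%R | i < k]).
pose g (p : R * OmX) := G (cons_tuple p.1
  [tuple (p.1 + (X (tnth t' i) p.2 - X t1 p.2))%R | i < k]).
have mg : measurable_fun setT g.
  apply: (measurableT_comp mG); apply: measurable_cons_tuple => //.
  apply: measurable_mktuple => i; apply: measurable_funD => //.
  apply: (measurableT_comp (levy_measurableB levyX t10 _) measurable_snd).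
  by rewrite -uS (le_trans a0)// -u0; exact: nu'.
have mH : measurable_fun setT H.
  by apply: (measurable_fun_fubini_tonelli_F (m2 := PX) g mg) => p; exact: G0.
have H0 y : 0 <= H y by apply: integral_ge0.
transitivity (\int[PX]_w F (fun k0 => X (u (unlift_unit (ord0 : 'I_k.+1) k0).+1) w -
    X (u (unlift_unit (ord0 : 'I_k.+1) k0)) w)%R).
  apply: eq_integral => w _; rewrite /F /= u0 u1; congr G.
  apply: eq_from_tnth => i; case: (unliftP ord0 i) => [j ->|->].
    by rewrite tnth_mktuple !tnthS tnth_mktuple sumE; ring.
  by rewrite tnth_mktuple !tnth0.
rewrite H1.
pose y w := (x0 + (X t1 w - X a w))%R.
have my : measurable_fun setT y.
  by apply: measurable_funD => //; exact: (levy_measurableB levyX).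
transitivity (\int[PX]_w \int[PX]_w' g (y w', w)).
  apply: eq_integral => w _; apply: eq_integral => w' _.
  rewrite /F /g /= u0 u1; congr (G (cons_tuple _ _)).
  by apply: eq_from_tnth => i; rewrite !tnth_mktuple sumE.
rewrite (fubini_tonelli (m1 := PX) (m2 := PX) (fun q => g (y q.2, q.1))); last 2 first.
- apply: (measurableT_comp mg); apply: measurable_fun_pair => //.
  exact: measurableT_comp.
- by move=> q; exact: G0.
transitivity (\int[PX]_w H (y w)); first by [].
have t1a : (0 < t1 - a <= T)%R.
  rewrite subr_gt0 at1/= lerBlDr (le_trans _ (_ : T <= T + a)%R) ?lerDl//.
  rewrite (le_trans _ lT)//.
  exact: unstable.path_lt_le_last.
have t1a0 : (0 <= t1 - a)%R by have /andP[/ltW] := t1a.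
transitivity (\int[PX]_w H (x0 + X (t1 - a)%R w)%R).
  have mHx : measurable_fun setT (fun v : R => H (x0 + v)%R).
    by apply: (measurableT_comp mH); exact: measurable_funD.
  have mXB := levy_measurableB levyX a0 t10.
  have mXs := levy_measurable levyX t1a0.
  apply: (@law_integral _ _ _ _ _ PX PX _ _ _ _ _ mXB mXs _ mHx).
    move=> A mA; have := levy_stationary hf a0 t1a0 mA; rewrite subrKC => ->//.
  by move=> v; exact: H0.
have mf1 : measurable_fun setT (f (t1 - a)%R).
  by apply: (density_measurable hf); have /andP[] := t1a.
have f10 v : 0 <= f (t1 - a)%R v by apply: (density_nonneg hf); have /andP[] := t1a.
rewrite (@integral_levy_density _ _ _ _ _ _ _ _ hf (t1 - a)%R
  (fun v => H (x0 + v)%R))//; last first.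
  by apply: (measurableT_comp mH); exact: measurable_funD.
rewrite -(integral_shift (- x0))//; last 2 first.
- apply: emeasurable_funM => //; apply: (measurableT_comp mH).
  exact: measurable_funD.
- by move=> v; rewrite mule_ge0.
apply: eq_integral => v _; rewrite subrKC.
rewrite /H (IH t' t1 v (fun x => G (cons_tuple v x)))//; last first.
  by apply: (measurableT_comp mG); exact: measurable_cons_tuple.
rewrite -integral_RnZr//; last 2 first.
- apply: emeasurable_funM; last exact: measurable_fdd_density.
  by apply: (measurableT_comp mG); exact: measurable_cons_tuple.
- by move=> x; rewrite mule_ge0//; exact: fdd_density_ge0.
apply: eq_integral_Rn => x; rewrite -muleA; congr (_ * _).
rewrite /fdd_density big_ord_recl !tnth0 /= muleC; congr (_ * _).
by apply: eq_bigr => i _; rewrite !tnthS.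
Qed.
End levy_density.

Section bridge_lrb.
Context {R : realType} (T : R) (T0 : 0 < T).
Context (nu : probability (measurableTypeR R) R).
Context {dX : measure_display} {OmX : measurableType dX}.
Context (PX : probability OmX R) (X : R -> OmX -> R) (f : R -> R -> \bar R).
Hypothesis hf : lrb_parameters f T nu PX X.
Local Open Scope ereal_scope.
Local Notation state := ((R * R) * OmX)%type.
Local Notation bridge_kernel := (bridge_kernel T0 hf).
Local Notation bridge := (bridge T X).
Variable Q : probability (seqspace state) R.
Hypothesis QE : forall n C, cylinder n C ->
  Q C = chain bridge_kernel n 0 (point : state) C.

Lemma last_tnth k (x : k.+1.-tuple R) (a : R) : last a x = tnth x ord_max.
Proof.
rewrite (tnth_nth a) -nth_last size_tuple/=.
by apply: set_nth_default; rewrite size_tuple.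
Qed.

Lemma bridge_end_law (B : set (measurableTypeR R)) : measurable B ->
  Q (bridge T @^-1` B) = nu B.
Proof.
move=> mB.
have := @bridge_family_law _ _ _ _ _ _ _ _ _ _ _ QE 'I_0 (fun=> 0%R) 0%R setT B
  (lexx _) T0.
rewrite (_ : [set x | _] = bridge T @^-1` B); last first.
  by apply/seteqP; split => x //= [].
move=> -> //; last by case.
transitivity (\int[nu]_(z in B) 1); last by rewrite integral_cst// mul1e.
have mfT := density_measurable hf T0.
apply: ge0_ae_eq_integral => //.
- apply: (measurable_funS measurableT) => //.
  under eq_fun do under eq_integral do
    rewrite subrr !subr0 indicE in_setT mul1e.
  under eq_fun do rewrite integral_cst// probability_setT mule1.
  by apply: emeasurable_funM => //; apply: (measurable_inve mfT) => z; exact: (density_nonneg hf).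
- move=> z _; rewrite mule_ge0// ?inve_ge0; last exact: (density_nonneg hf).
  by apply: integral_ge0 => w _; rewrite mule_ge0//; rewrite subr0 (density_nonneg hf).
- case: hf => _ _ _ _ hnu.
  apply: (@filterS _ _ (ae_filter_ringOfSetsType nu) _ _ _ hnu) => z /andP[z0 z1] _.
  under eq_integral do rewrite subrr !subr0 indicE in_setT mul1e.
  by rewrite integral_cst// probability_setT mule1 mulee_inv.
Qed.

Theorem bridge_is_lrb : is_lrb f T nu Q bridge.
Proof.
split.
- by move=> t _; exact: (measurable_bridge hf).
- exact: (cadlag_bridge T0 hf).
- exact: bridge_end_law.
move=> [//|k] t _; rewrite rcons_path => /andP[pt lT] A B mA mB.
set s := last 0%R t in lT *.
have sE : s = tnth t ord_max by exact: last_tnth.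
have srt : sorted <=%R (0%R :: t).
  by apply: (sub_path (e := <%R)) => // x y /ltW.
have ts (i : 'I_k.+1) : (0 <= tnth t i <= s)%R.
  have h a b : (a <= b)%N -> (b <= k.+1)%N ->
      (nth 0%R (0%R :: t) a <= nth 0%R (0%R :: t) b)%R.
    move=> ab bk; apply: (sorted_leq_nth le_trans lexx 0%R srt) => //;
      by rewrite inE /= size_tuple ltnS// (leq_trans ab).
  rewrite sE !(tnth_nth 0%R) (h 0%N i.+1)//= ?ltn_ord//.
  by apply: (h i.+1 k.+1) => //.
have s0 : (0 <= s)%R by rewrite sE; have /andP[] := ts ord_max.
have Ts : (0 < T - s)%R by rewrite subr_gt0.
pose A' := [set v : #|'I_k.+1|.-tuple R | A [tuple of_tuple v i | i < k.+1]].
have mA' : measurable A'.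
  have mt : measurable_fun setT
      (fun v : #|'I_k.+1|.-tuple R => [tuple of_tuple v i | i < k.+1]).
    by apply: measurable_mktuple => i; exact: measurable_of_tuple.
  by rewrite -[X in measurable X]setTI; exact: mt.
have A'E (y : 'I_k.+1 -> R) : A' (to_tuple y) = A [tuple y i | i < k.+1].
  rewrite /A' /=; congr A; apply: eq_from_tnth => i.
  by rewrite !tnth_mktuple to_tupleK.
have := @bridge_family_law _ _ _ _ _ _ _ _ _ _ _ QE 'I_k.+1 (tnth t) s A' B
  s0 lT ts mA' mB.
rewrite (_ : [set x | _] = [set x | A [tuple bridge (tnth t i) x | i < k.+1] /\
    B (bridge T x)]); last first.
  by apply/seteqP; split => x /=; rewrite A'E.
move=> ->; apply: eq_integral => z _.
pose G (x : k.+1.-tuple R) := (\1_A x)%:E * f (T - s)%R (z - last 0%R x)%R.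
have mG : measurable_fun setT G.
  apply: emeasurable_funM; first exact: measurable_indic_ereal.
  apply: (measurableT_comp (density_measurable hf Ts)).
  apply: measurable_funB => //.
  by under eq_fun do rewrite last_tnth; exact: measurable_tnth.
have G0 x : 0 <= G x by apply: mule_ge0; rewrite ?lee_fin//; exact: (density_nonneg hf).
transitivity ((\int[PX]_w G [tuple (0 + (X (tnth t i) w - X 0 w))%R | i < k.+1]) / f T z).
  congr (_ / _); apply: eq_integral => w _.
  rewrite /G last_tnth tnth_mktuple -sE add0r; congr (_%:E * _).
  rewrite !indicE; congr (nat_of_bool _)%:R.
  have := A'E (fun j => X (tnth t j) w - X 0 w)%R.
  rewrite (_ : [tuple _ | i < k.+1] =
     [tuple (0 + (X (tnth t i) w - X 0 w))%R | i < k.+1]); last first.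
    by apply: eq_from_tnth => i; rewrite !tnth_mktuple add0r.
  by move=> e; apply/idP/idP => /set_mem h; apply/mem_set; rewrite -?e// e.
have sT : (last 0 t <= T)%R by exact: ltW.
rewrite (levy_fdd_density hf 0%R (lexx 0%R) pt sT mG G0) -integral_RnZr; last 3 first.
- by apply: emeasurable_funM => //; exact: (measurable_fdd_density hf).
- by move=> x; rewrite mule_ge0//; exact: (fdd_density_ge0 hf).
- by rewrite inve_ge0 (density_nonneg hf).
apply: eq_integral_Rn => x; rewrite /G /bridge_density -!muleA; congr (_ * _).
by rewrite [RHS]muleC -!muleA; congr (_ * _); rewrite muleC.
Qed.

End bridge_lrb.

(** * The coordinates of the R^n-valued process *)
Section box_integral.
Context {R : realType}.
Local Open Scope ereal_scope.

Lemma integral_Rn_prod n (phi : 'I_n -> R -> \bar R) :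
  (forall i, measurable_fun setT (phi i)) -> (forall i x, 0 <= phi i x) ->
  integral_Rn (fun x : n.-tuple R => \prod_(i < n) phi i (tnth x i)) =
  \prod_(i < n) \int[lebesgue_measure]_x phi i x.
Proof.
elim: n phi => [|n IH] phi mphi phi0; first by rewrite /= !big_ord0.
rewrite /= big_ord_recl -IH//.
have P0 : 0 <= integral_Rn (fun x : n.-tuple R => \prod_(i < n) phi (lift ord0 i) (tnth x i)).
  by apply: integral_Rn_ge0 => x; apply: prode_ge0.
rewrite -ge0_integralZr//; last exact: mphi.
apply: eq_integral => x _.
rewrite -[RHS]muleC -integral_RnZr//.
- by apply: eq_integral_Rn => v; rewrite big_ord_recl tnth0 muleC; congr (_ * _);
    apply: eq_bigr => i _; rewrite tnthS.
- apply: emeasurable_prod => i; apply: (measurableT_comp (mphi _)).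
  exact: measurable_tnth.
- by move=> v; apply: prode_ge0.
Qed.

End box_integral.

Lemma ae_const_law {R : realType} {d d'} {Om : measurableType d} {V : measurableType d'}
    (P : probability Om R) (Y : Om -> V) (c : V) (A : set V) :
  measurable_fun setT Y -> {ae P, forall w, Y w = c} -> measurable A ->
  P (Y @^-1` A) = (\1_A c)%:E.
Proof.
move=> mY Yc mA.
have mYA : measurable (Y @^-1` A) by rewrite -[X in measurable X]setTI; exact: mY.
rewrite -(setIT (Y @^-1` A)) -integral_indic//.
transitivity (\int[P]_w (\1_A c)%:E)%E; last first.
  by rewrite integral_cst// probability_setT mule1.
have mI : measurable_fun setT (fun w => (\1_(Y @^-1` A) w)%:E : \bar R).
  exact: measurable_indic_ereal.
apply: ge0_ae_eq_integral => //.
apply: (@filterS _ _ (ae_filter_ringOfSetsType P) _ _ _ Yc) => w Yw _.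
by rewrite /= -Yw !indicE.
Qed.

Section levy_tuple.
Context {R : realType} n (m : n.-tuple R) (hm : forall i, (0 < tnth m i)%R).
Context (nu : probability (measurableTypeR R) R).
Context {dX : measure_display} {OmX : measurableType dX}.
Context (PX : probability OmX R) (X : R -> OmX -> R) (f : R -> R -> \bar R).
Hypothesis hf : lrb_parameters f (tuple_sum m) nu PX X.
Context {d : measure_display} {Om : measurableType d}.
Context (P : probability Om R) (xi : R -> Om -> n.-tuple R).
Hypothesis hxi : levy_process_tuple P xi.
Hypothesis hg : forall t : R, (0 < t)%R -> has_density_Rn P (xi t)
  (fun x => (\prod_(i < n) f (tnth m i * t)%R (tnth x i))%E).
Local Open Scope ereal_scope.
Let levyX := lrb_levy hf.

Lemma levy_tuple_measurable t : (0 <= t)%R -> measurable_fun setT (xi t).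
Proof. by case: hxi => -[mxi _ _ _] _; exact: mxi. Qed.

Lemma levy_tuple_coord t i : (0 <= t)%R -> measurable_fun setT (fun w => tnth (xi t w) i).
Proof.
by move=> t0; exact: (measurableT_comp (measurable_tnth i) (levy_tuple_measurable t0)).
Qed.

Lemma activity_le_sum i : (tnth m i <= tuple_sum m)%R.
Proof.
rewrite /tuple_sum (bigD1 i)//= lerDl; apply: sumr_ge0 => j _; exact: ltW.
Qed.

Let box (A : 'I_n -> set R) := [set x : n.-tuple R | forall i, A i (tnth x i)].

Let measurable_box A : (forall i, measurable (A i)) -> measurable (box A).
Proof.
move=> mA; apply: (measurable_family_box (Y := fun i x => tnth x i)) => // i.
exact: measurable_tnth.
Qed.

Let indic_boxE (A : 'I_n -> set R) (x : n.-tuple R) :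
  (\1_(box A) x)%:E = \prod_(i < n) (\1_(A i) (tnth x i))%:E :> \bar R.
Proof.
rewrite indicE; have [xA|xA] := pselect (box A x).
  rewrite mem_set// big1// => i _; rewrite indicE mem_set//; exact: xA.
rewrite memNset//; move/existsNP : xA => [i xi'].
by rewrite (bigD1 i)//= indicE memNset// mul0e.
Qed.

(** A product density makes the coordinates independent, with the marginal laws
    of X at the times m_i h; at h = 0 both processes vanish almost surely. *)
Lemma levy_tuple_box h (A : 'I_n -> set R) : (0 <= h <= 1)%R ->
  (forall i, measurable (A i)) ->
  P [set w | forall i, A i (tnth (xi h w) i)] =
  \prod_(i < n) PX (X (tnth m i * h)%R @^-1` A i).
Proof.
move=> /andP[h0 h1] mA; have [h00|hn0] := eqVneq h 0%R.
  case: hxi => -[mxi xi0 _ _] _; case: levyX => _ X0 _ _.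
  rewrite (_ : [set w | _] = xi 0 @^-1` box A); last by rewrite h00.
  rewrite (ae_const_law (mxi _ (lexx _)) xi0 (measurable_box mA)) indic_boxE.
  apply: eq_bigr => i _; rewrite h00 mulr0 tnth_mktuple.
  by rewrite (ae_const_law (levy_measurable levyX (lexx _)) X0 (mA i)).
have {hn0} h0' : (0 < h)%R by rewrite lt_neqAle eq_sym hn0.
have mh i : (0 < tnth m i * h)%R by rewrite mulr_gt0.
have mbox := measurable_box mA.
rewrite (_ : [set w | _] = xi h @^-1` box A)// (hg h0' mbox).
transitivity (integral_Rn (fun x : n.-tuple R => \prod_(i < n)
   ((\1_(A i) (tnth x i))%:E * f (tnth m i * h)%R (tnth x i)))).
  by apply: eq_integral_Rn => x; rewrite indic_boxE big_split.
rewrite (@integral_Rn_prod _ n (fun i x => (\1_(A i) x)%:E * f (tnth m i * h)%R x)).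
- apply: eq_bigr => i _; case: hf => _ _ /(_ (tnth m i * h)%R) hd _ _.
  rewrite hd//; last by rewrite mh/= (le_trans _ (activity_le_sum i))// ler_piMr// ltW.
  rewrite [RHS]integral_mkcond epatch_indic; apply: eq_integral => x _.
  by rewrite muleC.
- move=> i; apply: emeasurable_funM; first exact: measurable_indic_ereal.
  exact: (density_measurable hf).
- by move=> i x; apply: mule_ge0; rewrite ?lee_fin//; exact: (density_nonneg hf).
Qed.

(** Increments over disjoint intervals are independent as vectors, and each
    vector has independent coordinates by [levy_tuple_box]. *)
Lemma levy_tuple_family (s : nat -> R) M :
  (0 <= s 0%N)%R -> {homo s : i j / (i <= j)%N >-> (i <= j)%R} -> (s M.+1 <= 1)%R ->
  levy_family PX X P
    (fun (p : 'I_n * 'I_M.+1) w => tnth (xi (s p.2.+1) w) p.1 - tnth (xi (s p.2) w) p.1)%R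
    (fun p => tnth m p.1 * s p.2.+1 - tnth m p.1 * s p.2)%R.
Proof.
move=> s0 ns s1.
have sge0 j : (0 <= s j)%R by rewrite (le_trans s0)//; exact: ns.
split => [p|A mA].
  by apply: measurable_funB; exact: levy_tuple_coord.
case: hxi => -[mxi xi0 stat ind] _.
pose B j := if insub j is Some j' then box (fun i => A (i, j')) else setT.
have BE (j : 'I_M.+1) : B j = box (fun i => A (i, j)) by rewrite /B valK.
have mB j : measurable (B j).
  by rewrite /B; case: insubP => // j' _ _; exact: measurable_box.
have := ind M.+1 s B s0 ns mB.
rewrite (_ : [set w | _] = [set w | forall p : 'I_n * 'I_M.+1,
    A p (tnth (xi (s p.2.+1) w) p.1 - tnth (xi (s p.2) w) p.1)%R]); last first.
  apply/seteqP; split => w /= h.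
    move=> [i j] /=; have := h j (ltn_ord j); rewrite BE => /(_ i).
    by rewrite tnth_mktuple.
  move=> j jM; rewrite -[j]/(nat_of_ord (Ordinal jM)) BE => i.
  by rewrite tnth_mktuple; exact: (h (i, Ordinal jM)).
move=> ->.
transitivity (\prod_(j < M.+1) \prod_(i < n)
    PX (X (tnth m i * s j.+1 - tnth m i * s j)%R @^-1` A (i, j))); last first.
  by rewrite exchange_big/= pair_bigA; apply: eq_bigr => -[i j].
apply: eq_bigr => j _.
have ds : (0 <= s j.+1 - s j)%R by rewrite subr_ge0 ns.
have := stat (s j) (s j.+1 - s j)%R (B j) (sge0 _) ds (mB j).
rewrite subrKC => ->.
rewrite BE (@levy_tuple_box _ (fun i => A (i, j)))//.
- by apply: eq_bigr => i _; rewrite mulrBr.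
- rewrite ds/= lerBlDr (le_trans (ns _ M.+1 _))// (le_trans s1)// lerDl.
  exact: sge0.
Qed.

End levy_tuple.

(** * The Liouville process as a reweighting of the Levy process *)
Section partial_activity.
Context {R : realType} n (m : n.-tuple R).

Lemma partial_activity0 : partial_activity m 0 = 0.
Proof. by rewrite /partial_activity take0 big_nil. Qed.

Lemma partial_activityS i :
  partial_activity m i.+1 = partial_activity m i + nth 0 m i.
Proof.
rewrite /partial_activity; have [im|mi] := ltnP i (size m).
  by rewrite (take_nth 0)// -cats1 big_cat/= big_seq1.
by rewrite !take_oversize ?(leqW mi)// nth_default// addr0.
Qed.

Lemma partial_activity_sum : partial_activity m n = tuple_sum m.
Proof. by rewrite /partial_activity take_oversize ?size_tuple// big_tuple. Qed.

End partial_activity.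

(** Sets apart the last increment of each row of the grid. *)
Definition last_split {n M} (k : ('I_n * 'I_M.+1) + 'I_n) : 'I_n * 'I_M.+2 :=
  match k with inl p => (p.1, lift ord_max p.2) | inr i => (i, ord_max) end.

Lemma last_split_bij n M : bijective (@last_split n M).
Proof.
exists (fun p => if unlift ord_max p.2 is Some j then inl (p.1, j) else inr p.1).
  by case=> [[i j]|i] /=; rewrite ?liftK ?unlift_none.
by case=> i j /=; case: unliftP => [j' ->|->].
Qed.

Section interleaving.
Context {R : realType} n (m : n.+1.-tuple R) (hm : forall i, (0 < tnth m i)%R).
Context (nu : probability (measurableTypeR R) R).
Context {dX : measure_display} {OmX : measurableType dX}.
Context (PX : probability OmX R) (X : R -> OmX -> R) (f : R -> R -> \bar R).
Local Notation T := (tuple_sum m).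
Hypothesis hf : lrb_parameters f T nu PX X.
Context {d : measure_display} {Om : measurableType d}.
Context (P : probability Om R) (xi : R -> Om -> n.+1.-tuple R).
Hypothesis hxi : levy_process_tuple P xi.
Hypothesis hg : forall t : R, (0 < t)%R -> has_density_Rn P (xi t)
  (fun x => (\prod_(i < n.+1) f (tnth m i * t)%R (tnth x i))%E).
Local Open Scope ereal_scope.
Let levyX := lrb_levy hf.
Local Notation u := (partial_activity m).

Lemma nth_activity_ge0 i : (0 <= nth 0%R m i)%R.
Proof.
have [im|mi] := ltnP i n.+1; last by rewrite nth_default// size_tuple.
by rewrite -[i]/(nat_of_ord (Ordinal im)) -tnth_nth ltW.
Qed.

Lemma partial_activity_homo : {homo u : i j / (i <= j)%N >-> (i <= j)%R}.
Proof.
apply: homo_leq => [//||i]; first exact: le_trans.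
by rewrite partial_activityS lerDl nth_activity_ge0.
Qed.

Lemma partial_activity_ge0 i : (0 <= u i)%R.
Proof. by rewrite -(partial_activity0 m) partial_activity_homo. Qed.

Lemma tuple_sum_last : T = (u n + nth 0 m n)%R.
Proof. by rewrite -partial_activity_sum partial_activityS. Qed.

Lemma last_activity_gt0 : (0 < nth 0%R m n)%R.
Proof. by rewrite -[n]/(nat_of_ord (ord_max : 'I_n.+1)) -tnth_nth. Qed.

(** The time of the bridge that coordinate i of the Liouville process has reached
    at time t. *)
Definition clock (i : nat) (t : R) : R := (u i + nth 0 m i * t)%R.

Lemma clock_le i s t : (s <= t)%R -> (clock i s <= clock i t)%R.
Proof. by move=> st; rewrite lerD2l ler_wpM2l ?nth_activity_ge0. Qed.

Lemma clock0 i : clock i 0 = u i. Proof. by rewrite /clock mulr0 addr0. Qed.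

Lemma clock_lt i t : (t <= 1)%R -> (clock i t <= u i.+1)%R.
Proof.
by move=> t1; rewrite partial_activityS lerD2l ler_piMr ?nth_activity_ge0.
Qed.

Let remains t : (T - clock n t = nth 0 m n * (1 - t))%R.
Proof. by rewrite tuple_sum_last /clock; ring. Qed.

Section grid.
Variables (s : nat -> R) (M : nat) (t : R).
Hypotheses (s0 : s 0%N = 0%R) (ns : {homo s : i j / (i <= j)%N >-> (i <= j)%R}).
Hypotheses (sM : s M.+1 = t) (t01 : (0 <= t < 1)%R).

(* Row i of the grid runs through the interval of coordinate i up to time t, and
   its last increment jumps over the gap to the next interval. *)
Let c i j := if (j <= M.+1)%N then clock i (s j) else u i.+1.

Let cE i j : (j <= M.+1)%N -> c i j = clock i (s j).
Proof. by rewrite /c => ->. Qed.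

Let cM i : c i M.+2 = c i.+1 0%N.
Proof. by rewrite /c ltnn s0 clock0. Qed.

Let t0 : (0 <= t)%R. Proof. by have /andP[] := t01. Qed.
Let t1 : (t < 1)%R. Proof. by have /andP[] := t01. Qed.

Let cS i j : (j <= M.+1)%N -> (c i j <= c i j.+1)%R.
Proof.
rewrite leq_eqVlt => /orP[/eqP ->|jM].
  by rewrite cM !cE// s0 clock0 sM clock_lt// ltW.
by rewrite !cE// ?(ltnW jM)//; apply: clock_le; exact: ns.
Qed.

Let Y (p : 'I_n.+1 * 'I_M.+2) w := (X (c p.1 p.2.+1) w - X (c p.1 p.2) w)%R.
Let U (p : 'I_n.+1 * 'I_M.+1) w :=
  (tnth (xi (s p.2.+1) w) p.1 - tnth (xi (s p.2) w) p.1)%R.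
(* Increments with the lengths of the gaps, but placed end to end: their sum is
   a single increment of X. *)
Let V (i : 'I_n.+1) w := (X (u i.+1 * (1 - t))%R w - X (u i * (1 - t))%R w)%R.

Let family_X : levy_family PX X PX (Y \o last_split)
  (sum_fun (fun p : 'I_n.+1 * 'I_M.+1 => tnth m p.1 * s p.2.+1 - tnth m p.1 * s p.2)
           (fun i : 'I_n.+1 => u i.+1 * (1 - t) - u i * (1 - t)))%R.
Proof.
have c00 : (0 <= c 0 0)%R by rewrite cE// s0 clock0 partial_activity_ge0.
have := levy_family_bij (last_split_bij n.+1 M) (levy_family_lex levyX n.+1 c00 cS cM).
congr levy_family; apply/funext => -[[i j]|i] /=.
  rewrite /bump leqNgt ltn_ord add0n !cE ?(ltn_ord j)//; last exact: ltnW.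
  by rewrite /clock (tnth_nth 0%R); ring.
by rewrite cM !cE// s0 clock0 sM /clock partial_activityS; ring.
Qed.

Let family_V : levy_family PX X PX V (fun i => u i.+1 * (1 - t) - u i * (1 - t))%R.
Proof.
apply: (levy_family_grid levyX (t := fun i => u i * (1 - t))%R).
  by rewrite partial_activity0 mul0r.
move=> i j ij; rewrite ler_wpM2r ?subr_ge0 ?(ltW t1)//.
exact: partial_activity_homo.
Qed.

(** The increments of X inside the intervals may be replaced by those of xi, and
    the independent ones over the gaps by those of V. By the Chapman-Kolmogorov
    equation the latter turn the density at time T - clock n t, the length of the
    last gap, into the density at time T (1 - t), the length of all gaps. *)
Lemma levy_interleaving z (G : ('I_n.+1 * 'I_M.+1 -> R) -> \bar R) :
  measurable_fun setT (fun v : #|{: 'I_n.+1 * 'I_M.+1}|.-tuple R => G (of_tuple v)) ->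
  (forall y, 0 <= G y) ->
  \int[PX]_w (G (fun p => X (clock p.1 (s p.2.+1)) w - X (clock p.1 (s p.2)) w)%R *
    f (T - clock n t)%R (z - (X (clock n t) w - X 0%R w))%R) =
  \int[P]_w (G (fun p => U p w) *
    f (T * (1 - t))%R (z - (tuple_sum (xi t w) - tuple_sum (xi 0%R w)))%R).
Proof.
move=> mG G0.
have Tn : (0 < T - clock n t)%R.
  by rewrite remains mulr_gt0 ?last_activity_gt0// subr_gt0.
pose F (y : ('I_n.+1 * 'I_M.+1) + 'I_n.+1 -> R) : \bar R :=
  G (fun p => y (inl p)) * f (T - clock n t)%R
    (z - (\sum_p y (inl p) + \sum_(i < n) y (inr (widen_ord (leqnSn n) i))))%R.
have mF : measurable_fun setT
    (fun v : #|{: ('I_n.+1 * 'I_M.+1) + 'I_n.+1}|.-tuple R => F (of_tuple v)).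
  apply: emeasurable_funM.
    have mi p : measurable_fun setT (fun v : #|{: ('I_n.+1 * 'I_M.+1) + 'I_n.+1}|.-tuple R =>
        of_tuple v (inl p)) by exact: measurable_of_tuple.
    apply: eq_measurable_fun (measurableT_comp mG (measurable_to_tuple mi)) => v _.
    by rewrite /= to_tupleK.
  apply: (measurableT_comp (density_measurable hf Tn)).
  apply: measurable_funB => //; apply: measurable_funD.
    by apply: measurable_sum => p; exact: measurable_of_tuple.
  by apply: measurable_sum => p; exact: measurable_of_tuple.
have F0 y : 0 <= F y by rewrite mule_ge0// (density_nonneg hf).
have sM1 : (s M.+1 <= 1)%R by rewrite sM ltW.
have s00 : (0 <= s 0%N)%R by rewrite s0.
have family_U := levy_tuple_family hm hf hxi hg s00 ns sM1.
have := levy_family_split family_U family_V family_X mF F0.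
congr (_ = _); apply: eq_integral => w _; rewrite /F /=.
- congr (_ * f _ (_ - _)%R).
    congr G; apply/funext => -[i j]; rewrite /Y /= /bump leqNgt ltn_ord add0n.
    by rewrite !cE ?(ltn_ord j)//; exact: ltnW.
  rewrite -(pair_bigA _ (fun i j => Y (i, lift ord_max j) w))/=.
  have rowE (i : 'I_n.+1) : (\sum_(j < M.+1) Y (i, lift ord_max j) w =
      X (c i M.+1) w - X (c i 0%N) w)%R.
    rewrite -(sum_telescope M.+1 (fun j => X (c i j) w)); apply: eq_bigr => j _.
    by rewrite /Y /= /bump leqNgt ltn_ord add0n.
  under eq_bigr do rewrite rowE.
  rewrite big_ord_recr/= addrAC -big_split/=.
  rewrite (eq_bigr (fun i : 'I_n => X (u i.+1) w - X (u i) w)%R); last first.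
    by move=> i _; rewrite /Y /= cM (cE _ (leq0n _)) (cE i.+1 (leq0n _)) s0 !clock0; ring.
  rewrite (sum_telescope n (fun i => X (u i) w)) partial_activity0.
  by rewrite !cE// s0 clock0 sM; ring.
have UE : (\sum_p U p w = tuple_sum (xi t w) - tuple_sum (xi 0%R w))%R.
  rewrite -(pair_bigA _ (fun i j => U (i, j) w))/= /tuple_sum -sumrB.
  apply: eq_bigr => i _.
  by have := sum_telescope M.+1 (fun j => tnth (xi (s j) w) i); rewrite sM s0.
have VE w' : (\sum_(i < n) V (widen_ord (leqnSn n) i) w' =
    X (0 + u n * (1 - t)) w' - X 0 w')%R.
  rewrite (sum_telescope n (fun i => X (u i * (1 - t))%R w')).
  by rewrite partial_activity0 mul0r add0r.
rewrite UE; under eq_integral do rewrite VE.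
set D := (tuple_sum (xi t w) - tuple_sum (xi 0%R w))%R.
have un1 : (0 <= u n * (1 - t))%R.
  by rewrite mulr_ge0 ?partial_activity_ge0// subr_ge0 ltW.
rewrite ge0_integralZl//; last 2 first.
- apply: (measurableT_comp (density_measurable hf Tn)).
  apply: measurable_funB => //; apply: measurable_funD => //.
  by apply: (levy_measurableB levyX) => //; rewrite add0r.
- by move=> w' _; exact: (density_nonneg hf).
congr (_ * _).
rewrite -(density_increment hf (a := 0%R) (s := (u n * (1 - t))%R) (t := (T * (1 - t))%R)) //.
- apply: eq_integral => w' _; congr (f _ _); last by ring.
  by rewrite remains tuple_sum_last; ring.
- rewrite un1/= ltr_pM2r ?subr_gt0//.
  by rewrite tuple_sum_last ltrDl last_activity_gt0.
- by rewrite ler_piMr ?lerBlDr ?lerDl// -partial_activity_sum partial_activity_ge0.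
Qed.

End grid.
End interleaving.

Lemma eq_indic {R : realType} {T T' : Type} (A : set T) (B : set T') a b :
  (A a <-> B b) -> \1_A a = \1_B b :> R.
Proof.
move=> [AB BA]; rewrite !indicE; congr (nat_of_bool _)%:R.
by apply/idP/idP => /set_mem h; apply/mem_set; [exact: AB|exact: BA].
Qed.

Section theta.
Context {R : realType} n (m : n.+1.-tuple R) (hm : forall i, (0 < tnth m i)%R).
Context (nu : probability (measurableTypeR R) R).
Context {dX : measure_display} {OmX : measurableType dX}.
Context (PX : probability OmX R) (X : R -> OmX -> R) (f : R -> R -> \bar R).
Local Notation T := (tuple_sum m).
Hypothesis hf : lrb_parameters f T nu PX X.
Local Open Scope ereal_scope.
Let levyX := lrb_levy hf.
Local Notation u := (partial_activity m).
Local Notation clock := (clock m).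

Lemma tuple_sum_gt0 : (0 < T)%R.
Proof.
rewrite tuple_sum_last ltr_wpDl ?last_activity_gt0//.
exact: partial_activity_ge0.
Qed.

Let T1_gt0 t : (t < 1)%R -> (0 < T * (1 - t))%R.
Proof. by move=> t1; rewrite mulr_gt0 ?tuple_sum_gt0// subr_gt0. Qed.

(** The integrand of Theta, as a function of the pair (x, z). *)
Definition mixture t (p : R * R) : \bar R := f (T * (1 - t))%R (p.2 - p.1)%R / f T p.2.

Lemma mixture_ge0 t p : (t < 1)%R -> 0 <= mixture t p.
Proof.
move=> t1; apply: mule_ge0; rewrite ?inve_ge0; apply: (density_nonneg hf) => //.
  exact: T1_gt0.
exact: tuple_sum_gt0.
Qed.

Lemma measurable_mixture t : (t < 1)%R -> measurable_fun setT (mixture t).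
Proof.
move=> t1; apply: emeasurable_funM.
  apply: (measurableT_comp (density_measurable hf (T1_gt0 t1))).
  exact: measurable_funB.
apply: measurable_inve; last first.
  by move=> p; apply: (density_nonneg hf); exact: tuple_sum_gt0.
exact: (measurableT_comp (density_measurable hf tuple_sum_gt0) measurable_snd).
Qed.

Lemma measurable_integral_mixture t : (t < 1)%R ->
  measurable_fun setT (fun x : R => \int[nu]_z mixture t (x, z)).
Proof.
move=> t1.
apply: (@measurable_fun_fubini_tonelli_F _ _ R (measurableTypeR R) R nu (mixture t)).
  exact: measurable_mixture.
by move=> p; exact: mixture_ge0.
Qed.

Lemma measurable_Theta t : (t < 1)%R -> measurable_fun setT (Theta f T nu t).
Proof.
move=> t1; rewrite /Theta; case: eqP => _; first exact: measurable_cst.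
exact: measurable_integral_mixture.
Qed.

Lemma Theta_ge0 t x : (t < 1)%R -> 0 <= Theta f T nu t x.
Proof.
move=> t1; rewrite /Theta; case: eqP => // _; apply: integral_ge0 => z _.
exact: (mixture_ge0 (x, z) t1).
Qed.

(** At t = 0 and x = 0 the ratio is f_T / f_T, which is 1 almost everywhere. *)
Lemma mixture_Theta t x : (t < 1)%R -> (t = 0 -> x = 0)%R ->
  \int[nu]_z mixture t (x, z) = Theta f T nu t x.
Proof.
move=> t1 tx; rewrite /Theta; case: eqP => // t0.
rewrite (tx t0) /mixture t0.
transitivity (\int[nu]_z 1); last by rewrite integral_cst// probability_setT mule1.
apply: ge0_ae_eq_integral => //.
- exact: (measurableT_comp (measurable_mixture (ltr01 : (0 < 1)%R))
    (measurable_pair1 (0%R : R))).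
- by move=> z _; exact: (mixture_ge0 (0, z)%R (ltr01 : 0 < 1)%R).
- case: hf => _ _ _ _ hnu.
  apply: (@filterS _ _ (ae_filter_ringOfSetsType nu) _ _ _ hnu) => z /andP[z0 z1] _.
  by rewrite /= !subr0 mulr1 mulee_inv.
Qed.

Section law.
Context {d : measure_display} {Om : measurableType d}.
Context (P : probability Om R) (xi : R -> Om -> n.+1.-tuple R).
Hypothesis hxi : levy_process_tuple P xi.
Hypothesis hg : forall t : R, (0 < t)%R -> has_density_Rn P (xi t)
  (fun x => (\prod_(i < n.+1) f (tnth m i * t)%R (tnth x i))%E).

Lemma measurable_tuple_sum {d'} {S : measurableType d'} (Y : S -> n.+1.-tuple R) :
  measurable_fun setT Y -> measurable_fun setT (fun s => tuple_sum (Y s)).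
Proof.
move=> mY; apply: measurable_sum => i.
exact: (measurableT_comp (measurable_tnth i) mY).
Qed.

Variable Q : probability (seqspace ((R * R) * OmX)%type) R.
Hypothesis QE : forall n C, cylinder n C ->
  Q C = chain (bridge_kernel tuple_sum_gt0 hf) n 0 (point : (R * R) * OmX) C.

(** The positions of the Liouville process up to time t are functions of the
    bridge up to time s = clock n t < T. [bridge_family_law] expresses their law
    by X with a weight, [levy_interleaving] by xi with another weight, and
    exchanging the integrals over z and over the trajectories reveals Theta. *)
Theorem theta_fdd k (ts : 'I_k -> R) (A : 'I_k -> set (n.+1.-tuple R)) t :
  (0 <= t < 1)%R -> (forall j, 0 <= ts j <= t)%R -> (forall j, measurable (A j)) ->
  \int[P]_(w in [set w | forall j, A j (xi (ts j) w)])
     Theta f T nu t (tuple_sum (xi t w)) =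
  Q [set x | forall j, A j (glp_of_lrb m (bridge T X) (ts j) x)].
Proof.
move=> t01 tst mA; have /andP[t0 t1] := t01.
have [M [s [c [s0 ns cM sc sM]]]] := time_grid t0 tst.
have ts0 j : (0 <= ts j)%R by have /andP[] := tst j.
pose J := ('I_n.+1 * option 'I_k)%type.
pose r (p : J) := if p.2 is Some j then clock p.1 (ts j) else clock p.1 0.
have clock_ge0 i a : (0 <= a)%R -> (0 <= clock i a)%R.
  by move=> a0; rewrite (le_trans (partial_activity_ge0 hm i))// -clock0 clock_le.
have rS p : (0 <= r p <= clock n t)%R.
  have h i a : (i < n.+1)%N -> (0 <= a <= t)%R -> (0 <= clock i a <= clock n t)%R.
    move=> ilt /andP[a0 ta]; rewrite clock_ge0//=.
    rewrite (le_trans (clock_le hm i ta))//.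
    move: ilt; rewrite ltnS leq_eqVlt => /orP[/eqP -> //|ilt].
    rewrite (le_trans (clock_lt hm i (ltW t1)))//.
    rewrite (le_trans (partial_activity_homo hm ilt))// -clock0.
    exact: clock_le.
  by case: p => i [j|] /=; apply: h => //; rewrite lexx t0.
have ST : (clock n t < T)%R.
  by rewrite tuple_sum_last ltrD2l gtr_pMr// last_activity_gt0.
pose incr (v : J -> R) j : n.+1.-tuple R := [tuple (v (i, Some j) - v (i, None))%R | i < n.+1].
pose A' := [set v : #|{: J}|.-tuple R | forall j, A j (incr (of_tuple v) j)].
have mA' : measurable A'.
  apply: (measurable_family_box (Y := fun j v => incr (of_tuple v) j)) => // j.
  by apply: measurable_mktuple => i; apply: measurable_funB; exact: measurable_of_tuple.
have A'E v : A' (to_tuple v) = forall j, A j (incr v j).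
  by rewrite /A' /=; under eq_forall do rewrite (_ : of_tuple _ = v) ?to_tupleK//.
have := bridge_family_law QE (clock_ge0 n t t0) ST rS mA' measurableT.
rewrite (_ : [set x | _] = [set x | forall j, A j (glp_of_lrb m (bridge T X) (ts j) x)]);
    last first.
  have E x : A' (to_tuple (fun p => bridge T X (r p) x)) =
      forall j, A j (glp_of_lrb m (bridge T X) (ts j) x).
    rewrite A'E; apply: eq_forall => j; congr (A j _).
    apply: eq_from_tnth => i; rewrite !tnth_mktuple /r /= clock0 /glp_of_lrb.
    by congr (bridge T X _ x - _)%R; rewrite /clock (tnth_nth 0%R); ring.
  by apply/seteqP; split => x /=; rewrite E //; case.
move=> ->.
pose pos (y : 'I_n.+1 * 'I_M.+1 -> R) j : n.+1.-tuple R :=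
  [tuple (\sum_(l < c j) y (i, inord l))%R | i < n.+1].
pose B := [set v : #|{: 'I_n.+1 * 'I_M.+1}|.-tuple R | forall j, A j (pos (of_tuple v) j)].
have mB : measurable B.
  apply: (measurable_family_box (Y := fun j v => pos (of_tuple v) j)) => // j.
  apply: measurable_mktuple => i; apply: measurable_sum => l.
  exact: measurable_of_tuple.
pose G y : \bar R := (\1_B (to_tuple y))%:E.
have BE y : B (to_tuple y) = forall j, A j (pos y j).
  by rewrite /B /=; under eq_forall do rewrite (_ : of_tuple _ = y) ?to_tupleK//.
have mG : measurable_fun setT
    (fun v : #|{: 'I_n.+1 * 'I_M.+1}|.-tuple R => G (of_tuple v)).
  apply: (measurableT_comp (measurable_indic_ereal mB)).
  by apply: measurable_to_tuple => p; exact: measurable_of_tuple.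
have G0 y : 0 <= G y by rewrite lee_fin.
pose E' := [set w | forall j, A j (tuple_sub (xi (ts j) w) (xi 0%R w))].
pose D w := (tuple_sum (xi t w) - tuple_sum (xi 0%R w))%R.
have mxi a : (0 <= a)%R -> measurable_fun setT (xi a) by exact: (levy_tuple_measurable hxi).
have mD : measurable_fun setT D.
  by apply: measurable_funB; apply: measurable_tuple_sum; exact: mxi.
have mE' : measurable E'.
  apply: (measurable_family_box (Y := fun j w => tuple_sub (xi (ts j) w) (xi 0%R w))) => // j.
  by apply: measurable_mktuple => i; apply: measurable_funB; exact: (levy_tuple_coord hxi).
have inordE j (l : 'I_(c j)) : (inord l : 'I_M.+1) = l :> nat.
  by rewrite inordK// (leq_trans (ltn_ord l))// (leq_trans (cM j)).
transitivity (\int[nu]_z \int[P]_w ((\1_E' w)%:E * mixture t (D w, z))); last first.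
  apply: eq_integral => z _.
  transitivity ((\int[P]_w ((\1_E' w)%:E * f (T * (1 - t))%R (z - D w)%R)) / f T z).
    rewrite -ge0_integralZr//; last 3 first.
    - apply: emeasurable_funM; first exact: measurable_indic_ereal.
      by apply: (measurableT_comp (density_measurable hf (T1_gt0 t1))); exact: measurable_funB.
    - by move=> w _; apply: mule_ge0; rewrite ?lee_fin//;
        exact: (density_nonneg hf _ (T1_gt0 t1)).
    - by rewrite inve_ge0; exact: (density_nonneg hf _ tuple_sum_gt0).
    by apply: eq_integral => w _; rewrite -muleA.
  congr (_ / _); apply/esym.
  have := levy_interleaving hm hf hxi hg s0 ns sM t01 z mG G0.
  congr (_ = _); apply: eq_integral => w _; congr (_ * _).
  - congr (_%:E); apply: eq_indic; rewrite BE A'E.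
    have posE j : pos (fun p => X (clock p.1 (s p.2.+1)) w - X (clock p.1 (s p.2)) w)%R j
        = incr (fun p => X (r p) w - X 0 w)%R j.
      apply: eq_from_tnth => i; rewrite !tnth_mktuple /r /=.
      rewrite (eq_bigr (fun l : 'I_(c j) =>
        X (clock i (s l.+1)) w - X (clock i (s l)) w)%R).
        rewrite (sum_telescope _ (fun l => X (clock i (s l)) w)) sc s0; ring.
      by move=> l _; rewrite inordE.
    by split => h j; have := h j; rewrite posE.
  - congr (_%:E); apply: eq_indic; rewrite BE /E' /=.
    have posE j : pos (fun p => tnth (xi (s p.2.+1) w) p.1 - tnth (xi (s p.2) w) p.1)%R j
        = tuple_sub (xi (ts j) w) (xi 0%R w).
      apply: eq_from_tnth => i; rewrite !tnth_mktuple.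
      rewrite (eq_bigr (fun l : 'I_(c j) =>
        tnth (xi (s l.+1) w) i - tnth (xi (s l) w) i)%R).
        by rewrite (sum_telescope _ (fun l => tnth (xi (s l) w) i)) sc s0.
      by move=> l _; rewrite inordE.
    by split => h j; have := h j; rewrite posE.
rewrite (fubini_tonelli (m1 := nu) (m2 := P)
    (fun q => (\1_E' q.2)%:E * mixture t (D q.2, q.1))); last 2 first.
- apply: emeasurable_funM.
    by apply: (measurableT_comp (measurable_indic_ereal mE')); exact: measurable_snd.
  apply: (measurableT_comp (measurable_mixture t1)).
  apply: measurable_fun_pair; last exact: measurable_fst.
  exact: (measurableT_comp mD measurable_snd).
- by move=> q; apply: mule_ge0; rewrite ?lee_fin//; exact: mixture_ge0.
rewrite integral_mkcond.
have mE : measurable [set w | forall j, A j (xi (ts j) w)].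
  by apply: (measurable_family_box (Y := fun j w => xi (ts j) w)) => // j; exact: mxi.
have mTheta : measurable_fun setT (fun w => Theta f T nu t (tuple_sum (xi t w))).
  apply: (measurableT_comp (measurable_Theta t1)).
  by apply: measurable_tuple_sum; exact: mxi.
have mj : measurable_fun setT
    (fun q : Om * R => (\1_E' q.1)%:E * mixture t (D q.1, q.2)).
  apply: emeasurable_funM.
    by apply: (measurableT_comp (measurable_indic_ereal mE')); exact: measurable_fst.
  apply: (measurableT_comp (measurable_mixture t1)).
  apply: measurable_fun_pair; last exact: measurable_snd.
  exact: (measurableT_comp mD measurable_fst).
have j0 (q : Om * R) : 0 <= (\1_E' q.1)%:E * mixture t (D q.1, q.2).
  by apply: mule_ge0; rewrite ?lee_fin//; exact: mixture_ge0.
rewrite epatch_indic; apply: ge0_ae_eq_integral => //.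
- by apply: emeasurable_funM => //; exact: measurable_indic_ereal.
- exact: (@measurable_fun_fubini_tonelli_F _ _ Om (measurableTypeR R) R nu _ mj j0).
- by move=> w _; apply: mule_ge0; rewrite ?lee_fin//; exact: Theta_ge0.
- move=> w _; apply: integral_ge0 => z _.
  by apply: mule_ge0; rewrite ?lee_fin//; exact: mixture_ge0.
case: hxi => -[_ xi0 _ _] _.
apply: (@filterS _ _ (ae_filter_ringOfSetsType P) _ _ _ xi0) => w xi0w _ /=.
have mw : measurable_fun setT (fun z : R => mixture t (D w, z)).
  exact: (measurableT_comp (measurable_mixture t1) (measurable_pair1 (D w))).
have w0 z : 0 <= mixture t (D w, z) by exact: mixture_ge0.
rewrite ge0_integralZl ?lee_fin//.
have sum0 : tuple_sum (xi 0%R w) = 0%R.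
  by rewrite xi0w /tuple_sum big1// => i _; rewrite tnth_mktuple.
have DE : D w = tuple_sum (xi t w) by rewrite /D sum0 subr0.
rewrite mixture_Theta// ?DE; last by move=> ->.
rewrite muleC; congr (_%:E * _); apply: eq_indic; split => h j; have := h j.
  by congr (A j _); apply: eq_from_tnth => i; rewrite !tnth_mktuple xi0w tnth_mktuple subr0.
by congr (A j _); apply: eq_from_tnth => i; rewrite !tnth_mktuple xi0w tnth_mktuple subr0.
Qed.
End law.
End theta.

(** * Histories *)
Section histories.
Context {R : realType} {d : measure_display} {Om : measurableType d}.
Context n (xi : R -> Om -> n.-tuple R).
Implicit Types D : set R.

Lemma history_preimage D u (A : set (n.-tuple R)) : D u -> measurable A ->
  measurable (xi u @^-1` A : set (history xi D)).
Proof.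
move=> Du mA; apply: sub_sigma_algebra; exists u => //.
by exists A => //; rewrite setTI.
Qed.

Lemma measurable_history D u : D u ->
  measurable_fun [set: history xi D] (xi u : history xi D -> n.-tuple R).
Proof. by move=> Du _ A mA; rewrite setTI; exact: history_preimage. Qed.

Lemma measurable_into_history D {d'} {S : measurableType d'} (g : S -> Om) :
  (forall u, D u -> measurable_fun setT (xi u \o g)) ->
  measurable_fun setT (g : S -> history xi D).
Proof.
move=> mg; apply: (@measurability _ _ S (history xi D) setT g (history_gen xi D)) => //.
move=> _ [_ [u Du [A mA <-]] <-]; rewrite setTI.
by have := mg u Du measurableT A mA; rewrite !setTI.
Qed.

Lemma measurable_history_cylinder D k (ts : 'I_k -> R) (A : 'I_k -> set (n.-tuple R)) :
  (forall j, D (ts j)) -> (forall j, measurable (A j)) ->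
  measurable ([set w | forall j, A j (xi (ts j) w)] : set (history xi D)).
Proof.
move=> Dts mA; apply: (measurable_family_box
  (Y := fun j (w : history xi D) => xi (ts j) w)) => // j.
exact: measurable_history.
Qed.

(** Finite-dimensional cylinders generate the history, and they are stable under
    intersection because families of times may be concatenated. *)
Lemma history_measure_unique D (mu mu' : {measure set (history xi D) -> \bar R}) :
  (mu setT < +oo)%E ->
  (forall k (ts : 'I_k -> R) (A : 'I_k -> set (n.-tuple R)),
     (forall j, D (ts j)) -> (forall j, measurable (A j)) ->
     mu [set w | forall j, A j (xi (ts j) w)] = mu' [set w | forall j, A j (xi (ts j) w)]) ->
  forall A, measurable A -> mu A = mu' A.
Proof.
move=> mufin eqc.
pose G := [set B : set (history xi D) | exists k (ts : 'I_k -> R) A,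
  [/\ forall j, D (ts j), forall j, measurable (A j) &
      B = [set w | forall j, A j (xi (ts j) w)] ] ].
have mG : @measurable _ (history xi D) = <<s G >>.
  apply/seteqP; split; apply: smallest_sub; try exact: smallest_sigma_algebra.
    move=> _ [u Du [A mA <-]]; apply: sub_sigma_algebra.
    exists 1%N, (fun=> u), (fun=> A); split => //.
    by rewrite setTI; apply/seteqP; split => w /= h; [move=> _|exact: (h ord0)].
  by move=> _ [k [ts [A [Dts mA ->]]]]; exact: measurable_history_cylinder.
apply: (@measure_unique _ R (history xi D) G (fun=> setT) mG).
- move=> _ _ [k [ts [A [Dts mA ->]]]] [k' [ts' [A' [Dts' mA' ->]]]].
  exists (k + k')%N, (fun j : 'I_(k + k') =>
    match fintype.split j with inl i => ts i | inr i => ts' i end).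
  exists (fun j : 'I_(k + k') =>
    match fintype.split j with inl i => A i | inr i => A' i end); split.
  + by move=> j; case: fintype.split.
  + by move=> j; case: fintype.split.
  + apply/seteqP; split => w /=; first by move=> [h h'] j; case: fintype.split.
    move=> h; split => j.
      by have := h (unsplit (inl j)); rewrite unsplitK.
    by have := h (unsplit (inr j)); rewrite unsplitK.
- move=> _; exists 0%N, (fun=> 0), (fun=> setT); split; try by case.
  by apply/seteqP; split => // w _ [].
- by rewrite bigcup_const//; exists 0%N.
- by move=> _ [k [ts [A [Dts mA ->]]]]; exact: eqc.
- by [].
Qed.

End histories.

(** * The change of measure *)
Section change_of_measure.
Context {R : realType} n (m : n.+1.-tuple R) (hm : forall i, (0 < tnth m i)%R).
Context (nu : probability (measurableTypeR R) R).
Context {dX : measure_display} {OmX : measurableType dX}.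
Context (PX : probability OmX R) (X : R -> OmX -> R) (f : R -> R -> \bar R).
Local Notation T := (tuple_sum m).
Hypothesis hf : lrb_parameters f T nu PX X.
Context {d : measure_display} {Om : measurableType d}.
Context (P : probability Om R) (xi : R -> Om -> n.+1.-tuple R).
Hypothesis hxi : levy_process_tuple P xi.
Hypothesis hg : forall t : R, (0 < t)%R -> has_density_Rn P (xi t)
  (fun x => (\prod_(i < n.+1) f (tnth m i * t)%R (tnth x i))%E).
Local Open Scope ereal_scope.
Hypothesis hTheta : forall t : R, (0 <= t < 1)%R ->
  {ae P, forall w, 0 < Theta f T nu t (tuple_sum (xi t w)) < +oo}.
Variable Q : probability (seqspace ((R * R) * OmX)%type) R.
Hypothesis QE : forall n C, cylinder n C ->
  Q C = chain (bridge_kernel (tuple_sum_gt0 hm) hf) n 0 (point : (R * R) * OmX) C.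

Definition likelihood t w := Theta f T nu t (tuple_sum (xi t w)).
Local Notation Z := (fun t w => (likelihood t w)^-1).

Lemma likelihood_ge0 t w : (t < 1)%R -> 0 <= likelihood t w.
Proof. by move=> t1; apply: (Theta_ge0 hm hf). Qed.

Lemma measurable_history_likelihood D t : D t -> (t < 1)%R ->
  measurable_fun [set: history xi D] (likelihood t).
Proof.
move=> Dt t1; apply: (measurableT_comp (measurable_Theta hm hf t1)).
by apply: measurable_tuple_sum; exact: measurable_history.
Qed.

Lemma measurable_likelihood t : (0 <= t < 1)%R -> measurable_fun setT (likelihood t).
Proof.
move=> /andP[t0 t1]; apply: (measurableT_comp (measurable_Theta hm hf t1)).
by apply: measurable_tuple_sum; exact: (levy_tuple_measurable hxi).
Qed.

Definition tilted_measure t (t01 : (0 <= t < 1)%R) : {measure set Om -> \bar R} :=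
  density_measure P (measurable_likelihood t01)
    (fun w => likelihood_ge0 w (andP t01).2).

Lemma measurable_id_history D : (forall u, D u -> (0 <= u)%R) ->
  measurable_fun setT (id : Om -> history xi D).
Proof.
by move=> D0; apply: measurable_into_history => u /D0 u0; exact: (levy_tuple_measurable hxi).
Qed.

Lemma history_measurable D : (forall u, D u -> (0 <= u)%R) ->
  forall A : set (history xi D), measurable A -> @measurable _ Om A.
Proof.
by move=> D0 A mA; have := measurable_id_history D0 measurableT mA; rewrite setTI.
Qed.

Definition history_tilted (D : set R) (D0 : forall u, D u -> (0 <= u)%R) t
    (t01 : (0 <= t < 1)%R) : {measure set (history xi D) -> \bar R} :=
  image_measure (tilted_measure t01) (measurable_id_history D0).

Lemma history_tiltedE (D : set R) (D0 : forall u, D u -> (0 <= u)%R) t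
    (t01 : (0 <= t < 1)%R) (A : set (history xi D)) :
  history_tilted D0 t01 A = \int[P]_(w in A) likelihood t w.
Proof. by []. Qed.

Let itv_ge0 t (u : R) : `[0%R, t]%classic u -> (0 <= u)%R.
Proof. by rewrite /= in_itv/= => /andP[]. Qed.

Let itv_end (t : R) : (0 <= t < 1)%R -> `[0%R, t]%classic t.
Proof. by move=> /andP[t0 _]; rewrite /= in_itv/= t0 lexx. Qed.

Lemma likelihood_cylinder t s k (ts : 'I_k -> R) (A : 'I_k -> set (n.+1.-tuple R)) :
  (0 <= t < 1)%R -> (s <= t)%R -> (forall j, `[0%R, s]%classic (ts j)) ->
  (forall j, measurable (A j)) ->
  \int[P]_(w in [set w | forall j, A j (xi (ts j) w)]) likelihood t w =
  Q [set x | forall j, A j (glp_of_lrb m (bridge T X) (ts j) x)].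
Proof.
move=> t01 st tst mA; apply: (theta_fdd hxi hg QE) => // j.
by have := tst j; rewrite /= in_itv/= => /andP[-> /le_trans]; exact.
Qed.

Lemma likelihood_mass t : (0 <= t < 1)%R -> \int[P]_w likelihood t w = 1.
Proof.
move=> t01.
have := @likelihood_cylinder t t 0 (fun=> 0%R) (fun=> setT) t01 (lexx _).
rewrite [X in \int[P]_(w in X) _](_ : _ = setT); last first.
  by apply/seteqP; split => // w _ [].
rewrite [X in Q X](_ : _ = setT); last by apply/seteqP; split => // w _ [].
by rewrite probability_setT; apply; case.
Qed.

(** The reweighted measures agree on cylinders, where by [theta_fdd] both are the
    probabilities of the Liouville process. This is the martingale property of
    the likelihood. *)
Lemma likelihood_consistent s t : (0 <= s)%R -> (s <= t)%R -> (t < 1)%R ->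
  forall A : set (history xi `[0%R, s]), measurable A ->
  \int[P]_(w in A) likelihood s w = \int[P]_(w in A) likelihood t w.
Proof.
move=> s0 st t1 A mA.
have s01 : (0 <= s < 1)%R by rewrite s0 (le_lt_trans st).
have t01 : (0 <= t < 1)%R by rewrite (le_trans s0 st).
rewrite -(history_tiltedE (@itv_ge0 s) s01) -(history_tiltedE (@itv_ge0 s) t01).
have fin : history_tilted (@itv_ge0 s) s01 setT < +oo.
  by rewrite history_tiltedE likelihood_mass// ltry.
apply: (history_measure_unique fin _ mA) => k ts B tss mB.
rewrite !history_tiltedE (likelihood_cylinder s01 (lexx s) tss mB).
by rewrite (likelihood_cylinder t01 st tss mB).
Qed.

(** The factor likelihood * likelihood^-1 equals 1 where the likelihood is
    positive and finite, hence P-almost everywhere. *)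
Lemma likelihood_density t (t01 : (0 <= t < 1)%R)
    (Pt : {measure set (history xi `[0%R, t]) -> \bar R}) :
  (forall A : set (history xi `[0%R, t]), measurable A ->
     Pt A = \int[P]_(w in A) likelihood t w) ->
  [/\ measurable_fun [set: history xi `[0%R, t]] (Z t), forall w, 0 <= Z t w &
      forall A : set (history xi `[0%R, t]), measurable A ->
        P A = \int[Pt]_(w in A) Z t w].
Proof.
move=> PtE; have /andP[t0 t1] := t01.
have mZ : measurable_fun [set: history xi `[0%R, t]] (Z t).
  apply: measurable_inve; last by move=> w; exact: likelihood_ge0.
  by apply: measurable_history_likelihood => //; exact: itv_end.
have mZ' : measurable_fun [set: Om] (Z t).
  apply: measurable_inve; last by move=> w; exact: likelihood_ge0.
  exact: measurable_likelihood.
have Z0 w : 0 <= Z t w by rewrite inve_ge0 likelihood_ge0.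
split => // A mA.
have mA' := history_measurable (@itv_ge0 t) mA.
have mid := measurable_id_history (@itv_ge0 t).
transitivity (\int[image_measure (tilted_measure t01) mid]_(w in A) Z t w); last first.
  by apply: eq_measure_integral => B mB _; rewrite PtE.
rewrite [RHS](ge0_integral_pushforward mid)//; last exact: (measurable_funS measurableT).
transitivity (\int[tilted_measure t01]_w ((\1_A w)%:E * Z t w)); last first.
  by rewrite [RHS]integral_mkcond epatch_indic; apply: eq_integral => w _; rewrite muleC.
have mI : measurable_fun setT (fun w : Om => (\1_A w)%:E : \bar R).
  exact: measurable_indic_ereal.
rewrite integral_density; last 2 first.
- exact: emeasurable_funM.
- by move=> w; apply: mule_ge0; rewrite ?lee_fin.
transitivity (\int[P]_w (\1_A w)%:E).
  by rewrite integral_indic// setIT.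
have mlik := measurable_likelihood t01.
apply: ge0_ae_eq_integral => //.
- by apply: emeasurable_funM => //; exact: emeasurable_funM.
- by move=> w _; apply: mule_ge0; rewrite ?likelihood_ge0//; apply: mule_ge0; rewrite ?lee_fin.
apply: (@filterS _ _ (ae_filter_ringOfSetsType P) _ _ _ (hTheta t01)) => w /andP[w0 w1] _.
by rewrite -muleA (muleC (Z t w)) mulee_inv// mule1.
Qed.

(** If likelihood^-1 is the density of P with respect to Pt, then reweighting P
    by the likelihood restricts Pt to the set [good], where the likelihood is
    positive and finite. The total mass remains 1, so this set has full
    measure. *)
Lemma density_likelihood t (t01 : (0 <= t < 1)%R)
    (Pt : probability (history xi `[0%R, t]) R) :
  (forall A : set (history xi `[0%R, t]), measurable A -> P A = \int[Pt]_(w in A) Z t w) ->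
  forall A : set (history xi `[0%R, t]), measurable A ->
    Pt A = \int[P]_(w in A) likelihood t w.
Proof.
move=> PE; have /andP[t0 t1] := t01.
have mlik : measurable_fun [set: history xi `[0%R, t]] (likelihood t).
  by apply: measurable_history_likelihood => //; exact: itv_end.
have mlik' := measurable_likelihood t01.
have lik0 w : 0 <= likelihood t w by exact: likelihood_ge0.
have mZ : measurable_fun [set: history xi `[0%R, t]] (Z t) by exact: measurable_inve.
have Z0 w : 0 <= Z t w by rewrite inve_ge0 likelihood_ge0.
have mid := measurable_id_history (@itv_ge0 t).
pose good : set (history xi `[0%R, t]) := [set w | 0 < likelihood t w < +oo].
have mgood : measurable good.
  have := mlik measurableT _ (emeasurable_itv (Interval (BRight 0) (BLeft +oo))).
  rewrite setTI; congr (_ _); apply/seteqP; split => w;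
    by rewrite /good /= in_itv.
have goodE w : likelihood t w * Z t w = (\1_good w)%:E.
  rewrite indicE; have [wg|wg] := pselect (good w).
    by rewrite mem_set//; case/andP: wg => *; exact: mulee_inv.
  rewrite memNset//; move/negP : wg; rewrite negb_and -!leNgt leye_eq.
  move=> /orP[l0|/eqP ->]; last by rewrite invey mule0.
  have -> : likelihood t w = 0 by apply/eqP; rewrite eq_le l0 lik0.
  by rewrite mul0e.
have key (A : set (history xi `[0%R, t])) : measurable A ->
    \int[P]_(w in A) likelihood t w = Pt (A `&` good).
  move=> mA; have mA' := history_measurable (@itv_ge0 t) mA.
  transitivity (\int[image_measure P mid]_(w in A) likelihood t w).
    rewrite [RHS](ge0_integral_pushforward mid)//.
    exact: (measurable_funS measurableT).
  transitivity (\int[density_measure Pt mZ Z0]_(w in A) likelihood t w).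
    apply: eq_measure_integral => B mB _.
    exact: PE.
  rewrite integral_mkcond epatch_indic.
  have mI : measurable_fun setT (fun w : history xi `[0%R, t] => (\1_A w)%:E : \bar R).
    exact: measurable_indic_ereal.
  rewrite (integral_density Pt mZ Z0); last 2 first.
  - exact: emeasurable_funM.
  - by move=> w; apply: mule_ge0; rewrite ?lee_fin.
  transitivity (\int[Pt]_w (\1_(A `&` good) w)%:E).
    apply: eq_integral => w _.
    by rewrite muleAC goodE -EFinM mulrC indicI.
  by rewrite integral_indic ?setIT//; exact: measurableI.
move=> A mA; rewrite key//.
have goodT : Pt good = 1.
  by rewrite -(setTI good) -key// likelihood_mass.
have bad0 : Pt (~` good) = 0 by rewrite probability_setC// goodT subee.
rewrite (measure_setD_null mA _ bad0) ?setDE ?setCK//.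
exact: measurableC.
Qed.

End change_of_measure.

Section measure_probability.
Context {R : realType} {d} {T : measurableType d} (mu : {measure set T -> \bar R}).
Hypothesis mu1 : mu setT = 1%E.
Let law : set T -> \bar R := mu.
HB.instance Definition _ := Measure.copy law mu.
Let law1 : law setT = 1%E. Proof. exact: mu1. Qed.
HB.instance Definition _ := Measure_isProbability.Build _ _ _ law law1.

Lemma probability_of_measure : exists P : probability T R, forall A, P A = mu A.
Proof. by exists (law : probability T R). Qed.

End measure_probability.

Section liouville.
Context {R : realType} n (m : n.+1.-tuple R) (hm : forall i, (0 < tnth m i)%R).
Context (nu : probability (measurableTypeR R) R).
Context {dX : measure_display} {OmX : measurableType dX}.
Context (PX : probability OmX R) (X : R -> OmX -> R) (f : R -> R -> \bar R).
Local Notation T := (tuple_sum m).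
Hypothesis hf : lrb_parameters f T nu PX X.
Context {d : measure_display} {Om : measurableType d}.
Context (P : probability Om R) (xi : R -> Om -> n.+1.-tuple R).
Hypothesis hxi : levy_process_tuple P xi.
Hypothesis hg : forall t : R, (0 < t)%R -> has_density_Rn P (xi t)
  (fun x => (\prod_(i < n.+1) f (tnth m i * t)%R (tnth x i))%E).
Local Open Scope ereal_scope.
Hypothesis hTheta : forall t : R, (0 <= t < 1)%R ->
  {ae P, forall w, 0 < Theta f T nu t (tuple_sum (xi t w)) < +oo}.
Variable Q : probability (seqspace ((R * R) * OmX)%type) R.
Hypothesis QE : forall n C, cylinder n C ->
  Q C = chain (bridge_kernel (tuple_sum_gt0 hm) hf) n 0 (point : (R * R) * OmX) C.
Local Notation likelihood := (likelihood m nu f xi).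
Local Notation Z := (fun t w => (likelihood t w)^-1).
Local Notation L := (bridge T X).
Let T0 := tuple_sum_gt0 hm.

Let itv_ge0 t (u : R) : `[0%R, t]%classic u -> (0 <= u)%R.
Proof. by rewrite /= in_itv/= => /andP[]. Qed.

Lemma rn_unique P1 t (A : set (history xi `[0%R, t])) :
  RN_density_process xi P P1 Z -> (0 <= t < 1)%R -> measurable A ->
  P1 A = \int[P]_(w in A) likelihood t w.
Proof.
move=> rn t01 mA; have [Pt [-> // _ _ PE]] := rn t t01.
exact: (density_likelihood hxi hg QE t01 PE mA).
Qed.

(** An event that belongs to several histories is given the same probability by
    all of them, see [likelihood_consistent]; the choice of one is immaterial. *)
Lemma rn_exists : exists P1, RN_density_process xi P P1 Z.
Proof.
pose known (A : set Om) (t : R) :=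
  (0 <= t < 1)%R /\ measurable (A : set (history xi `[0%R, t])).
exists (fun A => if pselect (exists t, known A t) is left e
  then \int[P]_(w in A) likelihood (projT1 (cid e)) w else 0).
move=> t t01.
have [|Pt PtE] := probability_of_measure
    (mu := history_tilted hm hf hxi (@itv_ge0 t) t01).
  by rewrite history_tiltedE (likelihood_mass hxi hg QE).
exists Pt.
have PtE' (A : set (history xi `[0%R, t])) : measurable A ->
    Pt A = \int[P]_(w in A) likelihood t w.
  by move=> mA; rewrite PtE history_tiltedE.
have [mZ Z0 PZ] := likelihood_density hm hf hxi hTheta t01 PtE'.
split => // A mA; rewrite PtE'//.
case: pselect => [e|[]]; last by exists t; split.
case: cid => s [/= s01 mA'].
have /andP[s0 s1] := s01; have /andP[t0 t1] := t01.
have [st|ts] := leP s t.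
  exact: (likelihood_consistent hxi hg QE s0 st t1 mA').
by apply/esym; exact: (likelihood_consistent hxi hg QE t0 (ltW ts) s1 mA).
Qed.

Lemma rn_glp P1 : (2 <= n.+1)%N -> RN_density_process xi P P1 Z ->
  is_glp f nu m P1 xi.
Proof.
move=> n2 rn; split => //; exists _, _, Q, L; split.
  exact: (bridge_is_lrb QE).
move=> k ts A ts01 mA.
pose t : R := \big[Num.max/0%R]_(j < k) ts j.
have t0 : (0 <= t)%R by exact: bigmax_ge_id.
have t1 : (t < 1)%R.
  by apply: bigmax_lt => // j _; have := ts01 j; rewrite /= in_itv/= => /andP[].
have t01 : (0 <= t < 1)%R by rewrite t0.
have tst j : `[0%R, t]%classic (ts j).
  rewrite /= in_itv/=; have := ts01 j; rewrite /= in_itv/= => /andP[-> _].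
  exact: le_bigmax.
rewrite (rn_unique rn t01); last exact: measurable_history_cylinder.
exact: (likelihood_cylinder hxi hg QE t01 (lexx t) tst mA).
Qed.

Lemma cadlag_glp x :
  cadlag_tuple `[0%R, +oo[ (fun t => glp_of_lrb m L (Num.min t 1%R) x).
Proof.
move=> i; rewrite (_ : (fun t => _) = (fun t => L (clock m i (Num.min t 1%R)) x +
    - L (partial_activity m i) x)%R); last first.
  apply/funext => t; rewrite tnth_mktuple /clock (tnth_nth 0%R).
  by congr (L _ x - _)%R; ring.
apply: cadlagD; last exact: cadlag_cst.
apply: (@cadlag_comp _ `[0%R, T] _ (L^~ x)).
- exact: (cadlag_bridge T0 hf).
- move=> s t st; apply: clock_le => //; rewrite le_min.
  by rewrite ge_min st ge_min lexx orbT.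
- move=> t; have cm : {for t, continuous (fun u : R => Num.min u 1 : R^o)%R}.
    by apply: continuous_min; [exact: cvg_id|exact: cvg_cst].
  by apply: cvgD; [exact: cvg_cst|apply: cvgM => //; exact: cvg_cst].
- move=> t; rewrite /= !in_itv/= andbT => t0.
  have c0 : (0 <= Num.min t 1)%R by rewrite le_min t0 ler01.
  have c1 : (Num.min t 1 <= 1)%R by rewrite ge_min lexx orbT.
  rewrite (le_trans (partial_activity_ge0 hm i)) -?clock0 ?clock_le//=.
  rewrite (le_trans (clock_lt hm i c1))// -partial_activity_sum.
  by apply: partial_activity_homo => //; exact: ltn_ord.
Qed.

(** Each outcome x of the bridge is sent to an outcome of xi with the trajectory
    of the Liouville process at x, frozen at time 1; the image of the law of the
    bridge has the right finite-dimensional laws. *)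
Lemma rn_trajectories : all_trajectories xi ->
  exists P1 : probability (history xi `[0%R, 1%R[) R, RN_density_process xi P P1 Z.
Proof.
move=> all_xi.
have h x : exists w, forall t, (0 <= t)%R ->
    xi t w = glp_of_lrb m L (Num.min t 1%R) x.
  apply: all_xi; first exact: cadlag_glp.
  apply: eq_from_tnth => i; rewrite !tnth_mktuple min_l ?ler01//.
  by rewrite mul0r add0r subrr.
pose phi x := projT1 (cid (h x)).
have phiE x t : (0 <= t < 1)%R -> xi t (phi x) = glp_of_lrb m L t x.
  move=> /andP[t0 t1]; rewrite /phi; case: cid => w /= -> //.
  by rewrite min_l// ltW.
have mglp t : measurable_fun setT (glp_of_lrb m L t).
  by apply: measurable_mktuple => i; apply: measurable_funB; exact: (measurable_bridge hf).
have mphi : measurable_fun setT (phi : _ -> history xi `[0%R, 1%R[).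
  apply: measurable_into_history => u; rewrite /= in_itv/= => u01.
  by rewrite (_ : _ \o _ = glp_of_lrb m L u)//; apply/funext => x; exact: phiE.
have [|P1 P1E] := probability_of_measure (mu := image_measure Q mphi).
  exact: probability_setT.
exists P1 => t t01; have /andP[t0 t1] := t01.
have mid : measurable_fun setT (id : history xi `[0%R, 1%R[ -> history xi `[0%R, t]).
  apply: measurable_into_history => u; rewrite /= in_itv/= => /andP[u0 ut].
  by apply: measurable_history; rewrite /= in_itv/= u0 (le_lt_trans ut).
have [|Pt PtE] := probability_of_measure (mu := image_measure P1 mid).
  exact: probability_setT.
exists Pt.
have Ptcyl (A : set (history xi `[0%R, t])) : measurable A ->
    Pt A = \int[P]_(w in A) likelihood t w.
  move=> mA; rewrite -(history_tiltedE hm hf hxi (@itv_ge0 t) t01).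
  apply: history_measure_unique => //; first by rewrite probability_setT ltry.
  move=> k ts B tst mB.
  rewrite history_tiltedE (likelihood_cylinder hxi hg QE t01 (lexx t) tst mB).
  rewrite PtE -[LHS]/(P1 _) P1E; congr (Q _); apply/seteqP; split => x /= hx j;
    have := hx j; rewrite phiE//; have := tst j; rewrite /= in_itv/= => /andP[-> ut];
    exact: le_lt_trans t1.
have [mZ Z0 PZ] := likelihood_density hm hf hxi hTheta t01 Ptcyl.
by split => // A mA; rewrite PtE.
Qed.

End liouville.

Theorem corollary3p8 (R : realType)
    (n : nat) (hn : (2 <= n)%N)
    (m : n.-tuple R) (hm : forall i, 0 < tnth m i)
    (nu : probability (measurableTypeR R) R)
    (hnu : no_continuous_singular_part nu)
    (* the Levy process X with densities f *)
    (dX : measure_display) (OmegaX : measurableType dX)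
    (PX : probability OmegaX R) (X : R -> OmegaX -> R)
    (f : R -> R -> \bar R)
    (hf : lrb_parameters f (tuple_sum m) nu PX X)
    (* the R^n-valued Levy process xi under Ptilde *)
    (d : measure_display) (Omega : measurableType d)
    (Ptilde : probability Omega R) (xi : R -> Omega -> n.-tuple R)
    (hxi : levy_process_tuple Ptilde xi)
    (hg : forall t : R, 0 < t ->
       has_density_Rn Ptilde (xi t)
         (fun x => (\prod_(i < n) f (tnth m i * t)%R (tnth x i))%E))
    (hTheta : forall t : R, 0 <= t < 1 ->
       {ae Ptilde, forall w,
         (0 < Theta f (tuple_sum m) nu t (tuple_sum (xi t w)) < +oo)%E}) :
  let Z t w := ((Theta f (tuple_sum m) nu t (tuple_sum (xi t w)))^-1)%E in
  [/\ (* the density process defines P on every F_t with t < 1 ... *)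
      exists P : set Omega -> \bar R, RN_density_process xi Ptilde P Z,
      (* ... uniquely, ... *)
      forall P Q : set Omega -> \bar R,
        RN_density_process xi Ptilde P Z -> RN_density_process xi Ptilde Q Z ->
        forall t : R, 0 <= t < 1 ->
        forall A : set (history xi `[0, t]), measurable A -> P A = Q A,
      (* ... P is a probability measure on sigma(xi_u : 0 <= u < 1) provided
         that Omega has enough trajectories, ... *)
      all_trajectories xi ->
        exists P : probability (history xi `[0, 1[) R,
          RN_density_process xi Ptilde P Z &
      (* ... and xi is a GLP under P *)
      forall P : set Omega -> \bar R,
        RN_density_process xi Ptilde P Z -> is_glp f nu m P xi].
Proof.
case: n hn m hm hf xi hxi hg hTheta => [//|n'] n2 m' m0 hf' xi' hxi' hg' hTheta' Z.
have [Q QE] := ionescu_tulcea (bridge_kernel (tuple_sum_gt0 m0) hf')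
  (point : (R * R) * OmegaX).
split.
- exact: (rn_exists hxi' hg' hTheta' QE).
- move=> P1 P2 rn1 rn2 t t01 A mA.
  by rewrite (rn_unique hxi' hg' QE rn1 t01 mA) (rn_unique hxi' hg' QE rn2 t01 mA).
- exact: (rn_trajectories hxi' hg' hTheta' QE).
- by move=> P1 rn; exact: (rn_glp hxi' hg' QE n2 rn).
Qed.
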